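(* Let $A$ be a $2\times2$ matrix function defined on $\mathcal{R}=[0,1]\times[0,1]$ with $M=\|A\|_\infty$. There exists an invertible solution $P$ to $\bar\partial P=AP$ in $\mathcal{R}$ with the property that $$\|P\|+\|P^{-1}\|\le\exp\left[CM^2(\log M)^2\right],$$ where $C>0$ is a constant.
   Context: $\mathbb{R}^2$ is identified with $\mathbb{C}$, $z=x+iy$, and $\bar\partial=\frac12(\partial_x+i\partial_y)$. The solution $P$ is a $2\times2$ matrix-valued function on $\mathcal{R}$. For a matrix, $\|\cdot\|$ denotes the operator norm. For a $2\times2$ matrix function $A=(a_{ij})$, $\|A\|_\infty=\sup_{i,j=1,2}\|a_{ij}\|_{L^\infty}$.
   Formalization: As stated the bound fails (at M=1 its right side is 1, but ‖P‖+‖P⁻¹‖≥2); it is proved for every δ>0 with C=C(δ), for all A with M²(log M)²≥δ; A is taken Borel measurable and the equation holds in the distributional sense in the interior. *)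

(* Defs.v *)
From HB Require Import structures.
From mathcomp Require Import all_boot all_order all_algebra.
From mathcomp Require Import complex.
From mathcomp Require Import all_classical all_reals all_analysis.

Set Implicit Arguments.
Unset Strict Implicit.
Unset Printing Implicit Defensive.

Import Order.TTheory GRing.Theory Num.Theory.
Import numFieldNormedType.Exports.

Local Open Scope classical_set_scope.
Local Open Scope complex_scope.
Local Open Scope ring_scope.

Section PlaneDbar.
Variable R : realType.

(* The point z = x + iy of the plane is the pair (x, y) : R * R. *)
Definition square : set (R * R) := `[0, 1] `*` `[0, 1].

Definition open_square : set (R * R) := `]0, 1[ `*` `]0, 1[.

Local Notation leb2 := (@lebesgue_measure R \x @lebesgue_measure R)%E.

Definition cmeasurable_fun (D : set (R * R)) (f : R * R -> R[i]) : Prop :=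
  measurable_fun D (fun z => complex.Re (f z)) /\ measurable_fun D (fun z => complex.Im (f z)).

Definition ccontinuous_in (D : set (R * R)) (f : R * R -> R[i]) : Prop :=
  {in D, continuous (fun z => complex.Re (f z))} /\
  {in D, continuous (fun z => complex.Im (f z))}.

Definition cintegral (D : set (R * R)) (f : R * R -> R[i]) : R[i] :=
  (\int[leb2]_(z in D) complex.Re (f z)) +i* (\int[leb2]_(z in D) complex.Im (f z)).

(* L^oo norm over the square; extending |f| by 0 off the square does not change
   its essential supremum. *)
Definition Linfty_norm (f : R * R -> R[i]) : \bar R :=
  'N[leb2]_(+oo%E)[(fun z => (Normc.normc (f z))%:E) \_ square]%E.

Definition mx_Linfty_norm (A : R * R -> 'M[R[i]]_2) : \bar R :=
  ereal_sup [set Linfty_norm (fun z => A z ij.1 ij.2) | ij in [set: 'I_2 * 'I_2]].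

Definition l2norm (v : 'cV[R[i]]_2) : R :=
  Num.sqrt (\sum_(i < 2) Normc.normc (v i 0) ^+ 2).

Definition opnorm (B : 'M[R[i]]_2) : R :=
  sup [set l2norm (B *m v) | v in [set v : 'cV[R[i]]_2 | l2norm v <= 1]].

Definition sup_opnorm (F : R * R -> 'M[R[i]]_2) : \bar R :=
  ereal_sup [set (opnorm (F z))%:E | z in square].

Definition iter_derive (s : seq (R * R)) (phi : R * R -> R) : R * R -> R :=
  foldr (fun v (g : R * R -> R) z => 'D_v g z) phi s.

(* C^oo: all iterated directional derivatives exist and are continuous. *)
Definition smooth (phi : R * R -> R) : Prop :=
  forall s : seq (R * R),
    continuous (iter_derive s phi) /\
    (forall z v : R * R, derivable (iter_derive s phi) z v).

Definition test_function (D : set (R * R)) (phi : R * R -> R) : Prop :=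
  smooth phi /\
  exists K : set (R * R),
    [/\ compact K, K `<=` D & forall z, ~ K z -> phi z = 0].

Definition dbar (phi : R * R -> R) (z : R * R) : R[i] :=
  (2^-1)%:C *
  ('D_((1, 0) : R * R) phi z +i* 'D_((0, 1) : R * R) phi z).

(* As A is only bounded and measurable, dbar P = A P is understood in the sense
   of distributions in the interior of the square, P being the continuous
   representative. Real test functions suffice, by complex linearity. *)
Definition dbar_solution (A P : R * R -> 'M[R[i]]_2) : Prop :=
  (forall i j, ccontinuous_in open_square (fun z => P z i j)) /\
  (forall phi, test_function open_square phi -> forall i j,
    cintegral open_square (fun z => P z i j * dbar phi z) =
    - cintegral open_square (fun z => (A z *m P z) i j * (phi z)%:C)).

End PlaneDbar.

(* Main.v *)
(* Kernels with a Gaussian factor invert d-bar with norm O(1/sqrt L) on the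
   functions bounded by the weight exp(L y^2).  When L is a large multiple of
   M^2 + 1, a Neumann series therefore produces, near any holomorphic vector
   (h, g), a solution of the system for column vectors.  Sums of Gaussian waves
   over even and over odd indices give holomorphic functions h, g, bounded by
   the weight, with max(|h|, |g|) comparable to it.  This gives a solution u
   near (h, g), hence bounded below, and two auxiliary solutions s, r near
   (0, h), (g, 0).  A combination of s and r, corrected by a multiple of u, is a
   second column v with det(u, v) = exp(S(tr A)), S being an inverse of d-bar.
   All entries are at most exp(C (M^2 + 1)), and M^2 + 1 is at most a constant
   times M^2 (ln M)^2 as soon as the latter is bounded below. *)
Require Import Defs.
From HB Require Import structures.
From mathcomp Require Import all_boot all_order all_algebra.
From mathcomp Require Import complex.
From mathcomp Require Import all_classical all_reals all_analysis.
From mathcomp Require Import measurable_realfun ess_sup_inf ring lra zify.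

Set Implicit Arguments.
Unset Strict Implicit.
Unset Printing Implicit Defensive.

Import Order.TTheory GRing.Theory Num.Theory.
Import numFieldNormedType.Exports.

Local Open Scope classical_set_scope.
Local Open Scope complex_scope.
Local Open Scope ring_scope.

(** * Measurability in the plane *)

(** The plain Cauchy transform has norm of order one on bounded functions, so its Neumann series
    converges only for small [M]. The weight [exp(L y^2)] buys a norm of order [1/sqrt L] at the
    price of a factor [exp(L)], and a contraction then costs [L] of order [M^2]: this is the origin
    of the exponent. The obstacle is a lower bound relative to the weight. A zero-free holomorphic
    function cannot be comparable to [exp(L y^2)] up to fixed factors when [L] is large: its
    log-modulus is harmonic, whereas [L y^2] stays at distance of order [L] from harmonic functions.
    So a single sum must have zeros, and two sums without approximate common zero are used. For the
    same reason two columns near holomorphic pairs cannot have a determinant comparable to the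
    square of the weight. The second column is therefore not a Neumann solution: its coefficients on
    [s] and [r] contain the non-holomorphic factors [conj(h)^2] and [conj(g)^2], and Cramer's
    identity shows that the d-bar error so created points along [u]. Derivatives being
    distributional, all this algebra takes place in the class [mult]. *)

Section plane_measurability.
Variable R : realType.
Implicit Types (O E : set (R * R)) (f : R * R -> R).

(** Boxes with rational centres and radii [1/(n+1)] form a countable base of the plane, and each box
    is a measurable rectangle. *)
Lemma open_measurable_plane O : open O -> measurable O.
Proof.
move=> oO.
pose box (p : rat * rat * nat) : set (R * R) :=
  ball (ratr p.1.1 : R) p.2.+1%:R^-1 `*` ball (ratr p.1.2 : R) p.2.+1%:R^-1.
(* Boxes that leave [O] are replaced by the empty set, so that the union runs over a whole countable
   type. *)
pose B p := if `[< box p `<=` O >] then box p else set0.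
suff -> : O = \bigcup_p B p.
  apply: countable_bigcupT_measurable => // p; rewrite /B; case: ifP => // _.
  by apply: measurableX; exact: measurable_realfun.measurable_ball.
apply/seteqP; split => [z Oz|z [p _]]; last first.
  by rewrite /B; case: ifPn => // /asboolP; apply.
have /nbhs_ballP[e/= e0 zeO] : nbhs z O by exact: open_nbhs_nbhs.
have [n [d [d0 ne dE]]] : exists n d, [/\ 0 < d, d < e / 2 & n.+1%:R^-1 = d :> R].
  have e20 : 0 < e / 2 by rewrite divr_gt0.
  exists (Num.truncn (e / 2)^-1); eexists; split; last by [].
    by rewrite invr_gt0.
  by rewrite invf_plt ?posrE// truncnS_gt.
have approx (t : R) : exists q : rat, ball (ratr q : R) d t.
  have /rat_in_itvoo[q] : t - d < t + d by lra.
  rewrite in_itv/= => /andP[q1 q2]; exists q.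
  by rewrite ball_itv/= in_itv/=; apply/andP; split; lra.
have [q1 q1P] := approx z.1; have [q2 q2P] := approx z.2.
exists (q1, q2, n) => //; rewrite /B asboolT; first by rewrite /box/= dE.
move=> w [/= w1 w2]; apply: zeO; rewrite dE in w1 w2; move: q1P q2P w1 w2.
rewrite !ball_itv/= !in_itv/= => /andP[? ?] /andP[? ?] /andP[? ?] /andP[? ?].
by split; rewrite ball_itv/= in_itv/=; apply/andP; split; lra.
Qed.

Lemma continuous_measurable_plane O f :
  open O -> {in O, continuous f} -> measurable_fun O f.
Proof.
move=> oO; rewrite -(continuous_open_subspace f oO) => cf mO.
move: mO; apply: (measurability _ (RGenOpens.measurableE R)).
move=> _ [_ [a [b ->] <-]]; apply: open_measurable_plane.
have /continuousP /(_ _ (@interval_open _ (BRight a) (BLeft b) isT isT)) := cf.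
by move=> /open_subspaceP[V oV VO]; rewrite setIC -VO; exact: openI.
Qed.

Lemma open_square_open : open (@open_square R).
Proof.
have -> : @open_square R = (fst @^-1` `]0, 1[%classic) `&` (snd @^-1` `]0, 1[%classic).
  by [].
apply: openI; apply: open_comp => //; try exact: interval_open.
  by move=> z _; exact: cvg_fst.
by move=> z _; exact: cvg_snd.
Qed.

Lemma open_square_sub : @open_square R `<=` @square R.
Proof.
move=> z [] /=; rewrite !in_itv/= => /andP[? ?] /andP[? ?].
by split; rewrite /= in_itv/=; apply/andP; split; exact: ltW.
Qed.

Lemma measurable_open_square : measurable (@open_square R).
Proof. apply: open_measurable_plane; exact: open_square_open. Qed.

Lemma square_measure : (@lebesgue_measure R \x @lebesgue_measure R)%E (@open_square R) = 1%E.
Proof.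
rewrite [LHS]product_measure1E//= lebesgue_measure_itv/= lte_fin ltr01.
by rewrite oppr0 adde0 mule1.
Qed.

(** The inverse of 0 is 0 by convention, hence a discontinuity there; the point 0 is split off and
    continuity is used on its open complement. *)
Lemma measurable_inv : measurable_fun [set: R] (@GRing.inv R).
Proof.
have -> : [set: R] = [set 0] `|` ~` [set 0] by rewrite setUv.
have o0 : open (~` [set (0:R)]) by exact/closed_openC/closed_eq.
apply/measurable_funU => //; first exact: measurableC.
split; first exact: measurable_fun_set1.
apply: open_continuous_measurable_fun => // x /set_mem/= /eqP x0.
exact: inv_continuous.
Qed.

End plane_measurability.

(** * Complex-valued functions *)

Notation cRe := complex.Re.
Notation cIm := complex.Im.
Notation nc := Normc.normc.

Lemma eq_ler (R : realType) (x y : R) : x = y -> x <= y.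
Proof. by move->. Qed.

Section complex_numbers.
Variable R : realType.
Implicit Types (x y z w : R[i]).

Lemma cReD x y : cRe (x + y) = cRe x + cRe y. Proof. by case: x; case: y. Qed.
Lemma cImD x y : cIm (x + y) = cIm x + cIm y. Proof. by case: x; case: y. Qed.
Lemma cReN x : cRe (- x) = - cRe x. Proof. by case: x. Qed.
Lemma cImN x : cIm (- x) = - cIm x. Proof. by case: x. Qed.
Lemma cReM x y : cRe (x * y) = cRe x * cRe y - cIm x * cIm y.
Proof. by case: x; case: y. Qed.
Lemma cImM x y : cIm (x * y) = cRe x * cIm y + cIm x * cRe y.
Proof. by case: x => a b; case: y => c d /=; rewrite mulrC (mulrC b). Qed.
Lemma cRe_conj x : cRe (conjc x) = cRe x. Proof. by case: x. Qed.
Lemma cIm_conj x : cIm (conjc x) = - cIm x. Proof. by case: x. Qed.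
Definition cRI := (cReD, cImD, cReN, cImN, cReM, cImM, cRe_conj, cIm_conj).

Lemma complex_eq x y : cRe x = cRe y -> cIm x = cIm y -> x = y.
Proof. by case: x => a b; case: y => c d /= -> ->. Qed.

Lemma ncE x : nc x = Num.sqrt (cRe x ^+ 2 + cIm x ^+ 2). Proof. by case: x. Qed.
Lemma nc_ge0 x : 0 <= nc x. Proof. by rewrite ncE sqrtr_ge0. Qed.
Lemma nc_sqr x : nc x ^+ 2 = cRe x ^+ 2 + cIm x ^+ 2.
Proof. by rewrite ncE sqr_sqrtr// addr_ge0// sqr_ge0. Qed.
Lemma nc0 : nc (0 : R[i]) = 0. Proof. exact: Normc.normc0. Qed.
Lemma nc1 : nc (1 : R[i]) = 1. Proof. exact: Normc.normc1. Qed.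
Lemma ncM x y : nc (x * y) = nc x * nc y. Proof. exact: Normc.normcM. Qed.
Lemma ncV x : nc x^-1 = (nc x)^-1. Proof. exact: Normc.normcV. Qed.
Lemma ncN x : nc (- x) = nc x. Proof. exact: normcN. Qed.
Lemma ncD x y : nc (x + y) <= nc x + nc y. Proof. exact: le_normcD. Qed.
Lemma ncB x y : nc (x - y) <= nc x + nc y.
Proof. by rewrite -(ncN y); exact: ncD. Qed.
Lemma nc_eq0 x : (nc x == 0) = (x == 0).
Proof. by apply/eqP/eqP => [/Normc.eq0_normc//|->]; rewrite nc0. Qed.
Lemma nc_gt0 x : (0 < nc x) = (x != 0).
Proof. by rewrite lt_neqAle nc_ge0 andbT eq_sym nc_eq0. Qed.
Lemma nc_real (a : R) : nc a%:C = `|a|.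
Proof. by rewrite ncE/= expr0n/= addr0 sqrtr_sqr. Qed.
Lemma nc_nat n : nc (n%:R : R[i]) = n%:R.
Proof. by rewrite -(rmorph_nat (real_complex R)) nc_real ger0_norm. Qed.
Lemma nc_conj x : nc (conjc x) = nc x.
Proof. by rewrite !ncE !cRI sqrrN. Qed.
Lemma ncX x n : nc (x ^+ n) = nc x ^+ n.
Proof. by elim: n => [|n IH]; rewrite ?expr0 ?nc1// !exprS ncM IH. Qed.
Lemma nc_distC x y : nc (x - y) = nc (y - x). Proof. by rewrite -ncN opprB. Qed.
Lemma nc_dist_ge x y : nc x - nc y <= nc (x - y).
Proof. by rewrite lerBlDr -[in leLHS](subrK y x) ncD. Qed.
Lemma nc_sum (I : Type) (r : seq I) (P : pred I) (F : I -> R[i]) :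
  nc (\sum_(i <- r | P i) F i) <= \sum_(i <- r | P i) nc (F i).
Proof.
elim/big_rec2: _ => [|i a b _ ab]; first by rewrite nc0.
by rewrite (le_trans (ncD _ _))// lerD2l.
Qed.

Lemma abs_cRe x : `|cRe x| <= nc x.
Proof. by rewrite ncE -sqrtr_sqr ler_wsqrtr// lerDl sqr_ge0. Qed.
Lemma abs_cIm x : `|cIm x| <= nc x.
Proof. by rewrite ncE -sqrtr_sqr ler_wsqrtr// lerDr sqr_ge0. Qed.
Lemma nc_leD x : nc x <= `|cRe x| + `|cIm x|.
Proof.
rewrite -(ler_pXn2r (ltn0Sn 1)) ?nnegrE ?nc_ge0 ?addr_ge0// nc_sqr.
rewrite sqrrD !real_normK ?num_real// -addrA lerD2l lerDr mulrn_wge0//.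
Qed.

Lemma cRe_inv x : cRe x^-1 = cRe x / (cRe x ^+ 2 + cIm x ^+ 2).
Proof. by case: x. Qed.
Lemma cIm_inv x : cIm x^-1 = - cIm x / (cRe x ^+ 2 + cIm x ^+ 2).
Proof. by case: x => a b; rewrite /= mulNr. Qed.

Definition cexp z : R[i] := (expR (cRe z) * cos (cIm z)) +i* (expR (cRe z) * sin (cIm z)).

Lemma cexpD z w : cexp (z + w) = cexp z * cexp w.
Proof.
by apply: complex_eq; rewrite !cRI/= !cRI expRD ?cosD ?sinD; ring.
Qed.
Lemma cexp0 : cexp 0 = 1.
Proof. by apply: complex_eq; rewrite /= expR0 ?cos0 ?sin0 ?mulr0 ?mulr1. Qed.
Lemma nc_cexp z : nc (cexp z) = expR (cRe z).
Proof.
rewrite ncE/= !exprMn -mulrDr cos2Dsin2 mulr1 sqrtr_sqr ger0_norm//.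
Qed.
Lemma cexp_neq0 z : cexp z != 0.
Proof. by rewrite -nc_gt0 nc_cexp expR_gt0. Qed.
Lemma cexpN z : cexp (- z) = (cexp z)^-1.
Proof.
by apply: (mulfI (cexp_neq0 z)); rewrite -cexpD subrr cexp0 divff// cexp_neq0.
Qed.
Lemma cexp_conj z : conjc (cexp z) = cexp (conjc z).
Proof. by apply: complex_eq; rewrite !cRI/= !cRI ?cosN// sinN mulrN. Qed.
Lemma cexpMn z n : cexp (z *+ n) = cexp z ^+ n.
Proof. by elim: n => [|n IH]; rewrite ?mulr0n ?cexp0// mulrS cexpD IH exprS. Qed.

End complex_numbers.

(** * Continuity of complex-valued functions, through real and imaginary parts *)

Section complex_continuity.
Variables (R : realType) (T : topologicalType).
Local Notation C := R[i].
Implicit Types (z : T) (f g : T -> C).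

Definition ccont z f := {for z, continuous (fun z => cRe (f z))} /\
  {for z, continuous (fun z => cIm (f z))}.

Lemma ccont_cst z (c : C) : ccont z (fun=> c).
Proof. by split; exact: cst_continuous. Qed.

Lemma ccontD z f g : ccont z f -> ccont z g -> ccont z (fun z => f z + g z).
Proof.
move=> [? ?] [? ?]; split; rewrite (funext (fun _ => cReD _ _), funext (fun _ => cImD _ _));
  exact: continuousD.
Qed.

Lemma ccontN z f : ccont z f -> ccont z (fun z => - f z).
Proof.
by move=> [? ?]; split; rewrite (funext (fun _ => cReN _), funext (fun _ => cImN _));
  exact: continuousN.
Qed.

Lemma ccontB z f g : ccont z f -> ccont z g -> ccont z (fun z => f z - g z).
Proof. by move=> ? ?; apply: ccontD => //; exact: ccontN. Qed.

Lemma ccontM z f g : ccont z f -> ccont z g -> ccont z (fun z => f z * g z).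
Proof.
move=> [? ?] [? ?]; split; rewrite (funext (fun _ => cReM _ _), funext (fun _ => cImM _ _)).
  by apply: continuousB; exact: continuousM.
by apply: continuousD; exact: continuousM.
Qed.

Lemma ccont_conj z f : ccont z f -> ccont z (fun z => conjc (f z)).
Proof.
move=> [? ?]; split; rewrite (funext (fun _ => cRe_conj _), funext (fun _ => cIm_conj _)) //.
exact: continuousN.
Qed.

Lemma ccont_cexp z f : ccont z f -> ccont z (fun z => cexp (f z)).
Proof.
move=> [cr ci]; split => /=; apply: continuousM.
- by apply: continuous_comp cr _; exact: continuous_expR.
- by apply: continuous_comp ci _; exact: continuous_cos.
- by apply: continuous_comp cr _; exact: continuous_expR.
- by apply: continuous_comp ci _; exact: continuous_sin.
Qed.

Lemma ccont_eq z f g : f =1 g -> ccont z f -> ccont z g.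
Proof. by move=> /funext ->. Qed.

Lemma ccontP z f : ccont z f <->
  forall e, 0 < e -> \forall w \near z, nc (f w - f z) < e.
Proof.
split=> [[cr ci] e e0|h].
  have e2 : 0 < e / 2 by rewrite divr_gt0.
  have /cvgrPdist_lt /(_ _ e2) hr := cr.
  have /cvgrPdist_lt /(_ _ e2) hi := ci.
  near=> w; rewrite (le_lt_trans (nc_leD _))// !cRI (splitr e) ltrD//.
    by rewrite distrC; near: w.
  by rewrite distrC; near: w.
split; apply/cvgrPdist_lt => e e0; near=> w; rewrite distrC.
  have -> : cRe (f w) - cRe (f z) = cRe (f w - f z) by rewrite !cRI.
  by rewrite (le_lt_trans (abs_cRe _))//; near: w; exact: h.
have -> : cIm (f w) - cIm (f z) = cIm (f w - f z) by rewrite !cRI.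
by rewrite (le_lt_trans (abs_cIm _))//; near: w; exact: h.
Unshelve. all: by end_near. Qed.

Lemma ccont_lim z f : (forall e, 0 < e -> exists2 g, ccont z g &
  \forall w \near z, nc (f w - g w) <= e) -> ccont z f.
Proof.
move=> h; apply/ccontP => e e0.
have e3 : 0 < e / 3 by rewrite divr_gt0.
have [g /ccontP/(_ _ e3) cg fg] := h _ e3.
have fgz : nc (f z - g z) <= e / 3 by exact: nbhs_singleton fg.
near=> w.
have -> : f w - f z = (f w - g w) + (g w - g z) - (f z - g z) by ring.
have fgw : nc (f w - g w) <= e / 3 by near: w.
have gw : nc (g w - g z) < e / 3 by near: w.
have := ncB ((f w - g w) + (g w - g z)) (f z - g z).
have := ncD (f w - g w) (g w - g z); lra.
Unshelve. all: by end_near. Qed.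

Lemma ccont_inv z f : f z != 0 -> ccont z f -> ccont z (fun z => (f z)^-1).
Proof.
move=> f0 [cr ci].
have n0 : cRe (f z) ^+ 2 + cIm (f z) ^+ 2 != 0.
  by rewrite -nc_sqr expf_neq0// nc_eq0.
have cn : {for z, continuous (fun z => cRe (f z) ^+ 2 + cIm (f z) ^+ 2)}.
  by apply: continuousD; exact: continuousM.
split.
  have -> : (fun z => cRe (f z)^-1) = fun z => cRe (f z) / (cRe (f z) ^+ 2 + cIm (f z) ^+ 2).
    by apply/funext => w; case: (f w).
  by apply: continuousM => //; exact: continuousV.
have -> : (fun z => cIm (f z)^-1) = fun z => - (cIm (f z) / (cRe (f z) ^+ 2 + cIm (f z) ^+ 2)).
  by apply/funext => w; rewrite cIm_inv mulNr.
by apply: continuousN; apply: continuousM => //; exact: continuousV.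
Qed.

End complex_continuity.

Section complex_measurability.

(** * Measurability of complex-valued functions *)

Variables (R : realType) (d : measure_display) (T : measurableType d).
Local Notation C := R[i].
Implicit Types (D : set T) (f g : T -> C).

Definition cmeas D f := measurable_fun D (fun z => cRe (f z)) /\
  measurable_fun D (fun z => cIm (f z)).

Lemma cmeas_cst D (c : C) : cmeas D (fun=> c).
Proof. by split; exact: measurable_cst. Qed.

Lemma cmeas_real D (f : T -> R) : measurable_fun D f -> cmeas D (fun z => (f z)%:C).
Proof. by split => //; exact: measurable_cst. Qed.

Lemma cmeasD D f g : cmeas D f -> cmeas D g -> cmeas D (fun z => f z + g z).
Proof.
by move=> [? ?] [? ?]; split; under eq_fun do rewrite cRI; exact: measurable_funD.
Qed.

Lemma cmeasN D f : cmeas D f -> cmeas D (fun z => - f z).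
Proof.
by move=> [? ?]; split; under eq_fun do rewrite cRI; exact: measurableT_comp.
Qed.

Lemma cmeasM D f g : cmeas D f -> cmeas D g -> cmeas D (fun z => f z * g z).
Proof.
move=> [? ?] [? ?]; split; under eq_fun do rewrite cRI.
  by apply: measurable_funB; exact: measurable_funM.
by apply: measurable_funD; exact: measurable_funM.
Qed.

Lemma cmeas_sum D n (F : 'I_n -> T -> C) : (forall i, cmeas D (F i)) ->
  cmeas D (fun z => \sum_(i < n) F i z).
Proof.
elim: n F => [|n IH] F mF.
  by under [fun _ => _]eq_fun do rewrite big_ord0; exact: cmeas_cst.
under [fun _ => _]eq_fun do rewrite big_ord_recl.
by apply: cmeasD => //; exact: IH.
Qed.

Lemma cmeas_cexp D f : cmeas D f -> cmeas D (fun z => cexp (f z)).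
Proof.
have me := continuous_measurable_fun (@continuous_expR R).
have mc := continuous_measurable_fun (@continuous_cos R).
have ms := continuous_measurable_fun (@continuous_sin R).
move=> [mr mi]; split => /=; apply: measurable_funM.
- exact: measurableT_comp me mr.
- exact: measurableT_comp mc mi.
- exact: measurableT_comp me mr.
- exact: measurableT_comp ms mi.
Qed.

Lemma cmeas_inv D f : cmeas D f -> cmeas D (fun z => (f z)^-1).
Proof.
move=> [mr mi].
have mn : measurable_fun D (fun z => (cRe (f z) ^+ 2 + cIm (f z) ^+ 2)^-1).
  apply: measurableT_comp (@measurable_inv R) _.
  by apply: measurable_funD; exact: measurable_funX.
split.
  have -> : (fun z => cRe (f z)^-1) = fun z => cRe (f z) * (cRe (f z) ^+ 2 + cIm (f z) ^+ 2)^-1.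
    by apply/funext => w; rewrite cRe_inv.
  exact: measurable_funM.
have -> : (fun z => cIm (f z)^-1) = fun z => - cIm (f z) * (cRe (f z) ^+ 2 + cIm (f z) ^+ 2)^-1.
  by apply/funext => w; rewrite cIm_inv.
by apply: measurable_funM => //; exact: measurableT_comp.
Qed.

End complex_measurability.

Section complex_functions_plane.
Variable R : realType.
Implicit Types (D : set (R * R)) (f : R * R -> R[i]).

Lemma ccontinuous_inP D f : ccontinuous_in D f <-> forall z, D z -> ccont z f.
Proof.
split=> [[cr ci] z Dz|h]; first by split; [apply: cr|apply: ci]; exact/mem_set.
by split=> z /set_mem/h[].
Qed.

Lemma cmeas_continuous D f : open D -> (forall z, D z -> ccont z f) -> cmeas D f.
Proof.
move=> oD cf; split; apply: continuous_measurable_plane => // z /set_mem.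
  by case/cf.
by case/cf.
Qed.

End complex_functions_plane.

(** * Integrals over the plane *)

Notation leb2 R := (@lebesgue_measure R \x @lebesgue_measure R)%E.

(* Lebesgue measure lives on [measurableTypeR R], whose display is not that of
   [R]; the sigma-algebras agree, and the lemmas below transfer measurability. *)
Notation pT R := (measurableTypeR R * measurableTypeR R)%type.

Section display_transfer.
Variable R : realType.
Implicit Types D : set (R * R).

Let measurable_line_id : measurable_fun [set: measurableTypeR R]
  (fun x : measurableTypeR R => x : R).
Proof. by move=> _ Y mY; rewrite setTI preimage_id; exact: mY. Qed.

Lemma measurable_plane_id :
  measurable_fun [set: pT R] (fun z : pT R => z : R * R).
Proof.
apply/measurable_fun_pairP; split.
  exact: (measurableT_comp measurable_line_id measurable_fst).
exact: (measurableT_comp measurable_line_id measurable_snd).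
Qed.

Lemma measurable_planeP D : measurable D -> measurable (D : set (pT R)).
Proof.
by move=> mD; have := measurable_plane_id measurableT mD; rewrite setTI preimage_id.
Qed.

Lemma measurable_fun_plane D d (T : measurableType d) (f : R * R -> T) :
  measurable D -> measurable_fun D f -> measurable_fun (D : set (pT R)) f.
Proof.
move=> mD mf.
apply: (@measurable_comp _ _ _ _ _ _ D _ _ (fun z : pT R => z : R * R)) => //.
by move=> z [w Dw <-].
Qed.

Lemma measurable_fun_plane2 D (f : (R * R) * (R * R) -> R) :
  measurable D -> measurable_fun (D `*` D) f ->
  measurable_fun (D `*` D : set (pT R * pT R)) f.
Proof.
move=> mD mf.
apply: (@measurable_comp _ _ _ _ _ _ (D `*` D) _ _
  (fun z : pT R * pT R => z : (R * R) * (R * R))) => //.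
- exact: measurableX.
- by move=> z [w Dw <-].
Qed.

End display_transfer.

(* The library only registers products of (sub)probabilities as sigma-finite. *)
Section plane_measure.
Variable R : realType.
Definition plane_measure : set (pT R) -> \bar R := leb2 R.
HB.instance Definition _ := Measure.on plane_measure.
Let plane_measure_sigma_finite : sigma_finite setT plane_measure.
Proof.
have /sigma_finiteP[F [TF ndF Foo]] := sigma_finiteT (@lebesgue_measure R).
exists (fun n => F n `*` F n).
  rewrite -setXTT TF predeqE => -[x y]; split.
    move=> [/= [n _ Fnx] [k _ Fky]]; exists (maxn n k) => //; split.
    - by move: x Fnx; exact/subsetPset/ndF/leq_maxl.
    - by move: y Fky; exact/subsetPset/ndF/leq_maxr.
  by move=> [n _ []/= ? ?]; split; exists n.
move=> k; have [? ?] := Foo k.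
split; first exact: measurableX.
by rewrite /plane_measure product_measure1E// lte_mul_pinfty// ge0_fin_numE.
Qed.
HB.instance Definition _ := Measure_isSigmaFinite.Build _ _ _ plane_measure plane_measure_sigma_finite.

End plane_measure.

(** * Fubini's theorem for kernels with uniformly bounded slice integrals *)

Section generic_swap.
Context d (T : measurableType d) (R : realType).
Variable mu : {sigma_finite_measure set T -> \bar R}.
Implicit Types D : set T.

Lemma measurable_slice1 D (h : T -> T -> R) z : measurable D ->
  measurable_fun (D `*` D) (fun p => h p.1 p.2) -> D z -> measurable_fun D (h z).
Proof.
move=> mD mh Dz; have mDD : measurable (D `*` D) by exact: measurableX.
have /(measurable_fun_pair2 z) := (measurable_restrictT (fun p => h p.1 p.2) mDD).1 mh.
move=> /measurable_funTS -/(_ D); apply: eq_measurable_fun => w Dw.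
by rewrite patchE in_setX/= Dw mem_set.
Qed.

Lemma measurable_slice2 D (h : T -> T -> R) w : measurable D ->
  measurable_fun (D `*` D) (fun p => h p.1 p.2) -> D w -> measurable_fun D (h^~ w).
Proof.
move=> mD mh Dw; have mDD : measurable (D `*` D) by exact: measurableX.
have /(measurable_fun_pair1 w) := (measurable_restrictT (fun p => h p.1 p.2) mDD).1 mh.
move=> /measurable_funTS -/(_ D); apply: eq_measurable_fun => z Dz.
by rewrite patchE in_setX/= Dz mem_set.
Qed.

(** Uniform bounds on the slice integrals over a set of finite measure give integrability on the
    product, and Fubini's theorem applies to the extension by 0. *)
Lemma Rintegral_swap D (h : T -> T -> R) (B : R) : measurable D ->
  (mu D < +oo)%E -> measurable_fun (D `*` D) (fun p => h p.1 p.2) ->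
  (forall z, D z -> (\int[mu]_(w in D) `|h z w|%:E <= B%:E)%E) ->
  (forall w, D w -> (\int[mu]_(z in D) `|h z w|%:E <= B%:E)%E) ->
  \int[mu]_(z in D) (\int[mu]_(w in D) h z w) =
  \int[mu]_(w in D) (\int[mu]_(z in D) h z w).
Proof.
move=> mD finD mh h1 h2.
pose H p := (((fun p => h p.1 p.2) \_ (D `*` D)) p)%:E.
have mDD : measurable (D `*` D) by exact: measurableX.
have mH : measurable_fun setT H.
  by apply/measurable_EFinP; apply/(measurable_restrictT _ mDD).
have HE z w : H (z, w) = (((fun=> h z w : R) \_ D) z * ((fun=> (1:R)) \_ D) w)%:E.
  rewrite /H !patchE in_setX/=.
  by case: (z \in D); case: (w \in D); rewrite /= ?mulr1 ?mul0r ?mulr0.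
(* All slice integrals are finite, not only almost all, so the passage from extended to real inner
   integrals by [fine] loses nothing. *)
have fin1 z : D z -> (\int[mu]_(w in D) (h z w)%:E)%E \is a fin_num.
  move=> Dz; rewrite fin_num_abs.
  apply: (@le_lt_trans _ _ (\int[mu]_(w in D) `|h z w|%:E)%E).
    by apply: le_abse_integral => //; apply/measurable_EFinP; exact: measurable_slice1.
  by rewrite (le_lt_trans (h1 z Dz))// ltry.
have fin2 w : D w -> (\int[mu]_(z in D) (h z w)%:E)%E \is a fin_num.
  move=> Dw; rewrite fin_num_abs.
  apply: (@le_lt_trans _ _ (\int[mu]_(z in D) `|h z w|%:E)%E).
    by apply: le_abse_integral => //; apply/measurable_EFinP; exact: measurable_slice2.
  by rewrite (le_lt_trans (h2 w Dw))// ltry.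
have iH : (mu \x mu)%E.-integrable setT H.
  apply: (@integrable12ltyP _ _ T T R mu mu H mH).2.
  apply: (@le_lt_trans _ _ (\int[mu]_(z in D) B%:E)%E); last first.
    rewrite integral_cst//.
    have mDf : mu D \is a fin_num by rewrite ge0_fin_numE.
    by rewrite -[X in (_ * X)%E]fineK// -EFinM ltry.
  have -> : (\int[mu]_x \int[mu]_y `|H (x, y)| =
             \int[mu]_(x in D) \int[mu]_y `|H (x, y)|)%E.
    rewrite [RHS]integral_mkcond; apply: eq_integral => z _; rewrite patchE.
    case: ifPn => // zD; rewrite integral0_eq// => w _.
    by rewrite HE patchE (negbTE zD) mul0r abse0.
  have B0 z : D z -> (0 <= B%:E)%E.
    by move=> Dz; apply: le_trans (h1 z Dz); exact: integral_ge0.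
  apply: ge0_le_integral => //.
  - by move=> z _; exact: integral_ge0.
  - apply: measurable_funTS.
    by apply: (measurable_fun_fubini_tonelli_F (abse \o H)) => //=; exact: measurableT_comp.
  - move=> z Dz; apply: le_trans (h1 z Dz); rewrite [leRHS]integral_mkcond.
    apply: ge0_le_integral => //.
    + apply: measurableT_comp => //; exact: measurable_fun_pair2.
    + apply: (measurable_restrictT _ mD).1; apply/measurable_EFinP.
      by apply: measurableT_comp => //; exact: (measurable_slice1 mD mh).
    + by move=> w _; rewrite HE !patchE mem_set//; case: ifP; rewrite ?mulr1 ?mulr0// abse0.
rewrite /Rintegral; congr fine.
transitivity (\int[mu]_z \int[mu]_w H (z, w))%E.
  rewrite integral_mkcond; apply: eq_integral => z _; rewrite patchE.
  case: ifPn => zD.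
    rewrite fineK; last exact/fin1/set_mem.
    rewrite integral_mkcond; apply: eq_integral => w _.
    by rewrite HE !patchE zD; case: ifP; rewrite ?mulr1 ?mulr0.
  rewrite integral0_eq// => w _.
  by rewrite HE patchE (negbTE zD) mul0r.
rewrite (Fubini iH)/=.
rewrite [RHS]integral_mkcond; apply: eq_integral => w _; rewrite patchE.
case: ifPn => wD.
  rewrite fineK; last exact/fin2/set_mem.
  rewrite [RHS]integral_mkcond; apply: eq_integral => z _.
  by rewrite HE !patchE wD mulr1; case: ifP.
rewrite integral0_eq// => z _.
by rewrite HE [in X in _ * X]patchE (negbTE wD) mulr0.
Qed.

End generic_swap.

(** * Complex integrals over plane sets *)

Section plane_integrals.
Variable R : realType.
Local Notation mu := (leb2 R).
Local Notation C := R[i].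
Implicit Types (D : set (R * R)) (f g : R * R -> C).

Lemma measurable_leb2 D (h : R * R -> R) : measurable D -> measurable_fun D h ->
  measurable_fun (D : set (pT R)) (EFin \o h).
Proof.
by move=> mD mh; apply/measurable_EFinP; exact: measurable_fun_plane.
Qed.

Lemma measurable_leb2_norm D (h : R * R -> R) : measurable D -> measurable_fun D h ->
  measurable_fun (D : set (pT R)) (fun z => `|h z|%:E).
Proof.
move=> mD mh; apply: (@measurable_leb2 D (fun z => `|h z|)) => //.
exact: measurableT_comp mh.
Qed.

Definition cintegrable D f := mu.-integrable D (EFin \o (fun z => cRe (f z))) /\
  mu.-integrable D (EFin \o (fun z => cIm (f z))).

Lemma eq_cintegral D f g : (forall z, D z -> f z = g z) ->
  cintegral D f = cintegral D g.
Proof.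
move=> fg; rewrite /cintegral; congr (_ +i* _); apply: eq_Rintegral => z /set_mem/fg.
  by move->.
by move->.
Qed.

Lemma cintegralD D f g : measurable D -> cintegrable D f -> cintegrable D g ->
  cintegral D (fun z => f z + g z) = cintegral D f + cintegral D g.
Proof.
move=> mD [fr fi] [gr gi]; apply: complex_eq; rewrite !cRI/= -RintegralD//.
  by apply: eq_Rintegral => z _; rewrite cRI.
by apply: eq_Rintegral => z _; rewrite cRI.
Qed.

Lemma integrableZ_real D (r : R) (f : R * R -> R) : measurable D ->
  mu.-integrable D (EFin \o f) -> mu.-integrable D (EFin \o (fun z => r * f z)).
Proof.
move=> mD fi; have := @integrableZl _ _ R mu D mD r _ fi.
by apply: eq_integrable => // z _ /=; rewrite EFinM.
Qed.

Lemma cintegrableZ D (c : C) f : measurable D -> cintegrable D f ->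
  cintegrable D (fun z => c * f z).
Proof.
move=> mD [fr fi]; split.
  have := @integrableB _ _ R mu D mD _ _ (integrableZ_real (cRe c) mD fr) (integrableZ_real (cIm c) mD fi).
  by apply: eq_integrable => // z _ /=; rewrite cRI EFinB.
have := @integrableD _ _ R mu D mD _ _ (integrableZ_real (cRe c) mD fi) (integrableZ_real (cIm c) mD fr).
by apply: eq_integrable => // z _ /=; rewrite cRI EFinD.
Qed.

Lemma cintegralZ D (c : C) f : measurable D -> cintegrable D f ->
  cintegral D (fun z => c * f z) = c * cintegral D f.
Proof.
move=> mD [fr fi]; apply: complex_eq; rewrite !cRI/= -!RintegralZl//.
  rewrite -RintegralB//; try exact: integrableZ_real.
  by apply: eq_Rintegral => z _; rewrite cRI.
rewrite -RintegralD//; try exact: integrableZ_real.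
by apply: eq_Rintegral => z _; rewrite cRI.
Qed.

(** The factor 2 is the price of bounding the real and the imaginary part separately; it reappears
    in all later constants. *)
Lemma cintegral_bound D f (g : R * R -> R) (B : R) : measurable D ->
  cmeasurable_fun D f -> measurable_fun D g ->
  (forall z, D z -> nc (f z) <= g z) ->
  (\int[mu]_(z in D) (g z)%:E <= B%:E)%E ->
  cintegrable D f /\ nc (cintegral D f) <= 2 * B.
Proof.
move=> mD [mr mi] mg fg gB.
have key (h : R * R -> R) : measurable_fun D h -> (forall z, D z -> `|h z| <= g z) ->
    mu.-integrable D (EFin \o h) /\ `|\int[mu]_(z in D) h z| <= B.
  move=> mh hg.
  have hB : (\int[mu]_(z in D) `|h z|%:E <= B%:E)%E.
    apply: le_trans gB; apply: ge0_le_integral => //.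
    - exact: measurable_leb2_norm.
    - exact: measurable_leb2.
  have ih : mu.-integrable D (EFin \o h).
    apply/integrableP; split; first exact: measurable_leb2.
    by apply: le_lt_trans hB _; rewrite ltry.
  split => //; rewrite -lee_fin EFin_normr_Rintegral//.
  by apply: le_trans hB; apply: le_abse_integral => //; exact: measurable_leb2.
have [ir rB] := key _ mr (fun z Dz => le_trans (abs_cRe _) (fg z Dz)).
have [ii iB] := key _ mi (fun z Dz => le_trans (abs_cIm _) (fg z Dz)).
split; first by split.
by apply: le_trans (nc_leD _) _; rewrite mulr_natl mulr2n lerD.
Qed.

Lemma cintegrable_bounded D f (B : R) : measurable D -> (mu D < +oo)%E ->
  cmeasurable_fun D f -> (forall z, D z -> nc (f z) <= B) -> cintegrable D f.
Proof.
move=> mD finD mf fB.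
have [||//] := @cintegral_bound D f (fun=> B) (B * fine (mu D)) mD mf _ fB.
  exact: measurable_cst.
by rewrite integral_cst// EFinM fineK// ge0_fin_numE.
Qed.

Lemma cintegral_swap D (h : R * R -> R * R -> C) (g : R * R -> R * R -> R) (B : R) :
  measurable D -> (mu D < +oo)%E ->
  measurable_fun (D `*` D) (fun p => cRe (h p.1 p.2)) ->
  measurable_fun (D `*` D) (fun p => cIm (h p.1 p.2)) ->
  (forall z w, D z -> D w -> nc (h z w) <= g z w) ->
  (forall z, measurable_fun D (g z)) -> (forall w, measurable_fun D (g^~ w)) ->
  (forall z, D z -> (\int[mu]_(w in D) (g z w)%:E <= B%:E)%E) ->
  (forall w, D w -> (\int[mu]_(z in D) (g z w)%:E <= B%:E)%E) ->
  cintegral D (fun z => cintegral D (h z)) =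
  cintegral D (fun w => cintegral D (h^~ w)).
Proof.
move=> mD finD mr mi hg mg1 mg2 g1 g2.
have key (k : R * R -> R * R -> R) : measurable_fun (D `*` D) (fun p => k p.1 p.2) ->
    (forall z w, D z -> D w -> `|k z w| <= g z w) ->
    \int[mu]_(z in D) (\int[mu]_(w in D) k z w) =
    \int[mu]_(w in D) (\int[mu]_(z in D) k z w).
  move=> mk kg; apply: (@Rintegral_swap _ (pT R) R (@plane_measure R) D k B).
  - exact: measurable_planeP.
  - exact: finD.
  - exact: measurable_fun_plane2.
  - move=> z Dz; apply: le_trans (g1 z Dz); apply: ge0_le_integral => //.
    + by apply: measurable_leb2_norm => //; exact: (measurable_slice1 mD mk).
    + exact: measurable_leb2.
    + by move=> w Dw; rewrite lee_fin kg.
  - move=> w Dw; apply: le_trans (g2 w Dw); apply: ge0_le_integral => //.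
    + by apply: measurable_leb2_norm => //; exact: (measurable_slice2 mD mk).
    + exact: measurable_leb2.
    + by move=> z Dz; rewrite lee_fin kg.
rewrite /cintegral; congr (_ +i* _).
  by apply: key => // z w Dz Dw; exact: le_trans (abs_cRe _) (hg _ _ Dz Dw).
by apply: key => // z w Dz Dw; exact: le_trans (abs_cIm _) (hg _ _ Dz Dw).
Qed.

End plane_integrals.

(** * An integrable majorant of the Cauchy kernel *)

Section line_integrals.
Variable R : realType.
Local Notation lb := (@lebesgue_measure R).
Implicit Types a b d e s t u x : R.

Lemma ge0_integral_affine (G : R -> R) a e : 0 < e -> continuous G ->
  (forall x, 0 <= G x) ->
  (\int[lb]_x (G ((x - a) / e) / e)%:E = \int[lb]_t (G t)%:E)%E.
Proof.
move=> e0 cG G0; pose F x := (x - a) / e.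
have ei : 0 < e^-1 by rewrite invr_gt0.
have dF x : is_derive x 1 F e^-1.
  rewrite /F; apply: is_derive_eq.
  by rewrite /GRing.scale/= subr0 mulr1 mulr0 add0r.
have F' : F^`()%classic = fun=> e^-1.
  by apply/funext => x; rewrite derive1E; apply: derive_val.
rewrite (@increasing_ge0_integration_by_substitutionT R F G)//.
- by apply: eq_integral => x _; rewrite F'.
- by move=> x y xy; rewrite /F ltr_pM2r// ltrD2r.
- by rewrite F' => x; exact: cvg_cst.
- by rewrite F'; exact: is_cvg_cst.
- by rewrite F'; exact: is_cvg_cst.
- apply/cvgrNyPle => A; near=> x; rewrite /F ler_pdivrMr// lerBlDr.
  by near: x; apply: nbhs_ninfty_le; rewrite num_real.
- apply/cvgryPge => A; near=> x; rewrite /F ler_pdivlMr// lerBrDr.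
  by near: x; apply: nbhs_pinfty_ge; rewrite num_real.
Unshelve. all: by end_near. Qed.

(* Integrable majorant of 1/sqrt|u| near 0: d is the decay scale, and s > 0
   smooths the singularity, the integral being bounded uniformly in s. *)
Definition bump d s u := d / (Num.sqrt (`|u| + s) * (d + (`|u| + s))).

Lemma bump_ge0 d s u : 0 < d -> 0 < s -> 0 <= bump d s u.
Proof.
move=> d0 s0; rewrite /bump divr_ge0 ?ltW// mulr_gt0 ?sqrtr_gt0//.
  by rewrite ltr_wpDl.
by rewrite addr_gt0// ltr_wpDl.
Qed.

Lemma continuous_bump d s : 0 < d -> 0 < s -> continuous (bump d s).
Proof.
move=> d0 s0 u.
apply: (@continuousM _ _ (fun=> d)
  (fun u => (Num.sqrt (`|u| + s) * (d + (`|u| + s)))^-1)).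
  exact: cst_continuous.
have cn : {for u, continuous (fun u => `|u| + s)}.
  by apply: continuousD; [exact: norm_continuous|exact: cst_continuous].
have us : 0 < `|u| + s by rewrite ltr_wpDl.
apply: continuousV.
  by rewrite gt_eqF// mulr_gt0 ?sqrtr_gt0// addr_gt0.
apply: continuousM.
  by apply: continuous_comp => //; exact: sqrt_continuous.
by apply: continuousD => //; exact: cst_continuous.
Qed.

Lemma integral_bump d s : 0 < d -> 0 < s ->
  (\int[lb]_t (bump d s t)%:E <= (2 * (pi * Num.sqrt d))%:E)%E.
Proof.
move=> d0 s0.
have sd0 : 0 < Num.sqrt d by rewrite sqrtr_gt0.
rewrite ge0_symfun_integralT//; last 3 first.
- by move=> u; exact: bump_ge0.
- exact: continuous_bump.
- by move=> u; rewrite /bump/= normrN.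
rewrite EFinM lee_pmul2l//.
(* An antiderivative of the bump on [t > -s]. It tends to [pi * sqrt d] at infinity, and its value
   at 0 is nonnegative and is dropped, which makes the bound independent of [s]. *)
pose F (t : R) := 2 * Num.sqrt d * atan (Num.sqrt ((t + s) / d)).
have s0' : - s < 0 by rewrite oppr_lt0.
have dF t : - s < t -> is_derive t 1 F (d / (Num.sqrt (t + s) * (d + (t + s)))).
  move=> st; have ts : 0 < t + s by rewrite -ltrBlDr sub0r.
  have tsd : 0 < (t + s) / d by rewrite divr_gt0.
  pose lin (t : R) := (t + s) / d.
  have d1 : is_derive t 1 lin d^-1.
    rewrite /lin; apply: is_derive_eq.
    by rewrite /GRing.scale/= addr0 mulr1 mulr0 add0r.
  have d2 := @is_derive1_comp _ Num.sqrt lin t _ _ (is_derive1_sqrt tsd) d1.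
  have d3 := @is_derive1_comp _ atan (Num.sqrt \o lin) t _ _ (is_derive1_atan _) d2.
  have d4 : is_derive t 1 F (2 * Num.sqrt d *: _) := is_deriveZ _ d3.
  apply: is_derive_eq d4 _; rewrite /GRing.scale/= sqr_sqrtr ?ltW// /lin.
  rewrite sqrtrM ?ltW// sqrtrV ?ltW//.
  have sts0 : 0 < Num.sqrt (t + s) by rewrite sqrtr_gt0.
  have dE : d = Num.sqrt d ^+ 2 by rewrite sqr_sqrtr// ltW.
  move: dE sts0 sd0; set r := Num.sqrt d; set q := Num.sqrt (t + s) => dE q0 r0.
  rewrite dE; field; rewrite -dE.
  by rewrite !gt_eqF// addr_gt0.
have -> : [set x : R | 0 <= x] = `[0, +oo[%classic.
  by apply/seteqP; split => x/=; rewrite in_itv/= andbT.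
rewrite (@ge0_continuous_FTC2y _ _ F 0 (pi * Num.sqrt d)).
- by rewrite -EFinB lee_fin gerBl /F mulr_ge0// ?mulr_ge0// -[leLHS](@atan0 R) le_atan.
- by move=> x _; exact: bump_ge0.
- by apply: continuous_subspaceT => x; exact: continuous_bump.
- rewrite (_ : pi * Num.sqrt d = 2 * Num.sqrt d * (pi / 2)); last by field.
  apply: cvgM; first exact: cvg_cst.
  apply: (@cvg_comp _ _ _ (fun t => Num.sqrt ((t + s) / d)) atan _ +oo).
    apply/cvgryPge => A; near=> x.
    rewrite (le_trans (ler_norm A))// -sqrtr_sqr ler_wsqrtr//.
    rewrite ler_pdivlMr// -lerBlDr.
    by near: x; apply: nbhs_pinfty_ge; rewrite num_real.
  exact: cvgy_atan.
- by move=> x x0; have [] := dF x (lt_trans s0' x0).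
- have [+ _] := dF 0 s0'.
  by move=> /derivable1_diffP /differentiable_continuous; exact: cvg_at_right_filter.
- move=> x; rewrite in_itv/= andbT => x0.
  have [_] := dF x (lt_trans s0' x0).
  by rewrite derive1E => ->; rewrite /bump gtr0_norm.
Unshelve. all: by end_near. Qed.


Lemma integral_bump_shift d s a : 0 < d -> 0 < s ->
  (\int[lb]_t (bump d s (a - t))%:E <= (2 * (pi * Num.sqrt d))%:E)%E.
Proof.
move=> d0 s0; apply: le_trans (integral_bump d0 s0).
rewrite -(@ge0_integral_affine (bump d s) a 1)//; last 2 first.
- exact: continuous_bump.
- by move=> x; exact: bump_ge0.
rewrite le_eqVlt; apply/orP; left; apply/eqP; apply: eq_integral => t _.
by rewrite !divr1 /bump distrC.
Qed.

End line_integrals.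

Section kernel_integral.
Variable R : realType.
Local Notation mu := (leb2 R).
Local Notation lb := (@lebesgue_measure R).
Implicit Types (z w : R * R).

Definition pz z : R[i] := z.1 +i* z.2.

Lemma nc_pzE z w : nc (pz z - pz w) = Num.sqrt ((z.1 - w.1) ^+ 2 + (z.2 - w.2) ^+ 2).
Proof. by rewrite ncE !cRI. Qed.

Lemma abs_pz1 z w : `|z.1 - w.1| <= nc (pz z - pz w).
Proof. by have := abs_cRe (pz z - pz w); rewrite !cRI. Qed.

Lemma abs_pz2 z w : `|z.2 - w.2| <= nc (pz z - pz w).
Proof. by have := abs_cIm (pz z - pz w); rewrite !cRI. Qed.

Lemma measurable_coord1 D : measurable_fun D (fun w : R * R => w.1).
Proof. exact: measurable_funTS measurable_fst. Qed.
Lemma measurable_coord2 D : measurable_fun D (fun w : R * R => w.2).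
Proof. exact: measurable_funTS measurable_snd. Qed.

Lemma measurable_nc_pz z D : measurable_fun D (fun w => nc (pz z - pz w)).
Proof.
apply: measurable_funTS; under eq_fun do rewrite nc_pzE.
apply: measurableT_comp; first exact: continuous_measurable_fun (@sqrt_continuous _).
apply: measurable_funD; apply: measurable_funX; apply: measurable_funB => //.
Qed.

Lemma integral_prod_le (f g : R -> R) (a b : R) :
  continuous f -> continuous g -> (forall x, 0 <= f x) -> (forall x, 0 <= g x) ->
  (\int[lb]_x (f x)%:E <= a%:E)%E -> (\int[lb]_x (g x)%:E <= b%:E)%E ->
  (\int[mu]_w (f w.1 * g w.2)%:E <= (a * b)%:E)%E.
Proof.
move=> cf cg f0 g0 fa gb.
have mf : measurable_fun setT f by exact: continuous_measurable_fun.
have mg : measurable_fun setT g by exact: continuous_measurable_fun.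
rewrite fubini_tonelli1/=; last 2 first.
- apply/measurable_EFinP; apply: measurable_funM.
    exact: measurableT_comp.
  exact: measurableT_comp.
- by move=> w; rewrite lee_fin mulr_ge0.
rewrite /fubini_F/=.
have b0 : (0 <= b%:E)%E by apply: le_trans gb; apply: integral_ge0 => x _; rewrite lee_fin.
have a0 : (0 <= a%:E)%E by apply: le_trans fa; apply: integral_ge0 => x _; rewrite lee_fin.
apply: (@le_trans _ _ (\int[lb]_x (b%:E * (f x)%:E))%E).
  apply: ge0_le_integral => //.
  - by move=> x _; apply: integral_ge0 => y _; rewrite lee_fin mulr_ge0.
  - apply: (measurable_fun_fubini_tonelli_F (fun p : pT R => (f p.1 * g p.2)%:E)).
      apply/measurable_EFinP; apply: measurable_funM; exact: measurableT_comp.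
    by move=> p; rewrite lee_fin mulr_ge0.
  - by apply/measurable_EFinP; apply: measurable_funM.
  - move=> x _; under eq_integral do rewrite EFinM.
    rewrite ge0_integralZl_EFin//; last 2 first.
    + by move=> y _; rewrite lee_fin.
    + exact/measurable_EFinP.
    by rewrite muleC lee_wpmul2r// lee_fin.
rewrite ge0_integralZl_EFin//; last 2 first.
- by move=> x _; rewrite lee_fin.
- exact/measurable_EFinP.
by rewrite mulrC EFinM lee_wpmul2l.
Qed.

(** Since [r = |z - w|] dominates both coordinate distances [x] and [y], [1/(r+s)] is at most
    [1/(sqrt(x+s) sqrt(y+s))]. The planar singularity thus splits into two integrable singularities
    of one variable, without polar coordinates. The factor 4 comes from shifting [x] and [y] by [s]
    in the decay factors, where [s <= d] and [s <= d'] cost a factor 2 each. *)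
Lemma bump_prod (z w : R * R) (d d' s : R) : 0 < d -> 0 < d' -> 0 < s -> s <= d -> s <= d' ->
  (d / (d + `|z.1 - w.1|)) * (d' / (d' + `|z.2 - w.2|)) / (nc (pz z - pz w) + s) <=
  4 * (bump d s (z.1 - w.1) * bump d' s (z.2 - w.2)).
Proof.
move=> d0 d'0 s0 sd sd'; rewrite /bump.
have := abs_pz1 z w; have := abs_pz2 z w.
move: (nc _) => r; have := normr_ge0 (z.1 - w.1); have := normr_ge0 (z.2 - w.2).
move: `|z.1 - w.1| `|z.2 - w.2| => x y y0 x0 yr xr.
have half (e t : R) : 0 < e -> s <= e -> 0 <= t -> e / (e + t) <= 2 * (e / (e + (t + s))).
  move=> e0 se t0; rewrite ler_pdivrMr ?ltr_wpDr//.
  rewrite mulrA mulrAC ler_pdivlMr; last by lra.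
  by nra.
have xs0 : 0 < Num.sqrt (x + s) by rewrite sqrtr_gt0; lra.
have ys0 : 0 < Num.sqrt (y + s) by rewrite sqrtr_gt0; lra.
have rs : (r + s)^-1 <= (Num.sqrt (x + s) * Num.sqrt (y + s))^-1.
  rewrite lef_pV2 ?posrE ?mulr_gt0//; last by lra.
  have -> : r + s = Num.sqrt (r + s) * Num.sqrt (r + s) by rewrite -expr2 sqr_sqrtr//; lra.
  by apply: ler_pM; rewrite ?sqrtr_ge0// ler_wsqrtr// lerD2r.
rewrite -[leRHS](_ : (2 * (d / (d + (x + s)))) * (2 * (d' / (d' + (y + s)))) *
  (Num.sqrt (x + s) * Num.sqrt (y + s))^-1 = _); last first.
  by field; rewrite !gt_eqF//; lra.
apply: ler_pM => //.
- by rewrite mulr_ge0// divr_ge0//; lra.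
- by rewrite invr_ge0; lra.
- by apply: ler_pM; rewrite ?half// divr_ge0//; lra.
Qed.

(** The bound of the smoothed integrals by products of bumps is uniform in the smoothing parameter,
    so monotone convergence carries it to the singular kernel. *)
Lemma kernel_integral z (m : R * R -> R) (c d d' : R) : 0 < d -> 0 < d' ->
  measurable_fun setT m -> (forall w, 0 <= m w) ->
  (forall w, m w <= c * ((d / (d + `|z.1 - w.1|)) * (d' / (d' + `|z.2 - w.2|)))) ->
  (\int[mu]_w (m w / nc (pz z - pz w))%:E <=
    (c * 4 * ((2 * (pi * Num.sqrt d)) * (2 * (pi * Num.sqrt d'))))%:E)%E.
Proof.
move=> d0 d'0 mm m0 mc.
have c0 : 0 <= c.
  have := le_trans (m0 z) (mc z).
  by rewrite !subrr normr0 !addr0 !divff ?gt_eqF// !mulr1.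
pose r w := nc (pz z - pz w).
have r0 w : 0 <= r w by exact: nc_ge0.
have s0 n : 0 < n.+1%:R^-1 :> R by rewrite invr_gt0.
(* Off the diagonal this is [m / (r + 1/(n+1))], which increases to [m / r]; on the diagonal [h] and
   its limit are both 0 because the inverse of 0 is 0. *)
pose h n w := (m w / r w * (r w / (r w + n.+1%:R^-1)))%:E.
have h0 n w : (0 <= h n w)%E.
  by rewrite lee_fin mulr_ge0 ?divr_ge0// addr_ge0// ltW.
have mr : measurable_fun setT r by exact: measurable_nc_pz.
have mh n : measurable_fun [set: pT R] (h n).
  apply: (@measurable_leb2 _ setT (fun w => m w / r w * (r w / (r w + n.+1%:R^-1)))) => //.
  apply: measurable_funM; apply: measurable_funM => //.
    exact: measurableT_comp (@measurable_inv R) mr.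
  apply: measurableT_comp (@measurable_inv R) _.
  exact: measurable_funD.
have ndh w : {homo h ^~ w : n k / (n <= k)%N >-> (n <= k)%E}.
  move=> n k nk; rewrite lee_fin ler_wpM2l ?divr_ge0//.
  have [->|rw0] := eqVneq (r w) 0; first by rewrite !mul0r.
  have rw : 0 < r w by rewrite lt_neqAle eq_sym rw0 r0.
  rewrite ler_wpM2l ?(ltW rw)// lef_pV2 ?posrE ?addr_gt0// lerD2l lef_pV2 ?posrE//.
  by rewrite ler_nat.
have hlim w : limn (h ^~ w) = (m w / r w)%:E.
  apply/cvg_lim => //; apply: cvg_EFin; first by near=> n.
  have [rw|rw0] := eqVneq (r w) 0.
    have -> : fine \o h ^~ w = fun=> 0.
      by apply/funext => n /=; rewrite rw invr0 mulr0 mul0r.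
    by rewrite rw invr0 mulr0; exact: cvg_cst.
  rewrite -[X in _ --> X]mulr1; apply: cvgM; first exact: cvg_cst.
  rewrite -[X in _ --> X](divff rw0); apply: cvgM; first exact: cvg_cst.
  apply: cvgV => //; rewrite -[X in _ --> X]addr0.
  by apply: cvgD; [exact: cvg_cst|exact: cvg_harmonic].
have cb (e a s : R) : 0 < e -> 0 < s -> continuous (fun t => bump e s (a - t)).
  move=> e0 s1 t; apply: (@continuous_comp _ _ _ (fun t => a - t) (bump e s)).
    by apply: continuousB; [exact: cst_continuous|exact: id].
  exact: continuous_bump.
have mb s : 0 < s -> measurable_fun [set: pT R]
    (fun w : pT R => (bump d s (z.1 - w.1) * bump d' s (z.2 - w.2))%:E).
  move=> s1; apply: (@measurable_leb2 _ setT
    (fun w => bump d s (z.1 - w.1) * bump d' s (z.2 - w.2))) => //.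
  have m1 : measurable_fun [set: R] (fun t => bump d s (z.1 - t)).
    by apply: continuous_measurable_fun; exact: cb.
  have m2 : measurable_fun [set: R] (fun t => bump d' s (z.2 - t)).
    by apply: continuous_measurable_fun; exact: cb.
  apply: measurable_funM.
    exact: (measurableT_comp m1 (@measurable_fst _ _ R R)).
  exact: (measurableT_comp m2 (@measurable_snd _ _ R R)).
under eq_integral do rewrite -/(r _) -hlim.
rewrite monotone_convergence//.
apply: lime_le.
  apply: ereal_nondecreasing_is_cvgn => n k nk; apply: ge0_le_integral => //.
  by move=> w _; exact: ndh.
have dd0 : 0 < Num.min d d' by rewrite lt_min d0.
near=> n.
have nd : n.+1%:R^-1 <= Num.min d d'.
  by apply: ltW; near: n; exact: (near_infty_natSinv_lt (PosNum dd0)).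
have /andP[nd1 nd2] : (n.+1%:R^-1 <= d) && (n.+1%:R^-1 <= d').
  by move: nd; rewrite le_min.
set s := n.+1%:R^-1 in nd1 nd2 *.
have s1 : 0 < s := s0 n.
apply: (@le_trans _ _ (\int[mu]_w ((c * 4)%:E * (bump d s (z.1 - w.1) * bump d' s (z.2 - w.2))%:E))%E).
  apply: ge0_le_integral => //.
  - by apply: measurable_funeM; exact: (mb _ (s0 n)).
  - move=> w _; rewrite -EFinM lee_fin -mulrA.
    have key (t : R) : 0 <= t -> t^-1 * (t / (t + s)) <= (t + s)^-1.
      move=> t0; have [->|t1] := eqVneq t 0; last by rewrite mulKf.
      by rewrite mul0r mulr0 add0r invr_ge0 ltW// s0.
    apply: le_trans (ler_wpM2l (m0 w) (key _ (r0 w))) _.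
    rewrite -[leRHS]mulrA; apply: le_trans (ler_wpM2l c0 (bump_prod _ _ _ _ s1 _ _)) => //.
    rewrite [leRHS]mulrA; apply: ler_wpM2r; last exact: mc.
    by rewrite invr_ge0 addr_ge0// ltW// s0.
rewrite ge0_integralZl_EFin//; last 3 first.
- by move=> w _; rewrite lee_fin mulr_ge0// bump_ge0.
- exact: (mb _ (s0 n)).
- by rewrite mulr_ge0.
rewrite [leRHS]EFinM; apply: lee_wpmul2l; first by rewrite lee_fin mulr_ge0.
apply: (@integral_prod_le (fun t => bump d s (z.1 - t)) (fun t => bump d' s (z.2 - t))).
- exact: cb.
- exact: cb.
- by move=> x; exact: bump_ge0.
- by move=> x; exact: bump_ge0.
- exact: integral_bump_shift.
- exact: integral_bump_shift.
Unshelve. all: by end_near. Qed.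

End kernel_integral.

(** * Approximate identity *)

Section approximate_identity.
Variable R : realType.
Local Notation mu := (leb2 R).
Local Notation lb := (@lebesgue_measure R).
Implicit Types (z w : R * R).

(** This is the d-bar derivative of [conj(x) / (|x|^2 + e^2)], the regularised Cauchy kernel, at
    [x = u + iv]. As [e] tends to 0 it concentrates at the origin with constant mass. *)
Definition eta (e u v : R) : R := e ^+ 2 / (u ^+ 2 + v ^+ 2 + e ^+ 2) ^+ 2.

Lemma eta_ge0 e u v : 0 <= eta e u v.
Proof. by rewrite /eta divr_ge0// ?sqr_ge0// exprn_ge0// !addr_ge0// sqr_ge0. Qed.

Lemma eta_scale e u v : 0 < e -> eta e u v = eta 1 (u / e) (v / e) / e / e.
Proof.
move=> e0; rewrite /eta; have ne : e != 0 by rewrite gt_eqF.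
have s0 : 0 < u ^+ 2 + v ^+ 2 + e ^+ 2.
  by rewrite ltr_wpDl ?exprn_gt0// addr_ge0// sqr_ge0.
have -> : (u / e) ^+ 2 + (v / e) ^+ 2 + 1 ^+ 2 = (u ^+ 2 + v ^+ 2 + e ^+ 2) / e ^+ 2.
  by field.
by field; rewrite ne gt_eqF.
Qed.

Lemma measurable_eta e (a b : R * R -> R) D : measurable_fun D a -> measurable_fun D b ->
  measurable_fun D (fun z => eta e (a z) (b z)).
Proof.
move=> ma mb; apply: measurable_funM => //.
apply: (measurableT_comp (@measurable_inv R)).
apply: measurable_funX; apply: measurable_funD => //.
by apply: measurable_funD; exact: measurable_funX.
Qed.

Lemma continuous_eta e v : 0 < e -> continuous (fun u => eta e u v).
Proof.
move=> e0 u; rewrite /eta.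
apply: (@continuousM R R (fun=> e ^+ 2)
  (fun u => ((u ^+ 2 + v ^+ 2 + e ^+ 2) ^+ 2)^-1)); first exact: cst_continuous.
apply: continuousV.
  rewrite gt_eqF// exprn_gt0// ltr_wpDl ?exprn_gt0// addr_ge0// sqr_ge0//.
have cu : {for u, continuous (fun u : R => u)} by exact: id.
have c1 : {for u, continuous (fun u : R => u * u + v ^+ 2 + e ^+ 2)}.
  apply: continuousD; last exact: cst_continuous.
  by apply: continuousD; [exact: continuousM|exact: cst_continuous].
exact: (continuousM c1 c1).
Qed.

Lemma etaC e u v : eta e u v = eta e v u.
Proof. by rewrite /eta [in LHS](addrC (u ^+ 2)). Qed.

Lemma eta_mass_shift e w : 0 < e ->
  (\int[mu]_z (eta e (z.1 - w.1) (z.2 - w.2))%:E = \int[mu]_z (eta 1 z.1 z.2)%:E)%E.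
Proof.
move=> e0.
have meas (a b : R * R -> R) (k : R) : measurable_fun setT a -> measurable_fun setT b ->
    measurable_fun [set: pT R] (fun z : pT R => (eta 1 (a z) (b z) * k)%:E).
  move=> ma mb; apply: (@measurable_leb2 _ setT (fun z => eta 1 (a z) (b z) * k)) => //.
  by apply: measurable_funM => //; exact: measurable_eta.
have m1 : measurable_fun [set: R * R] (fun z : R * R => (z.1 - w.1) / e).
  by apply: measurable_funM => //; apply: measurable_funB => //; exact: measurable_coord1.
have m2 : measurable_fun [set: R * R] (fun z : R * R => (z.2 - w.2) / e).
  by apply: measurable_funM => //; apply: measurable_funB => //; exact: measurable_coord2.
have m3 : measurable_fun [set: R * R] (fun z : R * R => z.2) by exact: measurable_coord2.
have m4 : measurable_fun [set: R * R] (fun z : R * R => z.1) by exact: measurable_coord1.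
have e1 : 0 <= e^-1 by rewrite invr_ge0 ltW.
under eq_integral do rewrite eta_scale//.
rewrite fubini_tonelli1/=; last 2 first.
- under eq_fun do rewrite -mulrA; exact: meas.
- by move=> z; rewrite lee_fin; do 2 (apply: mulr_ge0 => //); exact: eta_ge0.
rewrite /fubini_F/=.
transitivity (\int[lb]_x \int[lb]_t (eta 1 ((x - w.1) / e) t / e)%:E)%E.
  apply: eq_integral => x _.
  rewrite -(@ge0_integral_affine _ (fun t => eta 1 ((x - w.1) / e) t / e) w.2 e)//.
  - move=> t; apply: continuousM; last exact: cst_continuous.
    have -> : eta 1 ((x - w.1) / e) = (eta 1)^~ ((x - w.1) / e).
      by apply/funext => y; exact: etaC.
    exact: continuous_eta.
  - by move=> t; rewrite mulr_ge0// eta_ge0.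
rewrite (fubini_tonelli (fun p : pT R => (eta 1 ((p.1 - w.1) / e) p.2 / e)%:E))/=; last 2 first.
- exact: meas.
- by move=> z; rewrite lee_fin mulr_ge0// eta_ge0.
transitivity (\int[lb]_t \int[lb]_s (eta 1 s t)%:E)%E.
  apply: eq_integral => t _.
  rewrite -(@ge0_integral_affine _ (fun s => eta 1 s t) w.1 e)//.
  - exact: continuous_eta.
  - by move=> s; exact: eta_ge0.
rewrite -(fubini_tonelli2 (fun p : pT R => (eta 1 p.1 p.2)%:E))//=.
- have := meas _ _ 1 m4 m3; apply: eq_measurable_fun => z _; by rewrite mulr1.
- by move=> z; rewrite lee_fin eta_ge0.
Qed.

(** The value is [pi], the usual normalisation of the Cauchy transform; the proof relies only on its
    being finite and positive. *)
Definition eta_mass : R := fine (\int[mu]_z (eta 1 z.1 z.2)%:E)%E.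

Let measurable_eta1 : measurable_fun [set: pT R] (fun z : pT R => (eta 1 z.1 z.2)%:E).
Proof.
apply: (@measurable_leb2 _ setT (fun z => eta 1 z.1 z.2)) => //.
by apply: measurable_eta; [exact: measurable_coord1|exact: measurable_coord2].
Qed.

Lemma eta_massE e w : 0 < e ->
  (\int[mu]_z (eta e (z.1 - w.1) (z.2 - w.2))%:E)%E = eta_mass%:E.
Proof.
move=> e0; rewrite eta_mass_shift// /eta_mass fineK// ge0_fin_numE; last first.
  by apply: integral_ge0 => z _; rewrite lee_fin eta_ge0.
(* Finiteness: [eta 1] is at most 16 times a product of two bumps with [d = s = 1]. *)
have cb : continuous (@bump R 1 1) by exact: continuous_bump.
have b0 x : 0 <= @bump R 1 1 x by exact: bump_ge0.
have ib := @integral_bump R 1 1 ltr01 ltr01.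
have h := integral_prod_le cb cb b0 b0 ib ib.
apply: le_lt_trans (ltry (16 * (2 * (pi * Num.sqrt 1) * (2 * (pi * Num.sqrt 1))))).
rewrite [leRHS]EFinM.
apply: le_trans (lee_wpmul2l _ h); last by rewrite lee_fin.
have mbb : measurable_fun [set: pT R]
    (fun w : pT R => (bump (1 : R) 1 w.1 * bump 1 1 w.2)%:E).
  apply: (@measurable_leb2 _ setT (fun w => bump (1 : R) 1 w.1 * bump 1 1 w.2)) => //.
  have mb := continuous_measurable_fun cb.
  apply: measurable_funM.
    exact: (measurableT_comp mb (@measurable_fst _ _ R R)).
  exact: (measurableT_comp mb (@measurable_snd _ _ R R)).
rewrite -ge0_integralZl_EFin//; last by move=> z _; rewrite lee_fin mulr_ge0.
apply: ge0_le_integral => //.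
- by move=> z _; rewrite lee_fin eta_ge0.
- exact: measurable_funeM.
- move=> z _; rewrite -EFinM lee_fin /eta /bump expr1n.
  rewrite -(real_normK (num_real z.1)) -(real_normK (num_real z.2)).
  have := normr_ge0 z.1; have := normr_ge0 z.2.
  move: `|z.1| `|z.2| => x y y0 x0.
  have sq (t : R) : 0 <= t -> 0 < Num.sqrt (t + 1) * (1 + (t + 1)) <= 4 * (t ^+ 2 + 1).
    move=> t0; have t1 : Num.sqrt (t + 1) ^+ 2 = t + 1 by rewrite sqr_sqrtr// addr_ge0.
    have : 0 < Num.sqrt (t + 1) by rewrite sqrtr_gt0 ltr_wpDl.
    move: (Num.sqrt _) t1 => q q2 q0; apply/andP; split; first by rewrite mulr_gt0//; lra.
    have q1 : q <= t + 1 by nra.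
    nra.
  have /andP[p1 q1] := sq _ x0; have /andP[p2 q2] := sq _ y0.
  rewrite !div1r -invfM ler_pdivlMr; last by rewrite mulr_gt0.
  rewrite mulrC ler_pdivrMr; last by rewrite exprn_gt0// ltr_wpDl// addr_ge0// sqr_ge0.
  apply: le_trans (ler_pM _ _ q1 q2) _; rewrite ?(ltW p1) ?(ltW p2)//.
  have := sqr_ge0 x; have := sqr_ge0 y; move: (x ^+ 2) (y ^+ 2) => X Y; nra.
Qed.

Lemma eta_mass_gt0 : 0 < eta_mass.
Proof.
have mO : measurable (@open_square R : set (pT R)).
  by apply: measurable_planeP; exact: measurable_open_square.
rewrite -lte_fin -(@eta_massE 1 (0, 0))//=.
(* On the unit square [x^2 + y^2 + 1 <= 3], so [eta 1 >= 1/9], and the square has measure 1. *)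
apply: (@lt_le_trans _ _ (9^-1)%:E); first by rewrite lte_fin.
apply: (@le_trans _ _ (\int[mu]_(z in @open_square R) (9^-1)%:E)%E).
  by rewrite integral_cst// [X in (_ * X)%E](square_measure R) mule1.
apply: (@le_trans _ _ (\int[mu]_(z in @open_square R) (eta 1 (z.1 - 0) (z.2 - 0))%:E)%E).
  apply: ge0_le_integral => //.
  - under eq_fun do rewrite !subr0; exact: measurable_funTS.
  - move=> z [/=]; rewrite !in_itv/= => /andP[x0 x1] /andP[y0 y1].
    rewrite lee_fin !subr0 /eta expr1n div1r lef_pV2 ?posrE//; last first.
      by rewrite exprn_gt0// ltr_wpDl// addr_ge0// sqr_ge0.
    have x2 : z.1 ^+ 2 <= 1 by rewrite expr_le1// ltW.
    have y2 : z.2 ^+ 2 <= 1 by rewrite expr_le1// ltW.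
    have := sqr_ge0 z.1; have := sqr_ge0 z.2; move: x2 y2.
    by move: (z.1 ^+ 2) (z.2 ^+ 2) => X Y; nra.
apply: ge0_subset_integral => //.
  by under eq_fun do rewrite !subr0.
by move=> z _; rewrite lee_fin eta_ge0.
Qed.

End approximate_identity.

(** * C^1 functions and integration by parts *)

Section continuously_differentiable.
Variable R : realType.
Local Notation C := R[i].
Implicit Types (f g fx fy gx gy : R * R -> R).

(** The partial derivatives are explicit data, taken along slices: integration by parts needs one
    variable at a time, and d-bar derivatives can then be computed by algebra. *)
Definition C1 f fx fy := [/\ continuous f, continuous fx, continuous fy,
  forall x y : R, is_derive x (1 : R) (fun t : R => f (t, y)) (fx (x, y)) &
  forall x y : R, is_derive y (1 : R) (fun t : R => f (x, t)) (fy (x, y))].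

Lemma C1_eq f fx fy g gx gy : C1 f fx fy -> f =1 g -> fx =1 gx -> fy =1 gy ->
  C1 g gx gy.
Proof. by move=> h /funext <- /funext <- /funext <-. Qed.

Lemma C1_cst (k : R) : C1 (fun=> k) (fun=> 0) (fun=> 0).
Proof. by split; try (by move=> z; exact: cst_continuous); move=> x y; exact: is_derive_cst. Qed.

Lemma C1_fst : C1 (fun z => z.1) (fun=> 1) (fun=> 0).
Proof.
split; try (by move=> z; exact: cst_continuous); first by move=> z; exact: cvg_fst.
  by move=> x y; exact: is_derive_id.
by move=> x y; exact: is_derive_cst.
Qed.

Lemma C1_snd : C1 (fun z => z.2) (fun=> 0) (fun=> 1).
Proof.
split; try (by move=> z; exact: cst_continuous); first by move=> z; exact: cvg_snd.
  by move=> x y; exact: is_derive_cst.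
by move=> x y; exact: is_derive_id.
Qed.

Lemma C1_add f fx fy g gx gy : C1 f fx fy -> C1 g gx gy ->
  C1 (fun z => f z + g z) (fun z => fx z + gx z) (fun z => fy z + gy z).
Proof.
move=> [cf cfx cfy dfx dfy] [cg cgx cgy dgx dgy].
split.
- by move=> z; exact: (continuousD (cf z) (cg z)).
- by move=> z; exact: (continuousD (cfx z) (cgx z)).
- by move=> z; exact: (continuousD (cfy z) (cgy z)).
- by move=> x y; exact: (is_deriveD (dfx x y) (dgx x y)).
- by move=> x y; exact: (is_deriveD (dfy x y) (dgy x y)).
Qed.

Lemma C1_mul f fx fy g gx gy : C1 f fx fy -> C1 g gx gy ->
  C1 (fun z => f z * g z) (fun z => fx z * g z + f z * gx z)
     (fun z => fy z * g z + f z * gy z).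
Proof.
move=> [cf cfx cfy dfx dfy] [cg cgx cgy dgx dgy]; split.
- by move=> z; exact: (continuousM (cf z) (cg z)).
- by move=> z; exact: (continuousD (continuousM (cfx z) (cg z)) (continuousM (cf z) (cgx z))).
- by move=> z; exact: (continuousD (continuousM (cfy z) (cg z)) (continuousM (cf z) (cgy z))).
- move=> x y; have := is_deriveM (dfx x y) (dgx x y).
  by rewrite /GRing.scale/= [X in is_derive _ _ _ X]addrC [X in is_derive _ _ _ (X + _)]mulrC.
- move=> x y; have := is_deriveM (dfy x y) (dgy x y).
  by rewrite /GRing.scale/= [X in is_derive _ _ _ X]addrC [X in is_derive _ _ _ (X + _)]mulrC.
Qed.

Lemma C1_opp f fx fy : C1 f fx fy ->
  C1 (fun z => - f z) (fun z => - fx z) (fun z => - fy z).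
Proof.
move=> h; apply: (C1_eq (C1_mul (C1_cst (-1)) h)) => z /=.
- by rewrite mulN1r.
- by rewrite mul0r add0r mulN1r.
- by rewrite mul0r add0r mulN1r.
Qed.

Lemma C1_comp (phi dphi : R -> R) f fx fy : C1 f fx fy ->
  (forall z, is_derive (f z) (1 : R) phi (dphi (f z))) ->
  (forall z, {for (f z), continuous dphi}) ->
  C1 (fun z => phi (f z)) (fun z => dphi (f z) * fx z) (fun z => dphi (f z) * fy z).
Proof.
move=> [cf cfx cfy dfx dfy] dp cdp.
have cp z : {for (f z), continuous phi}.
  by apply/differentiable_continuous/derivable1_diffP; have [] := dp z.
split.
- by move=> z; exact: (continuous_comp (cf z) (cp z)).
- by move=> z; exact: (continuousM (continuous_comp (cf z) (cdp z)) (cfx z)).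
- by move=> z; exact: (continuousM (continuous_comp (cf z) (cdp z)) (cfy z)).
- move=> x y; exact: (@is_derive1_comp _ phi (fun t => f (t, y)) x _ _ (dp (x, y)) (dfx x y)).
- move=> x y; exact: (@is_derive1_comp _ phi (fun t => f (x, t)) y _ _ (dp (x, y)) (dfy x y)).
Qed.

Lemma C1_expR f fx fy : C1 f fx fy ->
  C1 (fun z => expR (f z)) (fun z => expR (f z) * fx z) (fun z => expR (f z) * fy z).
Proof.
move=> h; apply: (@C1_comp expR expR) => // z; exact: continuous_expR.
Qed.

Lemma C1_cos f fx fy : C1 f fx fy ->
  C1 (fun z => cos (f z)) (fun z => - sin (f z) * fx z) (fun z => - sin (f z) * fy z).
Proof.
move=> h; apply: (@C1_comp cos (fun x => - sin x)) => // z.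
by apply: continuousN; exact: continuous_sin.
Qed.

Lemma C1_sin f fx fy : C1 f fx fy ->
  C1 (fun z => sin (f z)) (fun z => cos (f z) * fx z) (fun z => cos (f z) * fy z).
Proof.
move=> h; apply: (@C1_comp sin cos) => // z; exact: continuous_cos.
Qed.

Lemma C1_inv f fx fy : (forall z, f z != 0) -> C1 f fx fy ->
  C1 (fun z => (f z)^-1) (fun z => - (f z) ^- 2 * fx z) (fun z => - (f z) ^- 2 * fy z).
Proof.
move=> f0 h; apply: (@C1_comp GRing.inv (fun x => - x ^- 2)) => // z.
  have := is_deriveV (f0 z) (is_derive_id (f z) (1 : R)).
  by rewrite /GRing.scale/= mulr1.
have c1 : {for f z, continuous (fun x : R => x)} by exact: id.
apply: (@continuousN R R R (fun x => x ^- 2)).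
apply: continuousV; first by rewrite expf_neq0.
exact: (continuousM c1 c1).
Qed.

End continuously_differentiable.

(** * Calculus of d-bar derivatives for C^1 functions *)

Section complex_continuously_differentiable.
Variable R : realType.
Local Notation C := R[i].
Implicit Types (f fb g gb : R * R -> C).

(* [f] is of class C^1 and [fb] is its d-bar derivative. *)
Definition CD (f fb : R * R -> C) := exists ax ay bx byy,
  [/\ C1 (fun z => cRe (f z)) ax ay, C1 (fun z => cIm (f z)) bx byy &
   forall z, fb z = (2^-1)%:C * ((ax z - byy z) +i* (bx z + ay z))].

Lemma CD_cont f fb z : CD f fb -> ccont z f.
Proof. move=> [ax [ay [bx [b_y [[c1 _ _ _ _] [c2 _ _ _ _] _]]]]].
by split; [exact: c1|exact: c2]. Qed.

Lemma CD_cont_dbar f fb z : CD f fb -> ccont z fb.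
Proof.
move=> [ax [ay [bx [b_y [[_ cax cay _ _] [_ cbx cby _ _] h]]]]].
apply: (ccont_eq (fun z => esym (h z))); apply: ccontM; first exact: ccont_cst.
by split => /=; [exact: (continuousB (cax z) (cby z))|exact: (continuousD (cbx z) (cay z))].
Qed.

Lemma CD_eq f fb g gb : CD f fb -> f =1 g -> fb =1 gb -> CD g gb.
Proof. by move=> h /funext <- /funext <-. Qed.

Lemma CD_cst (c : C) : CD (fun=> c) (fun=> 0).
Proof.
exists (fun=> 0), (fun=> 0), (fun=> 0), (fun=> 0); split; try exact: C1_cst.
by move=> z; apply: complex_eq; rewrite !cRI/=; ring.
Qed.

Lemma CD_pz : CD (@pz R) (fun=> 0).
Proof.
exists (fun=> 1), (fun=> 0), (fun=> 0), (fun=> 1); split.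
- exact: C1_fst.
- exact: C1_snd.
- by move=> z; apply: complex_eq; rewrite !cRI/=; ring.
Qed.

Lemma CD_conj_pz : CD (fun z => conjc (pz z)) (fun=> 1).
Proof.
exists (fun=> 1), (fun=> 0), (fun=> 0), (fun=> -1); split.
- exact: C1_fst.
- by apply: (C1_eq (C1_opp (C1_snd R))) => z //=; rewrite oppr0.
- by move=> z; apply: complex_eq; rewrite !cRI/=; field.
Qed.

Lemma CD_add f fb g gb : CD f fb -> CD g gb ->
  CD (fun z => f z + g z) (fun z => fb z + gb z).
Proof.
move=> [ax [ay [bx [b_y [f1 f2 h]]]]] [cx [cy [dx [dy [g1 g2 k]]]]].
exists (fun z => ax z + cx z), (fun z => ay z + cy z), (fun z => bx z + dx z), (fun z => b_y z + dy z).
split.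
- by apply: (C1_eq (C1_add f1 g1)) => z //=; rewrite cRI.
- by apply: (C1_eq (C1_add f2 g2)) => z //=; rewrite cRI.
- by move=> z; rewrite h k; apply: complex_eq; rewrite !cRI/=; ring.
Qed.

Lemma CD_mul f fb g gb : CD f fb -> CD g gb ->
  CD (fun z => f z * g z) (fun z => fb z * g z + f z * gb z).
Proof.
move=> [ax [ay [bx [b_y [f1 f2 h]]]]] [cx [cy [dx [dy [g1 g2 k]]]]].
eexists; eexists; eexists; eexists; split.
- apply: (C1_eq (C1_add (C1_mul f1 g1) (C1_opp (C1_mul f2 g2)))) => z //=.
  by rewrite cRI.
- apply: (C1_eq (C1_add (C1_mul f1 g2) (C1_mul f2 g1))) => z //=.
  by rewrite cRI.
- by move=> z; rewrite h k; apply: complex_eq; rewrite !cRI/=; ring.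
Qed.

Lemma CD_opp f fb : CD f fb -> CD (fun z => - f z) (fun z => - fb z).
Proof.
move=> h; apply: (CD_eq (CD_mul (CD_cst (-1)) h)) => z /=.
  by rewrite mulN1r.
by rewrite mul0r add0r mulN1r.
Qed.

Lemma CD_cexp f fb : CD f fb -> CD (fun z => cexp (f z)) (fun z => cexp (f z) * fb z).
Proof.
move=> [ax [ay [bx [b_y [f1 f2 h]]]]].
eexists; eexists; eexists; eexists; split.
- exact: (C1_mul (C1_expR f1) (C1_cos f2)).
- exact: (C1_mul (C1_expR f1) (C1_sin f2)).
- by move=> z; rewrite h; apply: complex_eq; rewrite !cRI/=; ring.
Qed.

Lemma CD_inv f fb : (forall z, f z != 0) -> CD f fb ->
  CD (fun z => (f z)^-1) (fun z => - fb z / f z ^+ 2).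
Proof.
move=> f0 [ax [ay [bx [b_y [f1 f2 h]]]]].
pose N z := cRe (f z) * cRe (f z) + cIm (f z) * cIm (f z).
have N0 z : N z != 0.
  by rewrite /N -!expr2 -nc_sqr expf_neq0// nc_eq0.
have N1 := C1_inv N0 (C1_add (C1_mul f1 f1) (C1_mul f2 f2)).
eexists; eexists; eexists; eexists; split.
- apply: (C1_eq (C1_mul f1 N1)) => z //=.
  by rewrite cRe_inv /N -!expr2.
- apply: (C1_eq (C1_opp (C1_mul f2 N1))) => z //=.
  by rewrite cIm_inv mulNr /N -!expr2.
- move=> z; rewrite h -exprVn; have := N0 z; rewrite /N; set a := cRe (f z).
  set b := cIm (f z) => ab0.
  have -> : (f z)^-1 = (a / (a * a + b * b)) +i* (- b / (a * a + b * b)).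
    by apply: complex_eq; rewrite ?cRe_inv ?cIm_inv -!expr2.
  by rewrite expr2; apply: complex_eq => /=; field.
Qed.

End complex_continuously_differentiable.

(** * Integration by parts against compactly supported C^1 functions *)

Section integration_by_parts_plane.
Variable R : realType.
Local Notation C := R[i].
Local Notation mu := (leb2 R).
Local Notation lb := (@lebesgue_measure R).
Local Notation D := (@open_square R).

Lemma plane_hausdorff : hausdorff_space (R * R)%type.
Proof. exact: norm_hausdorff. Qed.

Lemma compact_support_bounded (K : set (R * R)) (f : R * R -> R) :
  compact K -> continuous f -> (forall z, ~ K z -> f z = 0) ->
  exists B, forall z, `|f z| <= B.
Proof.
move=> cK cf f0.
have /compact_bounded[M [_ hM]] := continuous_compact (continuous_subspaceT cf) cK.
exists (`|M| + 1) => z; have [Kz|nKz] := pselect (K z); last first.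
  by rewrite f0// normr0 addr_ge0.
apply: hM; last by exists z.
by rewrite (le_lt_trans (ler_norm _))// ltrDl.
Qed.

Lemma integrable_compact_support (K : set (R * R)) (g : R * R -> R) :
  compact K -> K `<=` D -> continuous g -> (forall z, ~ K z -> g z = 0) ->
  mu.-integrable D (EFin \o g).
Proof.
move=> cK KD cg g0; have [B gB] := compact_support_bounded cK cg g0.
have mD : measurable (D : set (pT R)).
  by apply: measurable_planeP; exact: measurable_open_square.
have mg : measurable_fun [set: R * R] g.
  by apply: continuous_measurable_plane; [exact: openT|move=> z _; exact: cg].
apply: measurable_bounded_integrable => //.
- by rewrite [X in (X < _)%E](square_measure R) ltry.
- by apply: measurable_fun_plane; [exact: measurable_open_square|exact: measurable_funTS].
- exists B; split; first by rewrite num_real.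
  by move=> x Bx z _ /=; exact: (le_trans (gB z) (ltW Bx)).
Qed.

Lemma integral_slices0 (K : set (R * R)) (g : R * R -> R) :
  compact K -> K `<=` D -> continuous g -> (forall z, ~ K z -> g z = 0) ->
  (forall y, \int[lb]_x (g (x, y))%:E = 0)%E \/ (forall x, \int[lb]_y (g (x, y))%:E = 0)%E ->
  \int[mu]_(z in D) g z = 0.
Proof.
move=> cK KD cg g0 gint.
have gD z : ~ D z -> g z = 0 by move=> nDz; apply: g0 => /KD.
have mD : measurable (D : set (pT R)).
  by apply: measurable_planeP; exact: measurable_open_square.
have gE : g = g \_ D.
  by apply/funext => z; rewrite patchE; case: ifPn => // /negP nDz; rewrite gD// => /mem_set.
have ig : mu.-integrable setT (EFin \o g).
  have iD := integrable_compact_support cK KD cg g0.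
  by rewrite gE -restrict_EFin; apply/integrable_restrict => //=; rewrite ?setTI ?setIT.
rewrite Rintegral_mkcond -gE /Rintegral.
case: gint => gint.
  by rewrite -(integral21_prod_meas1 ig)/= /fubini_G integral0_eq// => y _; exact: gint.
by rewrite -(integral12_prod_meas1 ig)/= /fubini_F integral0_eq// => x _; exact: gint.
Qed.

Lemma pairl_continuous (y : R) : continuous (fun t : R => (t, y)).
Proof.
by move=> x A; apply: (@cvg_pair _ _ _ (nbhs x) (nbhs x) (nbhs y) _ _ _ (fun t => t) (fun=> y)
  cvg_id (cvg_cst y)).
Qed.

Lemma pairr_continuous (x : R) : continuous (fun t : R => (x, t)).
Proof.
by move=> y A; apply: (@cvg_pair _ _ _ (nbhs y) (nbhs x) (nbhs y) _ _ _ (fun=> x) (fun t => t)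
  (cvg_cst x) cvg_id).
Qed.

Lemma derivative_near0 (f : R -> R) x l : is_derive x (1 : R) f l ->
  (\forall t \near x, f t = 0) -> l = 0.
Proof.
move=> df nf.
have [_ <-] := df.
by rewrite (@near_eq_derive _ _ _ _ (fun=> 0)) ?derive_cst.
Qed.

Lemma C1_support (K : set (R * R)) f fx fy : closed K -> C1 f fx fy ->
  (forall z, ~ K z -> f z = 0) ->
  (forall z, ~ K z -> fx z = 0) /\ (forall z, ~ K z -> fy z = 0).
Proof.
move=> cK [_ _ _ dfx dfy] f0.
have nK z : ~ K z -> \forall w \near z, ~ K w.
  by move=> Kz; apply: open_nbhs_nbhs; split => //; exact: closed_openC.
split=> -[x y] Kz.
  apply: (derivative_near0 (dfx x y)).
  exact: (filterS (fun t => f0 (t, y)) (@pairl_continuous y x _ (nK _ Kz))).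
apply: (derivative_near0 (dfy x y)).
exact: (filterS (fun t => f0 (x, t)) (@pairr_continuous x y _ (nK _ Kz))).
Qed.

Lemma integral_derivative0 (f df : R -> R) :
  continuous df -> (forall x, is_derive x (1 : R) f (df x)) ->
  (forall x, ~ (0 < x < 1) -> f x = 0) -> (forall x, ~ (0 < x < 1) -> df x = 0) ->
  (\int[lb]_x (df x)%:E = 0)%E.
Proof.
move=> cdf dff f0 df0.
have cf x : {for x, continuous f}.
  by apply/differentiable_continuous/derivable1_diffP; have [] := dff x.
transitivity (\int[lb]_(x in `[0%R, 1%R]) (df x)%:E)%E.
  rewrite [RHS]integral_mkcond; apply: eq_integral => x _; rewrite patchE.
  case: ifPn => // /negP x01; rewrite df0// => /andP[x0 x1]; apply: x01.
  by rewrite inE/= in_itv/= !ltW.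
rewrite (@continuous_FTC2 _ _ f)//.
- by rewrite !f0 ?subee// ltxx ?andbF.
- exact: continuous_subspaceT.
- split.
  + by move=> x _; have [] := dff x.
  + exact: cvg_at_right_filter (cf 0).
  + exact: cvg_at_left_filter (cf 1).
- by move=> x _; rewrite derive1E; have [_] := dff x.
Qed.

(** By Fubini it suffices to integrate along slices, where the fundamental theorem of calculus on
    [[0,1]] gives a difference of two boundary values, both 0. *)
Lemma C1_integral0 (K : set (R * R)) f fx fy : compact K -> K `<=` D -> C1 f fx fy ->
  (forall z, ~ K z -> f z = 0) ->
  \int[mu]_(z in D) fx z = 0 /\ \int[mu]_(z in D) fy z = 0.
Proof.
move=> cK KD h f0.
have [fx0 fy0] := C1_support (compact_closed plane_hausdorff cK) h f0.
case: h => cf cfx cfy dfx dfy.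
split; apply: (integral_slices0 cK KD) => //; [left => y|right => x].
- apply: (@integral_derivative0 (fun x => f (x, y)) (fun x => fx (x, y)) _
    (fun x => dfx x y)) => [x|x x01|x x01].
  + apply: (@continuous_comp _ _ _ (fun t : R => (t, y)) fx); last exact: cfx.
    exact: pairl_continuous.
  + by apply: f0 => /KD [/=]; rewrite in_itv.
  + by apply: fx0 => /KD [/=]; rewrite in_itv.
- apply: (@integral_derivative0 (fun y => f (x, y)) (fun y => fy (x, y)) _
    (fun y => dfy x y)) => [y|y y01|y y01].
  + apply: (@continuous_comp _ _ _ (fun t : R => (x, t)) fy); last exact: cfy.
    exact: pairr_continuous.
  + by apply: f0 => /KD [/= _]; rewrite in_itv.
  + by apply: fy0 => /KD [/= _]; rewrite in_itv.
Qed.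

Definition test_pair (psi Psi : R * R -> C) := CD psi Psi /\
  exists K : set (R * R), [/\ compact K, K `<=` D & forall z, ~ K z -> psi z = 0].

Lemma test_pair_mul m mb psi Psi : CD m mb -> test_pair psi Psi ->
  test_pair (fun z => m z * psi z) (fun z => mb z * psi z + m z * Psi z).
Proof.
move=> hm [h [K [cK KD K0]]]; split; first exact: CD_mul.
by exists K; split => // z Kz; rewrite K0// mulr0.
Qed.

Lemma test_pair_cont psi Psi z : test_pair psi Psi -> ccont z psi /\ ccont z Psi.
Proof. by move=> [h _]; split; [exact: (CD_cont z h)|exact: (CD_cont_dbar z h)]. Qed.

Lemma test_pair_supp psi Psi : test_pair psi Psi -> exists K : set (R * R),
  [/\ compact K, K `<=` D, forall z, ~ K z -> psi z = 0 & forall z, ~ K z -> Psi z = 0].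
Proof.
move=> [[ax [ay [bx [b_y [h1 h2 h]]]]] [K [cK KD K0]]].
exists K; split => // z Kz; rewrite h.
have [ax0 ay0] := C1_support (compact_closed plane_hausdorff cK) h1
  (fun z Kz => congr1 (@complex.Re R) (K0 z Kz)).
have [bx0 by0] := C1_support (compact_closed plane_hausdorff cK) h2
  (fun z Kz => congr1 (@complex.Im R) (K0 z Kz)).
by rewrite ax0// ay0// bx0// by0// subrr addr0 mulr0.
Qed.

Lemma test_pair_bound psi Psi : test_pair psi Psi ->
  exists B, forall z, nc (psi z) <= B /\ nc (Psi z) <= B.
Proof.
move=> t; have [K [cK _ K1 K2]] := test_pair_supp t.
have bd (f : R * R -> C) : (forall z, ccont z f) -> (forall z, ~ K z -> f z = 0) ->
    exists B, forall z, nc (f z) <= B.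
  move=> cf f0.
  have [B1 h1] := @compact_support_bounded K _ cK (fun z => (cf z).1)
    (fun z Kz => congr1 (@complex.Re R) (f0 z Kz)).
  have [B2 h2] := @compact_support_bounded K _ cK (fun z => (cf z).2)
    (fun z Kz => congr1 (@complex.Im R) (f0 z Kz)).
  by exists (B1 + B2) => z; rewrite (le_trans (nc_leD _))// lerD.
have [B1 h1] := bd _ (fun z => (test_pair_cont z t).1) K1.
have [B2 h2] := bd _ (fun z => (test_pair_cont z t).2) K2.
exists (Num.max B1 B2) => z.
by rewrite (le_trans (h1 z)) ?(le_trans (h2 z))// le_max lexx ?orbT.
Qed.

Lemma test_pair_integral0 psi Psi : test_pair psi Psi -> cintegral D Psi = 0.
Proof.
move=> t; have [[ax [ay [bx [b_y [h1 h2 h]]]]] [K [cK KD K0]]] := t.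
have [ax0 ay0] := C1_integral0 cK KD h1 (fun z Kz => congr1 (@complex.Re R) (K0 z Kz)).
have [bx0 by0] := C1_integral0 cK KD h2 (fun z Kz => congr1 (@complex.Im R) (K0 z Kz)).
have [ax1 ay1] := C1_support (compact_closed plane_hausdorff cK) h1
  (fun z Kz => congr1 (@complex.Re R) (K0 z Kz)).
have [bx1 by1] := C1_support (compact_closed plane_hausdorff cK) h2
  (fun z Kz => congr1 (@complex.Im R) (K0 z Kz)).
have mD : measurable (D : set (pT R)).
  by apply: measurable_planeP; exact: measurable_open_square.
have [_ cax cay _ _] := h1; have [_ cbx cby _ _] := h2.
have iax := integrable_compact_support cK KD cax ax1.
have iay := integrable_compact_support cK KD cay ay1.
have ibx := integrable_compact_support cK KD cbx bx1.
have iby := integrable_compact_support cK KD cby by1.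
rewrite (eq_cintegral (g := fun z => (2^-1)%:C * ((ax z - b_y z) +i* (bx z + ay z)))); last first.
  by move=> z _; exact: h.
rewrite cintegralZ; last 2 first.
- exact: measurable_open_square.
- split; first exact: (@integrableB _ _ R mu D mD _ _ iax iby).
  exact: (@integrableD _ _ R mu D mD _ _ ibx iay).
rewrite [X in _ * X](_ : _ = 0) ?mulr0//; apply: complex_eq => /=.
  by rewrite RintegralB// ax0 by0 subr0.
by rewrite RintegralD// bx0 ay0 addr0.
Qed.

Lemma test_function_pair (phi : R * R -> R) : test_function D phi ->
  test_pair (fun z => (phi z)%:C) (dbar phi).
Proof.
move=> [sphi [K [cK KD K0]]]; split; last first.
  by exists K; split => // z Kz; rewrite K0.
have [cp dp] := sphi [::].
have [cx _] := sphi [:: (1, 0)]; have [cy _] := sphi [:: (0, 1)].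
exists (fun z => 'D_((1, 0) : R * R) phi z), (fun z => 'D_((0, 1) : R * R) phi z), (fun=> 0), (fun=> 0).
split.
- split; [exact: cp|exact: cx|exact: cy|move=> x y|move=> x y].
  (* The difference quotient of [phi] along a coordinate vector is that of its restriction to the
     slice. *)
  + have E : (fun h : R => h^-1 *: (phi (h *: ((1, 0) : R * R) + (x, y)) - phi (x, y))) =
      (fun h : R => h^-1 *: (phi (h *: 1 + x, y) - phi (x, y))).
      apply/funext => h; congr (_ *: (phi _ - _)).
      by rewrite [LHS]surjective_pairing /= scaler0 add0r.
    by have := dp (x, y) (1, 0); rewrite /derivable E => d; split; rewrite // /derive E.
  + have E : (fun h : R => h^-1 *: (phi (h *: ((0, 1) : R * R) + (x, y)) - phi (x, y))) =
      (fun h : R => h^-1 *: (phi (x, h *: 1 + y) - phi (x, y))).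
      apply/funext => h; congr (_ *: (phi _ - _)).
      by rewrite [LHS]surjective_pairing /= scaler0 add0r.
    by have := dp (x, y) (0, 1); rewrite /derivable E => d; split; rewrite // /derive E.
- exact: C1_cst.
- by move=> z; rewrite /dbar subr0 add0r.
Qed.

End integration_by_parts_plane.

(** * The weighted inverse of d-bar *)

Section cauchy_kernel.
Variable R : realType.
Local Notation C := R[i].
Local Notation mu := (leb2 R).
Local Notation D := (@open_square R).
Implicit Types (z w : R * R) (L e : R) (F : R * R -> C).

Definition wt L z : R := expR (L * z.2 ^+ 2).

(* [kexp L] is holomorphic in z and equal to 1 on the diagonal; relative to the
   weight [wt L] it decays like a Gaussian of variance 1/L. *)
Definition kexp L z w : C := cexp (- (L%:C * ((pz z - pz w) ^+ 2 * (2^-1)%:C +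
  (0 +i* (2 * w.2)) * (pz z - pz w)))).

Definition kern L z w : C := kexp L z w / (pz z - pz w).

(** The factor [1/x] of [kern] is replaced by [conj(x) / (|x|^2 + e^2)], which is C^1 on the whole
    plane and agrees with [1/x] in the limit [e -> 0]. *)
Definition kreg L e z w : C := kexp L z w * (conjc (pz z - pz w) /
  ((pz z - pz w) * conjc (pz z - pz w) + (e ^+ 2)%:C)).

Lemma wt_gt0 L z : 0 < wt L z. Proof. exact: expR_gt0. Qed.

(** With [y = z.2 - w.2], the real part of the exponent is [-L/2 |z-w|^2 + L (y^2 + 2 w.2 y)], and
    the last bracket equals [z.2^2 - w.2^2]. The linear term of [kexp] is there to complete this
    square. *)
Lemma nc_kexp L z w : nc (kexp L z w) =
  expR (- (L / 2 * nc (pz z - pz w) ^+ 2)) * (wt L z / wt L w).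
Proof.
rewrite nc_cexp /wt -expRN -!expRD nc_sqr expr2; congr expR.
by rewrite !cRI/=; field.
Qed.

Lemma kexp_diag L z : kexp L z z = 1.
Proof. by rewrite /kexp subrr expr0n/= mul0r mulr0 addr0 mulr0 oppr0 cexp0. Qed.

Lemma mulc_conj (x : C) : x * conjc x = (nc x ^+ 2)%:C.
Proof. by apply: complex_eq; rewrite nc_sqr !cRI/= ?expr2; ring. Qed.

Lemma kreg_den_neq0 e (x : C) : e != 0 -> x * conjc x + (e ^+ 2)%:C != 0.
Proof.
move=> e0; rewrite mulc_conj -rmorphD/= -nc_eq0 nc_real ger0_norm ?addr_ge0 ?sqr_ge0//.
by rewrite gt_eqF// ltr_wpDl ?sqr_ge0// exprn_even_gt0.
Qed.

Lemma kern_diff L e z w : e != 0 -> kern L z w - kreg L e z w =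
  kexp L z w * ((e ^+ 2)%:C / ((pz z - pz w) * (nc (pz z - pz w) ^+ 2 + e ^+ 2)%:C)).
Proof.
move=> e0; rewrite /kern /kreg; move: (pz z - pz w : C) => x.
(* On the diagonal everything vanishes, by the convention on the inverse of 0. *)
have [x0|x0] := eqVneq x 0.
  have i0 : x^-1 = 0 :> C by apply/eqP; rewrite invr_eq0 x0.
  have c0 : conjc x = 0 :> C by rewrite x0 conjc0.
  by rewrite invfM i0 c0 !(mul0r, mulr0) subr0.
rewrite -mulrBr; congr (_ * _); rewrite rmorphD/= -mulc_conj.
have d0 := kreg_den_neq0 x e0.
move: ((e ^+ 2)%:C : C) (conjc x : C) d0 => k y d0.
by field; rewrite x0 d0.
Qed.

Lemma cmeas_pz d (T : measurableType d) (f : T -> R * R) A : measurable_fun A f ->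
  cmeas A (fun t => pz (f t)).
Proof.
move=> mf; split.
  exact: (measurableT_comp (@measurable_fst _ _ R R) mf).
exact: (measurableT_comp (@measurable_snd _ _ R R) mf).
Qed.

Lemma cmeas_conj d (T : measurableType d) (f : T -> C) A : cmeas A f ->
  cmeas A (fun t => conjc (f t)).
Proof.
case=> mr mi; split; first by under eq_fun do rewrite cRe_conj; exact: mr.
by under eq_fun do rewrite cIm_conj; exact: measurableT_comp mi.
Qed.

Lemma cmeas_kern d (T : measurableType d) (a b : T -> R * R) A L :
  measurable_fun A a -> measurable_fun A b -> cmeas A (fun t => kern L (a t) (b t)).
Proof.
move=> ma mb.
have mx : cmeas A (fun t => pz (a t) - pz (b t)).
  by apply: cmeasD; [|apply: cmeasN]; exact: cmeas_pz.
apply: cmeasM; last exact: cmeas_inv.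
apply: cmeas_cexp; apply: cmeasN; apply: cmeasM; first exact: cmeas_cst.
apply: cmeasD; first by apply: cmeasM; [exact: cmeasM|exact: cmeas_cst].
apply: cmeasM => //; split; first exact: measurable_cst.
apply: measurable_funM => //.
exact: (measurableT_comp (@measurable_snd _ _ R R) mb).
Qed.

Lemma cmeas_kreg d (T : measurableType d) (a b : T -> R * R) A L e :
  measurable_fun A a -> measurable_fun A b -> cmeas A (fun t => kreg L e (a t) (b t)).
Proof.
move=> ma mb.
have mx : cmeas A (fun t => pz (a t) - pz (b t)).
  by apply: cmeasD; [|apply: cmeasN]; exact: cmeas_pz.
have mcx : cmeas A (fun t => conjc (pz (a t) - pz (b t))).
  by exact: cmeas_conj.
apply: cmeasM; last first.
  apply: cmeasM => //; apply: cmeas_inv; apply: cmeasD; last exact: cmeas_cst.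
  exact: cmeasM.
apply: cmeas_cexp; apply: cmeasN; apply: cmeasM; first exact: cmeas_cst.
apply: cmeasD; first by apply: cmeasM; [exact: cmeasM|exact: cmeas_cst].
apply: cmeasM => //; split; first exact: measurable_cst.
apply: measurable_funM => //.
exact: (measurableT_comp (@measurable_snd _ _ R R) mb).
Qed.

Lemma ccont_kreg L e (p : (R * R) * (R * R)) : e != 0 ->
  ccont p (fun p => kreg L e p.1 p.2).
Proof.
move=> e0.
have cpz (q : R * R) : ccont q (@pz R) by exact: (CD_cont q (CD_pz R)).
have c1 : ccont p (fun p => pz p.1).
  split.
    exact: (continuous_comp (g := fun q : R * R => q.1) (@cvg_fst _ _ _ _ _) (cpz p.1).1).
  exact: (continuous_comp (@cvg_fst _ _ _ _ _) (cpz p.1).2).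
have c2 : ccont p (fun p => pz p.2).
  split.
    exact: (continuous_comp (@cvg_snd _ _ _ _ _) (cpz p.2).1).
  exact: (continuous_comp (@cvg_snd _ _ _ _ _) (cpz p.2).2).
have cx := ccontB c1 c2.
apply: ccontM.
  apply: ccont_cexp; apply: ccontN; apply: ccontM; first exact: ccont_cst.
  apply: ccontD; first by apply: ccontM; [exact: ccontM|exact: ccont_cst].
  apply: ccontM => //; split; first exact: cst_continuous.
  apply: (@continuousM _ _ (fun=> 2)); first exact: cst_continuous.
  exact: c2.2.
apply: ccontM; first exact: ccont_conj.
apply: ccont_inv; first exact: kreg_den_neq0.
by apply: ccontD; [exact: ccontM (ccont_conj cx)|exact: ccont_cst].
Qed.

Lemma expRN_le (v : R) : 0 <= v -> expR (- (v ^+ 2 / 2)) <= 2 / (1 + v).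
Proof.
move=> v0; rewrite expRN -[leRHS]invrK lef_pV2 ?posrE ?expR_gt0//; last first.
  by rewrite invr_gt0 divr_gt0//; lra.
apply: le_trans (expR_ge1Dx _); rewrite invf_div ler_pdivrMr//.
by have := sqr_ge0 (v - 1); nra.
Qed.

(** In each variable the Gaussian is at most [2 d / (d + |x|)] with decay scale [d = 1/sqrt L].
    [kernel_integral] then gives a multiple of [sqrt d * sqrt d = 1/sqrt L]: this is the gain in
    [L]. *)
Lemma gauss_kernel_integral L z : 0 < L ->
  (\int[mu]_w (expR (- (L / 2 * nc (pz z - pz w) ^+ 2)) / nc (pz z - pz w))%:E <=
   (64 * pi ^+ 2 / Num.sqrt L)%:E)%E.
Proof.
move=> L0; set s := Num.sqrt L.
have s0 : 0 < s by rewrite sqrtr_gt0.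
have LE : L = s ^+ 2 by rewrite sqr_sqrtr// ltW.
have si0 : 0 < s^-1 by rewrite invr_gt0.
have mg : measurable_fun setT (fun w => expR (- (L / 2 * nc (pz z - pz w) ^+ 2))).
  apply: (measurableT_comp (continuous_measurable_fun (@continuous_expR R))).
  apply: measurableT_comp => //; apply: measurable_funM => //.
  by apply: measurable_funX; exact: measurable_nc_pz.
have := @kernel_integral R z _ 4 s^-1 s^-1 si0 si0 mg (fun w => expR_ge0 _).
have -> : 4 * 4 * (2 * (pi * Num.sqrt s^-1) * (2 * (pi * Num.sqrt s^-1))) = 64 * pi ^+ 2 / s.
  have := sqr_sqrtr (ltW si0); move: (Num.sqrt _) => r; rewrite -[X in _ = X -> _]mul1r => rE.
  rewrite -[RHS](_ : 64 * pi ^+ 2 * r ^+ 2 = _); first by ring.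
  by rewrite rE mul1r.
apply=> w; rewrite nc_sqr !cRI/= mulrDr opprD expRD.
have half (x : R) : expR (- (L / 2 * (x ^+ 2))) <= 2 * (s^-1 / (s^-1 + `|x|)).
  have -> : L / 2 * x ^+ 2 = (s * `|x|) ^+ 2 / 2.
    by rewrite exprMn real_normK ?num_real// -LE; ring.
  apply: le_trans (expRN_le _) _; first by rewrite mulr_ge0// ltW.
  apply: eq_ler.
  have : 0 <= `|x| by []. move: `|x| => y y0; field.
  by apply/andP; split; rewrite gt_eqF// ltr_wpDr// mulr_ge0// ltW.
rewrite -[leRHS](_ : (2 * (s^-1 / (s^-1 + `|z.1 - w.1|))) * (2 * (s^-1 / (s^-1 + `|z.2 - w.2|))) = _).
  by apply: ler_pM; rewrite ?expR_ge0// half.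
ring.
Qed.

Lemma open_square_measure_fin : (mu D < +oo)%E.
Proof. by rewrite (square_measure R) ltry. Qed.

Lemma integral_sub_plane (g : R * R -> R) (B : R) : measurable_fun setT g ->
  (forall w, 0 <= g w) -> (\int[mu]_w (g w)%:E <= B%:E)%E ->
  (\int[mu]_(w in D) (g w)%:E <= B%:E)%E.
Proof.
move=> mg g0; apply: le_trans; apply: ge0_subset_integral => //.
- by apply: measurable_planeP; exact: measurable_open_square.
- exact: measurable_leb2.
- by move=> w _; rewrite lee_fin.
Qed.

Lemma integral_scale_le (S : set (R * R)) (g : R * R -> R) (k B : R) : measurable S ->
  measurable_fun S g -> (forall w, 0 <= g w) -> 0 <= k ->
  (\int[mu]_(w in S) (g w)%:E <= B%:E)%E ->
  (\int[mu]_(w in S) (k * g w)%:E <= (k * B)%:E)%E.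
Proof.
move=> mS mg g0 k0 gB; under eq_integral do rewrite EFinM.
have mS' := measurable_planeP mS; rewrite ge0_integralZl_EFin//.
- by rewrite [leRHS]EFinM; apply: lee_wpmul2l; rewrite ?lee_fin.
- by move=> w _; rewrite lee_fin.
- exact: measurable_leb2.
Qed.

Definition dbar_inv L F z : C :=
  ((eta_mass R)^-1)%:C * cintegral D (fun w => F w * kern L z w).

Definition dbar_inv_cst : R := 128 * pi ^+ 2 / eta_mass R.

Lemma dbar_inv_cst_gt0 : 0 < dbar_inv_cst.
Proof. by rewrite divr_gt0 ?eta_mass_gt0// mulr_gt0// exprn_gt0// pi_gt0. Qed.

(** The quotient [wt L z / wt L w] in the modulus of [kexp] converts the bound on [F] at [w] into
    the same weighted bound at [z], leaving only the integral of the Gaussian kernel. The 128 in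
    [dbar_inv_cst] is 64 doubled by [cintegral_bound]. *)
Lemma dbar_inv_bound L F (B : R) z : 0 < L -> 0 <= B -> cmeas D F ->
  (forall w, D w -> nc (F w) <= B * wt L w) ->
  cintegrable D (fun w => F w * kern L z w) /\
  nc (dbar_inv L F z) <= dbar_inv_cst / Num.sqrt L * (B * wt L z).
Proof.
move=> L0 B0 mF FB.
have k0 : 0 <= B * wt L z by rewrite mulr_ge0// ltW// wt_gt0.
pose h w := expR (- (L / 2 * nc (pz z - pz w) ^+ 2)) / nc (pz z - pz w).
have h0 w : 0 <= h w by rewrite divr_ge0 ?expR_ge0 ?nc_ge0.
have mh : measurable_fun setT h.
  apply: measurable_funM.
    apply: (measurableT_comp (continuous_measurable_fun (@continuous_expR R))).
    apply: measurableT_comp => //; apply: measurable_funM => //.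
    by apply: measurable_funX; exact: measurable_nc_pz.
  by apply: measurableT_comp (@measurable_inv R) _; exact: measurable_nc_pz.
have hB : (\int[mu]_(w in D) (B * wt L z * h w)%:E <=
    (B * wt L z * (64 * pi ^+ 2 / Num.sqrt L))%:E)%E.
  apply: integral_scale_le => //; [exact: measurable_open_square|exact: measurable_funTS|].
  by apply: integral_sub_plane => //; exact: gauss_kernel_integral.
have mFk : cmeas D (fun w => F w * kern L z w).
  by apply: cmeasM => //; apply: cmeas_kern => //; exact: measurable_cst.
have mBh : measurable_fun D (fun w => B * wt L z * h w).
  by apply: measurable_funM => //; exact: measurable_funTS.
have Fk w : D w -> nc (F w * kern L z w) <= B * wt L z * h w.
  move=> Dw; rewrite !ncM ncV nc_kexp.
  have wt0 := wt_gt0 L w.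
  apply: le_trans (ler_wpM2r _ (FB w Dw)) _.
    by rewrite !mulr_ge0 ?invr_ge0 ?nc_ge0 ?expR_ge0 ?(ltW (wt_gt0 _ _)).
  apply: eq_ler; rewrite /h.
  by move: (expR _) (nc _)^-1 => a b; field; rewrite gt_eqF.
have [i1 i2] := cintegral_bound (@measurable_open_square R) mFk mBh Fk hB.
split => //; rewrite ncM nc_real ger0_norm ?invr_ge0 ?(ltW (eta_mass_gt0 R))//.
apply: le_trans (ler_wpM2l _ i2) _; first by rewrite invr_ge0 ltW// eta_mass_gt0.
apply: eq_ler; rewrite /dbar_inv_cst; ring.
Qed.

End cauchy_kernel.

(** * Regularised kernels and their convergence *)

Section kernel_approximation.
Variable R : realType.
Local Notation C := R[i].
Local Notation mu := (leb2 R).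
Local Notation D := (@open_square R).
Implicit Types (z w : R * R) (L e : R) (F X : R * R -> C).

Lemma CD_kexp L w : CD (fun z => kexp L z w) (fun=> 0).
Proof.
pose dx := CD_add (CD_pz R) (CD_cst (- pz w : C)).
apply: (CD_eq (CD_cexp (CD_opp (CD_mul (CD_cst (L%:C : C))
  (CD_add (CD_mul (CD_mul dx dx) (CD_cst ((2^-1)%:C : C)))
    (CD_mul (CD_cst (0 +i* (2 * w.2) : C)) dx)))))) => z.
  by rewrite /kexp expr2.
by rewrite /= !(addr0, mul0r, mulr0, add0r, oppr0).
Qed.

Lemma CD_kreg L e w : e != 0 ->
  CD (fun z => kreg L e z w)
     (fun z => kexp L z w * (eta e (z.1 - w.1) (z.2 - w.2))%:C).
Proof.
move=> e0.
pose dx := CD_add (CD_pz R) (CD_cst (- pz w : C)).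
have dcx : CD (fun z => conjc (pz z - pz w)) (fun=> 1).
  apply: (CD_eq (CD_add (CD_conj_pz R) (CD_cst (- conjc (pz w) : C)))) => z.
    by apply: complex_eq; rewrite !cRI; ring.
  by rewrite addr0.
have den z := kreg_den_neq0 (pz z - pz w) e0.
have dden := CD_inv den (CD_add (CD_mul dx dcx) (CD_cst ((e ^+ 2)%:C : C))).
apply: (CD_eq (CD_mul (CD_kexp L w) (CD_mul dcx dden))) => z //.
rewrite mul0r add0r; congr (_ * _).
have -> : ((eta e (z.1 - w.1) (z.2 - w.2))%:C : C) =
    (e ^+ 2)%:C / ((pz z - pz w) * conjc (pz z - pz w) + (e ^+ 2)%:C) ^+ 2.
  rewrite mulc_conj nc_sqr !cRI/= /eta -rmorphD/= -rmorphXn/= -rmorphV/=; last first.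
    rewrite unitfE expf_neq0// gt_eqF// ltr_wpDl ?addr_ge0 ?sqr_ge0//.
    by rewrite exprn_even_gt0.
  by rewrite -rmorphM.
have := den z; move: ((e ^+ 2)%:C : C) (pz z - pz w : C) (conjc _ : C) => k x y xyk.
by field.
Qed.

(** Up to the factor [expR L], a majorant on the square of the difference [kern - kreg] at scale
    [e], and of both kernels at scale 1. Its integral is of order [sqrt e]. Only the first
    coordinate carries the scale: on the square the second factor lies between 1/2 and 1. Symmetry
    in [z] and [w] makes it serve for integration in either variable. *)
Definition kdom e z w : R :=
  4 * ((e / (e + `|z.1 - w.1|)) * (1 / (1 + `|z.2 - w.2|))) / nc (pz z - pz w).

Lemma kdomC e z w : kdom e z w = kdom e w z.
Proof. by rewrite /kdom (distrC z.1) (distrC z.2) (nc_distC (pz z)). Qed.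

Let m e z w : R := 4 * ((e / (e + `|z.1 - w.1|)) * (1 / (1 + `|z.2 - w.2|))).

Let m_ge0 e z w : 0 < e -> 0 <= m e z w.
Proof.
move=> e0; rewrite !mulr_ge0// ?invr_ge0 ?addr_ge0//; exact: ltW.
Qed.

Lemma kdom_ge0 e z w : 0 < e -> 0 <= kdom e z w.
Proof. by move=> e0; rewrite divr_ge0 ?nc_ge0//; exact: m_ge0. Qed.

Let measurable_m e z : measurable_fun setT (m e z).
Proof.
have m1 : measurable_fun [set: R * R] (fun w : R * R => `|z.1 - w.1|).
  by apply: measurableT_comp => //; apply: measurable_funB.
have m2 : measurable_fun [set: R * R] (fun w : R * R => `|z.2 - w.2|).
  by apply: measurableT_comp => //; apply: measurable_funB.
apply: measurable_funM => //; apply: measurable_funM; apply: measurable_funM => //;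
  apply: measurableT_comp (@measurable_inv R) _; exact: measurable_funD.
Qed.

Lemma measurable_kdom e z : measurable_fun setT (kdom e z).
Proof.
apply: measurable_funM; first exact: measurable_m.
by apply: measurableT_comp (@measurable_inv R) _; exact: measurable_nc_pz.
Qed.

Lemma kdom_integral e z : 0 < e ->
  (\int[mu]_(w in D) (kdom e z w)%:E <= (64 * pi ^+ 2 * Num.sqrt e)%:E)%E.
Proof.
move=> e0; apply: integral_sub_plane.
- exact: measurable_kdom.
- by move=> w; exact: kdom_ge0.
have -> : 64 * pi ^+ 2 * Num.sqrt e =
    4 * 4 * (2 * (pi * Num.sqrt e) * (2 * (pi * Num.sqrt (1 : R)))).
  by rewrite sqrtr1; ring.
exact: (@kernel_integral R z (m e z) 4 e 1 e0 ltr01 (@measurable_m e z)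
  (fun w => m_ge0 z w e0) (fun w => lexx _)).
Qed.

Lemma open_square_coord z : D z -> [/\ 0 < z.1, z.1 < 1, 0 < z.2 & z.2 < 1].
Proof. by case=> /=; rewrite !in_itv/= => /andP[? ?] /andP[? ?]. Qed.

Lemma nc_kexp_le L z w : 0 <= L -> D z -> D w -> nc (kexp L z w) <= expR L.
Proof.
move=> L0 /open_square_coord[_ _ z0 z1] /open_square_coord[_ _ w0 w1].
rewrite nc_kexp /wt -expRN -!expRD ler_expR.
have zz : L * z.2 ^+ 2 <= L by rewrite ler_piMr// expr_le1// ltW.
have : 0 <= L / 2 * nc (pz z - pz w) ^+ 2 by rewrite mulr_ge0 ?sqr_ge0// divr_ge0.
have : 0 <= L * w.2 ^+ 2 by rewrite mulr_ge0 ?sqr_ge0.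
lra.
Qed.

Let dist_le1 z w : D z -> D w -> `|z.1 - w.1| <= 1 /\ `|z.2 - w.2| <= 1.
Proof.
move=> /open_square_coord[? ? ? ?] /open_square_coord[? ? ? ?].
by split; rewrite ler_norml; apply/andP; split; lra.
Qed.

Let nc_abs1 z w : `|z.1 - w.1| ^+ 2 <= nc (pz z - pz w) ^+ 2.
Proof. by rewrite nc_sqr !cRI/= real_normK ?num_real// lerDl sqr_ge0. Qed.

Lemma kern_dom L z w : 0 <= L -> D z -> D w -> nc (kern L z w) <= expR L * kdom 1 z w.
Proof.
move=> L0 Dz Dw; rewrite /kern ncM ncV; apply: ler_pM; rewrite ?nc_ge0 ?invr_ge0 ?nc_ge0//.
  exact: nc_kexp_le.
have [d1 d2] := dist_le1 Dz Dw.
rewrite -[leLHS]mul1r /kdom; apply: ler_wpM2r; first by rewrite invr_ge0 nc_ge0.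
have h (x : R) : 0 <= x -> x <= 1 -> 2^-1 <= 1 / (1 + x).
  by move=> x0 x1; rewrite div1r lef_pV2 ?posrE//; lra.
apply: (@le_trans _ _ (4 * (2^-1 * 2^-1))); first by lra.
by rewrite ler_pM2l//; apply: ler_pM; rewrite ?invr_ge0// h.
Qed.

Lemma kern_kreg_dom L e z w : 0 <= L -> 0 < e -> D z -> D w ->
  nc (kern L z w - kreg L e z w) <= expR L * kdom e z w.
Proof.
move=> L0 e0 Dz Dw; rewrite kern_diff ?gt_eqF// ncM; apply: ler_pM; rewrite ?nc_ge0//.
  exact: nc_kexp_le.
have [d1 d2] := dist_le1 Dz Dw.
have den : 0 < nc (pz z - pz w) ^+ 2 + e ^+ 2 by rewrite ltr_wpDl ?sqr_ge0// exprn_gt0.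
rewrite ncM ncV ncM !nc_real ger0_norm ?sqr_ge0// (ger0_norm (ltW den)) /kdom.
rewrite invfM mulrCA mulrC; apply: ler_wpM2r; first by rewrite invr_ge0 nc_ge0.
have := nc_abs1 z w; move: den; move: (nc _ ^+ 2) => n den n1.
have : 0 <= `|z.1 - w.1| by []. have : 0 <= `|z.2 - w.2| by [].
move: `|z.1 - w.1| `|z.2 - w.2| d1 d2 n1 => x y x1 y1 n1 y0 x0.
apply: (@le_trans _ _ (2 * (e / (e + x)))).
  rewrite mulrA ler_pdivrMr// mulrAC ler_pdivlMr; last lra.
  have : e * (e + x) <= 2 * (n + e ^+ 2) by have := sqr_ge0 (e - x); nra.
  by rewrite -(ler_pM2l e0) => h; rewrite expr2 -mulrA; apply: le_trans h _; rewrite mulrCA mulrA.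
have ex : 0 <= e / (e + x) by rewrite divr_ge0; lra.
suff : 2^-1 <= 1 / (1 + y) by move=> h; nra.
by rewrite div1r lef_pV2 ?posrE//; lra.
Qed.

Lemma kreg_dom L e z w : 0 <= L -> 0 < e -> D z -> D w ->
  nc (kreg L e z w) <= expR L * kdom 1 z w.
Proof.
move=> L0 e0 Dz Dw; apply: le_trans (kern_dom L0 Dz Dw).
rewrite /kreg /kern !ncM; apply: ler_wpM2l; first exact: nc_ge0.
rewrite mulc_conj -rmorphD !ncV nc_conj nc_real.
have [->|x0] := eqVneq (nc (pz z - pz w)) 0; first by rewrite mul0r invr0.
have n0 : 0 < nc (pz z - pz w) by rewrite lt_neqAle eq_sym x0 nc_ge0.
rewrite ger0_norm ?addr_ge0 ?sqr_ge0// ler_pdivrMr; last first.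
  by rewrite ltr_wpDl ?sqr_ge0// exprn_gt0.
rewrite -[leLHS](mulKf x0) ler_pM2l ?invr_gt0// -expr2 lerDl sqr_ge0//.
Qed.

Lemma cintegrableD (S : set (R * R)) (f g : R * R -> C) : measurable S ->
  cintegrable S f -> cintegrable S g -> cintegrable S (fun z => f z + g z).
Proof.
move=> /measurable_planeP mS [fr fi] [gr gi]; split.
  have := @integrableD _ _ R mu S mS _ _ fr gr.
  by apply: eq_integrable => // z _ /=; rewrite cRI EFinD.
have := @integrableD _ _ R mu S mS _ _ fi gi.
by apply: eq_integrable => // z _ /=; rewrite cRI EFinD.
Qed.

Lemma cintegral_dom a (k : R * R -> C) X e z (B : R) : 0 <= a -> 0 < e -> 0 <= B ->
  cmeas D k -> cmeas D X -> (forall w, D w -> nc (X w) <= B) ->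
  (forall w, D w -> nc (k w) <= a * kdom e z w) ->
  cintegrable D (fun w => X w * k w) /\
  nc (cintegral D (fun w => X w * k w)) <= 128 * pi ^+ 2 * (B * a) * Num.sqrt e.
Proof.
move=> a0 e0 B0 mk mX XB ka.
have mXk : cmeas D (fun w => X w * k w) by exact: cmeasM.
have mg : measurable_fun D (fun w => B * a * kdom e z w).
  apply: measurable_funM; first exact: measurable_cst.
  by apply: measurable_funTS; exact: measurable_kdom.
have Xk w : D w -> nc (X w * k w) <= B * a * kdom e z w.
  by move=> Dw; rewrite ncM -mulrA ler_pM ?nc_ge0 ?XB ?ka.
have gB : (\int[mu]_(w in D) (B * a * kdom e z w)%:E <=
    (B * a * (64 * pi ^+ 2 * Num.sqrt e))%:E)%E.
  apply: integral_scale_le.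
  - exact: measurable_open_square.
  - by apply: measurable_funTS; exact: measurable_kdom.
  - by move=> w; exact: kdom_ge0.
  - exact: mulr_ge0.
  - exact: kdom_integral.
have [i1 i2] := cintegral_bound (@measurable_open_square R) mXk mg Xk gB.
by split => //; apply: le_trans i2 _; apply: eq_ler; ring.
Qed.

Lemma kern_approx L X e z (B : R) : 0 <= L -> 0 < e -> 0 <= B -> D z ->
  cmeas D X -> (forall w, D w -> nc (X w) <= B) ->
  nc (cintegral D (fun w => X w * kern L z w) - cintegral D (fun w => X w * kreg L e z w))
    <= 128 * pi ^+ 2 * (B * expR L) * Num.sqrt e /\
  nc (cintegral D (fun w => X w * kern L w z) - cintegral D (fun w => X w * kreg L e w z))
    <= 128 * pi ^+ 2 * (B * expR L) * Num.sqrt e.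
Proof.
move=> L0 e0 B0 Dz mX XB.
have main (k k' : R * R -> C) : cmeas D k -> cmeas D k' ->
    (forall w, D w -> nc (k w) <= expR L * kdom 1 z w) ->
    (forall w, D w -> nc (k' w) <= expR L * kdom 1 z w) ->
    (forall w, D w -> nc (k w - k' w) <= expR L * kdom e z w) ->
    nc (cintegral D (fun w => X w * k w) - cintegral D (fun w => X w * k' w))
    <= 128 * pi ^+ 2 * (B * expR L) * Num.sqrt e.
  move=> mk mk' kd k'd kk'.
  have [ik _] := cintegral_dom (expR_ge0 L) ltr01 B0 mk mX XB kd.
  have [ik' _] := cintegral_dom (expR_ge0 L) ltr01 B0 mk' mX XB k'd.
  have mkk : cmeas D (fun w => k w - k' w) by apply: cmeasD => //; exact: cmeasN.
  have [ikk h] := cintegral_dom (expR_ge0 L) e0 B0 mkk mX XB kk'.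
  suff -> : cintegral D (fun w => X w * k w) - cintegral D (fun w => X w * k' w) =
    cintegral D (fun w => X w * (k w - k' w)) by [].
  apply/eqP; rewrite subr_eq; apply/eqP; rewrite -cintegralD//.
    by apply: eq_cintegral => w _; ring.
  exact: measurable_open_square.
have mid : measurable_fun D (@id (R * R)) by [].
have mz : measurable_fun D (fun=> z) by exact: measurable_cst.
split; apply: main => [||w Dw|w Dw|w Dw]; try (by apply: cmeas_kern); try (by apply: cmeas_kreg).
- exact: kern_dom.
- exact: kreg_dom.
- exact: kern_kreg_dom.
- by rewrite kdomC; exact: kern_dom.
- by rewrite kdomC; exact: kreg_dom.
- by rewrite kdomC; exact: kern_kreg_dom.
Qed.

Lemma ccont_kreg_integral L F e z (B : R) : 0 <= L -> 0 < e -> 0 <= B -> D z -> cmeas D F ->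
  (forall w, D w -> nc (F w) <= B) ->
  ccont z (fun z => cintegral D (fun w => F w * kreg L e z w)).
Proof.
move=> L0 e0 B0 Dz mF FB; apply/ccontP => r r0.
pose r' := r / (4 * (B + 1)).
have r'0 : 0 < r' by rewrite divr_gt0// mulr_gt0//; lra.
have cpt : compact (@square R) by apply: compact_setX; exact: segment_compact.
(* Joint continuity of [kreg] and compactness of the closed square make the convergence as [z']
   tends to [z] uniform in [w]. *)
have near_sq : \forall z' \near z, @square R `<=` (fun w => nc (kreg L e z' w - kreg L e z w) < r').
  apply: ((compact_near_coveringP (@square R)).1 cpt _ (nbhs z)
    (fun z' w => nc (kreg L e z' w - kreg L e z w) < r')) => w _.
  have r'2 : 0 < r' / 2 by rewrite divr_gt0.
  have /ccontP/(_ _ r'2) h1 := @ccont_kreg R L e (z, w) (lt0r_neq0 e0).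
  case: h1 => -[U V] [Uz Vw] UV.
  have zU : U z by exact: nbhs_singleton.
  exists (V, U); first by split.
  move=> [w' z'] [Vw' Uz'].
  have a1 : nc (kreg L e z' w' - kreg L e z w) < r' / 2 := UV (z', w') (conj Uz' Vw').
  have a2 : nc (kreg L e z w' - kreg L e z w) < r' / 2 := UV (z, w') (conj zU Vw').
  change (nc (kreg L e z' w' - kreg L e z w') < r').
  rewrite -(subrKA (kreg L e z w)); apply: le_lt_trans (ncD _ _) _.
  by rewrite [X in _ + X]nc_distC; lra.
have nearD : \forall z' \near z, D z'.
  by apply: open_nbhs_nbhs; split => //; exact: open_square_open.
near=> z'.
have Dz' : D z' by near: z'.
have sq : @square R `<=` (fun w => nc (kreg L e z' w - kreg L e z w) < r') by near: z'.
have mk z1 : cmeas D (fun w => kreg L e z1 w).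
  by apply: cmeas_kreg => //; exact: measurable_cst.
have ik z1 : D z1 -> cintegrable D (fun w => F w * kreg L e z1 w).
  move=> Dz1.
  exact: (cintegral_dom (expR_ge0 L) ltr01 B0 (mk z1) mF FB (fun w Dw => kreg_dom L0 e0 Dz1 Dw)).1.
have -> : cintegral D (fun w => F w * kreg L e z' w) - cintegral D (fun w => F w * kreg L e z w) =
    cintegral D (fun w => F w * (kreg L e z' w - kreg L e z w)).
  apply/eqP; rewrite subr_eq; apply/eqP; rewrite -cintegralD//.
  - by apply: eq_cintegral => w _; ring.
  - exact: measurable_open_square.
  - rewrite (_ : (fun _ => _) = (fun w => F w * kreg L e z' w + (-1) * (F w * kreg L e z w))); last first.
      by apply/funext => w; ring.
    have i2 := cintegrableZ (-1) (@measurable_open_square R) (ik z Dz).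
    have i1 := ik z' Dz'.
    exact: (cintegrableD (@measurable_open_square R) i1 i2).
  - exact: ik.
have mFk : cmeas D (fun w => F w * (kreg L e z' w - kreg L e z w)).
  by apply: cmeasM => //; apply: cmeasD => //; exact: cmeasN.
have Fk w : D w -> nc (F w * (kreg L e z' w - kreg L e z w)) <= B * r'.
  move=> Dw; rewrite ncM; apply: ler_pM; rewrite ?nc_ge0 ?FB//.
  by apply: ltW; apply: sq; exact: open_square_sub.
have hB : (\int[mu]_(w in D) (B * r')%:E <= (B * r')%:E)%E.
  rewrite integral_cst; last by apply: measurable_planeP; exact: measurable_open_square.
  by rewrite [X in (_ * X)%E](square_measure R) mule1.
have mc : measurable_fun D (fun=> B * r') by exact: measurable_cst.
have [_ h] := cintegral_bound (@measurable_open_square R) mFk mc Fk hB.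
apply: le_lt_trans h _; rewrite /r' mulrCA.
have -> : 2 * (r / (4 * (B + 1))) = r * (2^-1 / (B + 1)) by field; lra.
rewrite mulrCA gtr_pMr// mulrA ltr_pdivrMr; lra.
Unshelve. all: by end_near.
Qed.

(** Up to the normalising factor, the regularised integrals are continuous and differ from the
    singular one by order [sqrt e] uniformly on the square. *)
Lemma ccont_dbar_inv L F z (B : R) : 0 <= L -> 0 <= B -> D z -> cmeas D F ->
  (forall w, D w -> nc (F w) <= B) -> ccont z (dbar_inv L F).
Proof.
move=> L0 B0 Dz mF FB; apply: ccont_lim => r r0.
pose k := (eta_mass R)^-1 * (128 * pi ^+ 2 * (B * expR L)).
have k0 : 0 <= k.
  by apply: mulr_ge0; [rewrite invr_ge0 ltW// eta_mass_gt0|rewrite mulr_ge0 ?mulr_ge0 ?exprn_ge0 ?expR_ge0 ?pi_ge0].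
(* Chosen so that the error [k * sqrt e] is at most [r]. *)
pose e : R := (r / (k + 1)) ^+ 2.
have rk : 0 < r / (k + 1) by rewrite divr_gt0//; lra.
have e0 : 0 < e by rewrite exprn_gt0.
exists (fun z => ((eta_mass R)^-1)%:C * cintegral D (fun w => F w * kreg L e z w)).
  by apply: ccontM; [exact: ccont_cst|exact: ccont_kreg_integral FB].
have nearD : \forall z' \near z, D z'.
  by apply: open_nbhs_nbhs; split => //; exact: open_square_open.
apply: filterS nearD => z' Dz'.
rewrite /dbar_inv -mulrBr ncM nc_real ger0_norm; last by rewrite invr_ge0 ltW// eta_mass_gt0.
apply: le_trans (ler_wpM2l _ (kern_approx L0 e0 B0 Dz' mF FB).1) _.
  by rewrite invr_ge0 ltW// eta_mass_gt0.
rewrite [leLHS](_ : _ = k * (r / (k + 1))); last first.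
  by rewrite /e sqrtr_sqr gtr0_norm// /k; move: (r / _) => t; ring.
by rewrite mulrA ler_pdivrMr; lra.
Qed.

(** At distance at least [d] one has [n + e^2 >= n >= (n + d^2) / 2] for [n = u^2 + v^2]. Bounding
    the tail at scale [e] by the bump at the fixed scale [d] spares a separate tail integral, as the
    mass does not depend on the scale. *)
Lemma eta_tail e d (u v : R) : 0 < e -> 0 < d -> d ^+ 2 <= u ^+ 2 + v ^+ 2 ->
  eta e u v <= 4 * (e ^+ 2 / d ^+ 2) * eta d u v.
Proof.
move=> e0 d0; rewrite /eta; move: (u ^+ 2 + v ^+ 2) => n dn.
have d2 : 0 < d ^+ 2 by rewrite exprn_gt0.
have n0 : 0 < n by exact: lt_le_trans dn.
have e2 : 0 < e ^+ 2 by rewrite exprn_gt0.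
have -> : 4 * (e ^+ 2 / d ^+ 2) * (d ^+ 2 / (n + d ^+ 2) ^+ 2) = e ^+ 2 * (4 / (n + d ^+ 2) ^+ 2).
  by field; rewrite !gt_eqF//; lra.
rewrite ler_pM2l//.
have -> : 4 / (n + d ^+ 2) ^+ 2 = (((n + d ^+ 2) / 2) ^+ 2)^-1.
  by field; rewrite gt_eqF//; lra.
rewrite lef_pV2 ?posrE ?exprn_gt0//; try lra.
by rewrite lerXn2r ?nnegrE; lra.
Qed.

Lemma approx_identity X w (B r : R) : D w -> cmeas D X ->
  (forall z, D z -> nc (X z) <= B) -> ccont w X -> 0 < r ->
  exists2 e0, 0 < e0 & forall e, 0 < e -> e < e0 ->
    nc (cintegral D (fun z => X z * (eta e (z.1 - w.1) (z.2 - w.2))%:C) -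
        (eta_mass R)%:C * X w) <= r.
Proof.
move=> Dw mX XB cX r0; set c := eta_mass R; have c0 : 0 < c := eta_mass_gt0 R.
have B0 : 0 <= B by exact: le_trans (nc_ge0 _) (XB w Dw).
pose h := r / (4 * c).
have h0 : 0 < h by rewrite divr_gt0// mulr_gt0.
have : \forall z \near w, D z /\ nc (X z - X w) < h.
  apply: filterI; last by move/ccontP: cX; apply.
  by apply: open_nbhs_nbhs; split => //; exact: open_square_open.
case/nbhs_ballP => d /= d0 dball.
have far z : ~ (D z /\ nc (X z - X w) < h) -> d ^+ 2 <= (z.1 - w.1) ^+ 2 + (z.2 - w.2) ^+ 2.
  move=> nz; rewrite leNgt; apply/negP => lt; apply: nz; apply: dball.
  have s (x y : R) : x ^+ 2 + y ^+ 2 < d ^+ 2 -> `|x| < d.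
    move=> xy; rewrite -(ltr_pXn2r (n := 2)) ?nnegrE ?(ltW d0)// real_normK ?num_real//.
    by apply: le_lt_trans xy; rewrite lerDl sqr_ge0.
  split; rewrite /ball/= distrC; first exact: s lt.
  by apply: s; rewrite addrC; exact: lt.
(* For [e < min(1, K)] one has [e^2 <= e], so the tail ratio [q] satisfies [(B + 1) q c <= r/10].
   With [h c = r/4] the near part contributes [r/2], the far part at most [4r/10] and the missing
   mass at most [r/10]. *)
pose K := r * d ^+ 2 / (40 * (B + 1) * c).
have d2 : 0 < d ^+ 2 by rewrite exprn_gt0.
have K0 : 0 < K by rewrite divr_gt0// ?mulr_gt0//; lra.
exists (Num.min 1 K) => [|e e0]; first by rewrite lt_min ltr01.
rewrite lt_min => /andP[e1 eK].
pose et e' z := eta e' (z.1 - w.1) (z.2 - w.2).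
have et0 e' z : 0 <= et e' z by exact: eta_ge0.
have met e' (S : set (R * R)) : measurable_fun S (et e').
  by apply: measurable_eta; apply: measurable_funB => //; exact: measurable_funTS.
have mD := @measurable_open_square R.
have mDp := measurable_planeP mD.
pose q := 4 * (e ^+ 2 / d ^+ 2).
have q0 : 0 <= q by rewrite mulr_ge0// divr_ge0// ?sqr_ge0// ltW.
have mfull e' (S : set (R * R)) : measurable S -> measurable_fun (S : set (pT R)) (EFin \o et e').
  by move=> mS; apply: measurable_leb2 => //; exact: met.
have massT e' : 0 < e' -> (\int[mu]_z (et e' z)%:E = c%:E)%E by move=> ?; exact: eta_massE.
have massS e' (S : set (R * R)) : measurable S -> 0 < e' -> (\int[mu]_(z in S) (et e' z)%:E <= c%:E)%E.
  move=> mS e'0; rewrite -(massT e' e'0); apply: ge0_subset_integral => //.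
  - exact: mfull.
  - by move=> z _; rewrite lee_fin.
have integ e' : 0 < e' -> cintegrable D (fun z => (et e' z)%:C : C).
  move=> e'0.
  have m1 : cmeas D (fun z => (et e' z)%:C : C) by exact: cmeas_real.
  have := cintegral_bound mD m1 (met e' D) _ (massS e' D mD e'0).
  by case=> // z _; rewrite nc_real ger0_norm.
have outside : (\int[mu]_(z in ~` D) (et e z)%:E <= (q * c)%:E)%E.
  have mDc : measurable (~` D) by exact: measurableC.
  apply: (@le_trans _ _ (\int[mu]_(z in ~` D) (q * et d z)%:E)%E).
    apply: ge0_le_integral => //.
    - by move=> z _; rewrite lee_fin.
    - exact: mfull.
    - apply: (@measurable_leb2 _ (~` D) (fun z => q * et d z)) => //.
      by apply: measurable_funM => //; exact: measurable_cst.
    - by move=> z nD; rewrite lee_fin; apply: eta_tail => //; apply: far => -[].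
  by apply: integral_scale_le (massS d _ mDc d0).
pose cD := \int[mu]_(z in D) et e z.
have cDE : (\int[mu]_(z in D) (et e z)%:E)%E = cD%:E.
  rewrite /cD /Rintegral fineK// ge0_fin_numE.
    exact: le_lt_trans (massS e D mD e0) (ltry _).
  by apply: integral_ge0 => z _; rewrite lee_fin.
have cDle : cD <= c by rewrite -lee_fin -cDE; exact: massS.
have cDge : c <= cD + q * c.
  rewrite -lee_fin -(massT e e0) -(setUv D) ge0_integral_setU//=.
  - by rewrite EFinD -cDE; apply: leeD.
  - by apply: measurable_planeP; exact: measurableC.
  - by rewrite setUv; apply: mfull.
  - by move=> z _; rewrite lee_fin.
  - by apply/disj_setPCl.
(* The error is split into the oscillation of [X] around [w] and the mass [c - cD] that lies outside
   the square. *)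
have -> : cintegral D (fun z => X z * (et e z)%:C) - c%:C * X w =
  cintegral D (fun z => (X z - X w) * (et e z)%:C) + X w * (cD - c)%:C.
  have -> : X w * (cD - c)%:C = X w * cintegral D (fun z => (et e z)%:C : C) - c%:C * X w.
    have -> : cintegral D (fun z => (et e z)%:C : C) = cD%:C.
      rewrite /cintegral; apply: complex_eq => //=.
      by rewrite /Rintegral integral0.
    by rewrite rmorphB/=; ring.
  rewrite addrA; congr (_ - _); rewrite -cintegralZ//; last exact: integ.
  rewrite -cintegralD//.
  - by apply: eq_cintegral => z _; ring.
  - apply: (cintegral_bound mD _ (g := fun z => (2 * B) * et e z) (B := 2 * B * c) _ _ _).1.
    + apply: cmeasM; last exact: cmeas_real.
      by apply: cmeasD => //; exact: cmeas_cst.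
    + by apply: measurable_funM => //; exact: measurable_cst.
    + move=> z Dz; rewrite ncM nc_real ger0_norm// ler_wpM2r//.
      by apply: le_trans (ncB _ _) _; have := XB z Dz; have := XB w Dw; lra.
    + by apply: integral_scale_le (massS e D mD e0) => //; exact: mulr_ge0.
  - by apply: cintegrableZ => //; exact: integ.
apply: le_trans (ncD _ _) _.
have t2 : nc (X w * (cD - c)%:C) <= B * (q * c).
  rewrite ncM nc_real; apply: ler_pM; rewrite ?nc_ge0 ?XB//.
  by rewrite ler_norml; apply/andP; split; [lra|]; rewrite (le_trans (y := 0))//; [lra|rewrite mulr_ge0// ltW].
have k2 : 0 <= 2 * B * q by rewrite mulr_ge0// mulr_ge0.
have t1 : nc (cintegral D (fun z => (X z - X w) * (et e z)%:C)) <= 2 * ((h + 2 * B * q) * c).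
  apply: (cintegral_bound mD _ (g := fun z => h * et e z + (2 * B * q) * et d z) _ _ _).2.
  - apply: cmeasM; last exact: cmeas_real.
    by apply: cmeasD => //; exact: cmeas_cst.
  - by apply: measurable_funD; apply: measurable_funM => //; exact: measurable_cst.
  - move=> z Dz; rewrite ncM nc_real ger0_norm//.
    have [near|farz] := ltP (nc (X z - X w)) h.
      rewrite -[leLHS]addr0; apply: lerD; last exact: mulr_ge0.
      by rewrite ler_wpM2r// ltW.
    rewrite -[leLHS]add0r; apply: lerD; first by rewrite mulr_ge0// ltW.
    rewrite -mulrA; apply: ler_pM; rewrite ?nc_ge0//.
      by apply: le_trans (ncB _ _) _; have := XB z Dz; have := XB w Dw; lra.
    by apply: eta_tail => //; apply: far => -[_]; rewrite ltNge farz.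
  - under eq_integral do rewrite EFinD.
    have h1 := ltW h0.
    rewrite ge0_integralD//; last 4 first.
    + by move=> z _; rewrite lee_fin mulr_ge0.
    + apply: (@measurable_leb2 _ D (fun z => h * et e z)) => //.
      by apply: measurable_funM => //; exact: measurable_cst.
    + by move=> z _; rewrite lee_fin; exact: mulr_ge0.
    + apply: (@measurable_leb2 _ D (fun z => 2 * B * q * et d z)) => //.
      by apply: measurable_funM => //; exact: measurable_cst.
    by rewrite (mulrDl h) [leRHS]EFinD; apply: leeD;
      apply: integral_scale_le => //; exact: massS.
have hc : h * c = r / 4 by rewrite /h; field; rewrite gt_eqF.
have e2 : e ^+ 2 <= e by rewrite expr2 ger_pMr// ltW.
have qK : q <= 4 * (K / d ^+ 2).
  rewrite ler_pM2l// ler_pM2r ?invr_gt0//; apply: le_trans e2 (ltW eK).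
have qc : (B + 1) * (q * c) <= r / 10.
  have -> : r / 10 = (B + 1) * (4 * (K / d ^+ 2) * c).
    rewrite /K; field; rewrite (gt_eqF d0) (gt_eqF c0)/=; lra.
  by rewrite ler_pM2l ?ler_pM2r//; lra.
have qc0 : 0 <= q * c by rewrite mulr_ge0// ltW.
apply: le_trans (lerD t1 t2) _; nra.
Qed.

End kernel_approximation.

(** * Weak solutions and the Leibniz rule *)

Section weak_dbar.
Variable R : realType.
Local Notation C := R[i].
Local Notation mu := (leb2 R).
Local Notation D := (@open_square R).
Implicit Types (z w : R * R) (L e : R) (f g F G : R * R -> C).

Let mD := @measurable_open_square R.

Lemma near_open_square z : D z -> \forall w \near z, D w.
Proof. by move=> Dz; apply: open_nbhs_nbhs; split => //; exact: open_square_open. Qed.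

Definition mbdd F := cmeas D F /\ exists B, forall z, D z -> nc (F z) <= B.

Lemma mbdd_bound F : mbdd F -> exists2 B, 0 <= B & forall z, D z -> nc (F z) <= B.
Proof.
move=> [_ [B hB]]; exists (Num.max 0 B); first by rewrite le_max lexx.
by move=> z Dz; rewrite le_max hB ?orbT.
Qed.

Lemma mbdd_cst (c : C) : mbdd (fun=> c).
Proof. by split; [exact: cmeas_cst|exists (nc c)]. Qed.

Lemma mbddD f g : mbdd f -> mbdd g -> mbdd (fun z => f z + g z).
Proof.
move=> [mf [B hf]] [mg [B' hg]]; split; first exact: cmeasD.
by exists (B + B') => z Dz; apply: le_trans (ncD _ _) _; rewrite lerD ?hf ?hg.
Qed.

Lemma mbddM f g : mbdd f -> mbdd g -> mbdd (fun z => f z * g z).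
Proof.
move=> [mf [B hf]] [mg [B' hg]]; split; first exact: cmeasM.
by exists (B * B') => z Dz; rewrite ncM ler_pM ?nc_ge0 ?hf ?hg.
Qed.

Lemma mbddN f : mbdd f -> mbdd (fun z => - f z).
Proof.
move=> [mf [B hf]]; split; first exact: cmeasN.
by exists B => z Dz; rewrite ncN hf.
Qed.

Lemma cmeas_eq (S : set (R * R)) f g : (forall z, S z -> f z = g z) -> cmeas S f -> cmeas S g.
Proof.
move=> fg [mr mi]; split.
  by apply: eq_measurable_fun mr => z /set_mem Sz; rewrite fg.
by apply: eq_measurable_fun mi => z /set_mem Sz; rewrite fg.
Qed.

Lemma mbdd_eq f g : (forall z, D z -> f z = g z) -> mbdd f -> mbdd g.
Proof.
move=> fg [mf [B hf]]; split; first exact: cmeas_eq mf.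
by exists B => z Dz; rewrite -fg ?hf.
Qed.

Lemma mbdd_integrable f : mbdd f -> cintegrable D f.
Proof.
by move=> [mf [B hf]]; apply: cintegrable_bounded mf hf => //; exact: open_square_measure_fin.
Qed.

Lemma cintegral_le f (B : R) : mbdd f -> (forall z, D z -> nc (f z) <= B) ->
  nc (cintegral D f) <= 2 * B.
Proof.
move=> [mf _] hf.
have mB : measurable_fun D (fun=> B) by exact: measurable_cst.
have hB : (\int[mu]_(z in D) B%:E <= B%:E)%E.
  rewrite integral_cst; last exact: measurable_planeP.
  by rewrite [X in (_ * X)%E](square_measure R) mule1.
exact: (cintegral_bound mD mf mB hf hB).2.
Qed.

Lemma mbdd_test psi Psi : test_pair psi Psi -> mbdd psi /\ mbdd Psi.
Proof.
move=> t; have [B hB] := test_pair_bound t.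
split; split.
- by apply: cmeas_continuous (@open_square_open R) _ => z _; exact: (test_pair_cont z t).1.
- by exists B => z _; exact: (hB z).1.
- by apply: cmeas_continuous (@open_square_open R) _ => z _; exact: (test_pair_cont z t).2.
- by exists B => z _; exact: (hB z).2.
Qed.

Definition adm f F := [/\ forall z, D z -> ccont z f, mbdd f & mbdd F].

Lemma admP f F (B : R) : (forall z, D z -> ccont z f) -> (forall z, D z -> nc (f z) <= B) ->
  mbdd F -> adm f F.
Proof.
move=> cf hf mF; split => //; split; last by exists B.
exact: cmeas_continuous (@open_square_open R) cf.
Qed.

Lemma adm_add f F g G : adm f F -> adm g G -> adm (fun z => f z + g z) (fun z => F z + G z).
Proof.
move=> [cf bf bF] [cg bg bG]; split; [|exact: mbddD|exact: mbddD].
by move=> z Dz; apply: ccontD; [exact: cf|exact: cg].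
Qed.

Lemma adm_mul f F g G : adm f F -> adm g G ->
  adm (fun z => f z * g z) (fun z => F z * g z + f z * G z).
Proof.
move=> [cf bf bF] [cg bg bG]; split.
- by move=> z Dz; apply: ccontM; [exact: cf|exact: cg].
- exact: mbddM.
- by apply: mbddD; exact: mbddM.
Qed.

Lemma ccont_near z f g : (\forall w \near z, f w = g w) -> f z = g z -> ccont z f -> ccont z g.
Proof.
move=> fg fgz /ccontP cf; apply/ccontP => e e0.
have h := cf e e0.
apply: filterS2 fg h => w fgw; rewrite fgw fgz//.
Qed.

Lemma adm_eq f F g G : (forall z, D z -> f z = g z) -> (forall z, D z -> F z = G z) ->
  adm f F -> adm g G.
Proof.
move=> fg FG [cf bf bF]; split; [|exact: mbdd_eq bf|exact: mbdd_eq bF].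
move=> z Dz; apply: ccont_near (cf z Dz); last exact: fg.
by apply: filterS (near_open_square Dz) => w; exact: fg.
Qed.

Definition weak f F := adm f F /\ forall psi Psi, test_pair psi Psi ->
  cintegral D (fun z => f z * Psi z) = - cintegral D (fun z => F z * psi z).

(* The Leibniz rule is imposed against all weak solutions: this makes the class
   closed under products and under uniform limits of the pair, without any
   product rule for distributional derivatives. *)
Definition mult f F := adm f F /\ forall g G, weak g G ->
  weak (fun z => f z * g z) (fun z => F z * g z + f z * G z).

Lemma weak_eq f F g G : (forall z, D z -> f z = g z) -> (forall z, D z -> F z = G z) ->
  weak f F -> weak g G.
Proof.
move=> fg FG [af h]; split; first exact: adm_eq af.
move=> psi Psi t; rewrite -(eq_cintegral (f := fun z => f z * Psi z)); last first.
  by move=> z Dz; rewrite fg.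
rewrite (h _ _ t); congr (- _).
by apply: eq_cintegral => z Dz; rewrite FG.
Qed.

Lemma weak_add f F g G : weak f F -> weak g G -> weak (fun z => f z + g z) (fun z => F z + G z).
Proof.
move=> [af hf] [ag hg]; split; first exact: adm_add.
move=> psi Psi t; have [bp bP] := mbdd_test t.
case: af ag => [_ bf bF] [_ bg bG].
have E (a b c : R * R -> C) : mbdd a -> mbdd b -> mbdd c ->
    cintegral D (fun z => (a z + b z) * c z) =
    cintegral D (fun z => a z * c z) + cintegral D (fun z => b z * c z).
  move=> ba bb bc; rewrite -cintegralD//; try (by apply: mbdd_integrable; exact: mbddM).
  by apply: eq_cintegral => z _; rewrite mulrDl.
by rewrite !E// (hf _ _ t) (hg _ _ t) opprD.
Qed.

Lemma weak1 : weak (fun=> 1) (fun=> 0).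
Proof.
split; first by split; [move=> z _; exact: ccont_cst|exact: mbdd_cst|exact: mbdd_cst].
move=> psi Psi t; rewrite (eq_cintegral (g := Psi)); last by move=> z _; rewrite mul1r.
rewrite (test_pair_integral0 t) (eq_cintegral (g := fun=> 0)); last by move=> z _; rewrite mul0r.
suff -> : cintegral D (fun=> 0 : C) = 0 by rewrite oppr0.
by rewrite /cintegral; apply: complex_eq; rewrite /= /Rintegral integral0.
Qed.

Lemma mult_weak f F : mult f F -> weak f F.
Proof.
move=> [_ /(_ _ _ weak1)]; apply: weak_eq => z _; first by rewrite mulr1.
by rewrite mulr1 mulr0 addr0.
Qed.

Lemma mult_eq f F g G : (forall z, D z -> f z = g z) -> (forall z, D z -> F z = G z) ->
  mult f F -> mult g G.
Proof.
move=> fg FG [af h]; split; first exact: adm_eq af.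
move=> k K wk; apply: weak_eq (h _ _ wk) => z Dz; first by rewrite fg.
by rewrite fg// FG.
Qed.

Lemma mult_add f F g G : mult f F -> mult g G -> mult (fun z => f z + g z) (fun z => F z + G z).
Proof.
move=> [af hf] [ag hg]; split; first exact: adm_add.
move=> k K wk; apply: weak_eq (weak_add (hf _ _ wk) (hg _ _ wk)) => z _ /=.
  by rewrite mulrDl.
by rewrite !mulrDl addrACA.
Qed.

Lemma mult_mul f F g G : mult f F -> mult g G ->
  mult (fun z => f z * g z) (fun z => F z * g z + f z * G z).
Proof.
move=> [af hf] [ag hg]; split; first exact: adm_mul.
by move=> k K wk; apply: weak_eq (hf _ _ (hg _ _ wk)) => z _ /=; ring.
Qed.

Lemma square_bounded f : (forall z, ccont z f) -> exists B, forall z, square z -> nc (f z) <= B.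
Proof.
move=> cf.
have cpt : compact (@square R) by apply: compact_setX; exact: segment_compact.
have bnd (h : R * R -> R) : continuous h -> exists B, forall z, square z -> `|h z| <= B.
  move=> ch.
  have /compact_bounded[B [_ hB]] : compact (h @` @square R).
    by apply: continuous_compact => //; exact: continuous_subspaceT.
  exists (B + 1) => z sz; apply: hB; first by rewrite ltrDl.
  by exists z.
have [B hB] := bnd _ (fun z => (cf z).1).
have [B' hB'] := bnd _ (fun z => (cf z).2).
exists (B + B') => z sz; apply: le_trans (nc_leD _) _.
by rewrite lerD ?hB ?hB'.
Qed.

Lemma ccont_mbdd f : (forall z, ccont z f) -> mbdd f.
Proof.
move=> cf; split; first by apply: cmeas_continuous (@open_square_open R) _ => z _; exact: cf.
by have [B hB] := square_bounded cf; exists B => z /open_square_sub; exact: hB.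
Qed.

(** If [psi] is a test function, so is [m psi]; testing the equation of [g] against [m psi] is
    testing that of [m g] against [psi]. *)
Lemma mult_CD m mb : CD m mb -> mult m mb.
Proof.
move=> dm.
have am : adm m mb.
  split; first by move=> z _; exact: CD_cont dm.
    by apply: ccont_mbdd => z; exact: CD_cont dm.
  by apply: ccont_mbdd => z; exact: CD_cont_dbar dm.
split; [exact: am|move=> g G [ag hg]; split]; first exact: adm_mul.
move=> psi Psi t; have := hg _ _ (test_pair_mul dm t).
have [bp bP] := mbdd_test t.
case: am ag => [_ bm bmb] [_ bg bG].
have -> : cintegral D (fun z => g z * (mb z * psi z + m z * Psi z)) =
    cintegral D (fun z => mb z * g z * psi z) + cintegral D (fun z => m z * g z * Psi z).
  rewrite -cintegralD//; try (by apply: mbdd_integrable; do 2! apply: mbddM => //).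
  by apply: eq_cintegral => z _; ring.
have -> : cintegral D (fun z => (mb z * g z + m z * G z) * psi z) =
    cintegral D (fun z => mb z * g z * psi z) + cintegral D (fun z => G z * (m z * psi z)).
  rewrite -cintegralD//; try (by apply: mbdd_integrable; do 2! apply: mbddM => //).
  by apply: eq_cintegral => z _; ring.
have gen (a b c : C) : a + b = - c -> b = - (a + c) by move=> h; rewrite opprD -h; ring.
exact: gen.
Qed.

Lemma mult_cst (c : C) : mult (fun=> c) (fun=> 0).
Proof. exact: mult_CD (CD_cst c). Qed.

Lemma mult_opp f F : mult f F -> mult (fun z => - f z) (fun z => - F z).
Proof.
move=> mf; apply: mult_eq (mult_mul (mult_cst (-1)) mf) => z _; first by rewrite mulN1r.
by rewrite mul0r add0r mulN1r.
Qed.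

(** For fixed [g], [G] and test pair, both sides of the weak identity are continuous in [f] and [F]
    for uniform convergence, so the defect [d] is at most [e * K] for every [e]. *)
Lemma mult_lim f F : mbdd F -> (forall e, 0 < e -> exists f' F', mult f' F' /\
   forall z, D z -> nc (f z - f' z) <= e /\ nc (F z - F' z) <= e) -> mult f F.
Proof.
move=> bF lim.
have af : adm f F.
  have [f' [F' [[[cf' bf' _] _] h]]] := lim 1 ltr01.
  case: bf' => mf' [B hB].
  apply: (@admP _ _ (1 + B)) => // z Dz; last first.
    rewrite -(subrK (f' z) (f z)); apply: le_trans (ncD _ _) _.
    by rewrite lerD ?hB//; exact: (h z Dz).1.
  apply: ccont_lim => e e0; have [f1 [F1 [[[cf1 _ _] _] h1]]] := lim e e0.
  exists f1; first exact: cf1.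
  by apply: filterS (near_open_square Dz) => w Dw; exact: (h1 w Dw).1.
split; [exact: af|move=> g G wg; split]; first by apply: adm_mul => //; case: wg.
move=> psi Psi t; have [bp bP] := mbdd_test t.
have [[_ bg bG] hg] := wg; have [_ bf _] := af.
have [[Bg Bg0 hBg] [BG BG0 hBG]] := (mbdd_bound bg, mbdd_bound bG).
have [[Bp Bp0 hBp] [BP BP0 hBP]] := (mbdd_bound bp, mbdd_bound bP).
apply/eqP; rewrite -addr_eq0 -nc_eq0; set d := _ + _.
pose K := 2 * (Bg * BP + (Bg + BG) * Bp).
have K0 : 0 <= K by rewrite mulr_ge0// addr_ge0// mulr_ge0// addr_ge0.
suff small e : 0 < e -> nc d <= e * K.
  rewrite eq_le nc_ge0 andbT; apply/ler_addgt0Pl => r r0; rewrite addr0.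
  have rK : 0 < r / (K + 1) by rewrite divr_gt0//; lra.
  apply: le_trans (small _ rK) _; rewrite mulrAC ler_pdivrMr; lra.
move=> e0; have [f' [F' [mf' h]]] := lim e e0.
have [[_ bf' bF'] hf'] := mf'; have [_ id'] := hf' _ _ wg.
(* The defect of the approximating pair vanishes; subtracting it leaves an integral that is linear
   in [f - f'] and [F - F']. *)
have dE : d = cintegral D (fun z => (f z - f' z) * (g z * Psi z) +
    ((F z - F' z) * g z + (f z - f' z) * G z) * psi z).
  pose X z := f' z * g z * Psi z + (F' z * g z + f' z * G z) * psi z.
  have iX : cintegral D X = 0.
    have i1 : cintegrable D (fun z => f' z * g z * Psi z).
      by apply: mbdd_integrable; apply: mbddM => //; exact: mbddM.
    have i2 : cintegrable D (fun z => (F' z * g z + f' z * G z) * psi z).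
      by apply: mbdd_integrable; apply: mbddM => //; apply: mbddD; exact: mbddM.
    by rewrite /X (cintegralD mD i1 i2) (id' _ _ t) addNr.
  have b1 : mbdd (fun z => f z - f' z) by apply: mbddD => //; exact: mbddN.
  have b2 : mbdd (fun z => F z - F' z) by apply: mbddD => //; exact: mbddN.
  rewrite -[RHS]addr0 -iX -cintegralD//.
  - rewrite /d -cintegralD//.
    + by apply: eq_cintegral => z _; rewrite /X; ring.
    + by apply: mbdd_integrable; do 2! apply: mbddM => //.
    + by apply: mbdd_integrable; apply: mbddM => //; apply: mbddD; exact: mbddM.
  - apply: mbdd_integrable; apply: mbddD; first by apply: mbddM => //; exact: mbddM.
    by apply: mbddM => //; apply: mbddD; exact: mbddM.
  - apply: mbdd_integrable; apply: mbddD; first by do 2! apply: mbddM => //.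
    by apply: mbddM => //; apply: mbddD; exact: mbddM.
rewrite dE (_ : e * K = 2 * (e * (Bg * BP) + (e * Bg + e * BG) * Bp)); last by rewrite /K; ring.
have b1 : mbdd (fun z => f z - f' z) by apply: mbddD => //; exact: mbddN.
have b2 : mbdd (fun z => F z - F' z) by apply: mbddD => //; exact: mbddN.
apply: cintegral_le.
  apply: mbddD; first by apply: mbddM => //; exact: mbddM.
  by apply: mbddM => //; apply: mbddD; exact: mbddM.
move=> z Dz; have [h1 h2] := h z Dz.
apply: le_trans (ncD _ _) _; rewrite !ncM; apply: lerD.
  by rewrite !ler_pM ?mulr_ge0 ?nc_ge0 ?hBg ?hBP.
rewrite ler_pM ?nc_ge0 ?hBp//; apply: le_trans (ncD _ _) _.
by rewrite !ncM lerD// ler_pM ?nc_ge0 ?hBg ?hBG.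
Qed.

(* Fubini turns the Leibniz rule for the integral operator into a reproducing
   formula for the kernel tested against a weak solution; the latter is the
   limit of the integration by parts against the smooth kernel [kreg]. *)
Lemma mult_dbar_inv L F : 0 < L -> mbdd F -> mult (dbar_inv L F) F.
Proof.
move=> L0 bF; have [mF _] := bF; have [B Bge0 hB] := mbdd_bound bF.
have L0' := ltW L0.
have hBw w : D w -> nc (F w) <= B * wt L w.
  move=> Dw; apply: le_trans (hB w Dw) _; rewrite ler_peMr//.
  by rewrite /wt -expR0 ler_expR mulr_ge0 ?sqr_ge0.
have af : adm (dbar_inv L F) F.
  apply: (@admP _ _ (dbar_inv_cst R / Num.sqrt L * (B * expR L))) => // z Dz.
    exact: ccont_dbar_inv hB.
  apply: le_trans (dbar_inv_bound z L0 Bge0 mF hBw).2 _.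
  rewrite ler_wpM2l//; first by rewrite divr_ge0 ?sqrtr_ge0// ltW// dbar_inv_cst_gt0.
  rewrite ler_wpM2l// /wt ler_expR ler_piMr//.
  by have [_ _ z0 z1] := open_square_coord Dz; rewrite expr_le1// ltW.
split; [exact: af|move=> g G wg; split]; first by apply: adm_mul => //; case: wg.
move=> psi Psi t; have [bp bP] := mbdd_test t.
have [[cg bg bG] hg] := wg.
(* In the weak sense [X] is the d-bar derivative of the compactly supported product [g psi]. *)
pose X z := g z * Psi z + G z * psi z.
have bX : mbdd X by apply: mbddD; exact: mbddM.
have [mX _] := bX; have [BX BX0' hBX] := mbdd_bound bX.
set c := eta_mass R; have c0 : 0 < c := eta_mass_gt0 R.
(* The Cauchy-Pompeiu formula for [g psi] with the kernel [kern]. The sign comes from integrating in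
   the first argument of the kernel. *)
have reproduce w : D w -> cintegral D (fun z => X z * kern L z w) = - (c%:C * (g w * psi w)).
  move=> Dw; apply/eqP; rewrite -addr_eq0 -nc_eq0.
  pose Y z := g z * psi z * kexp L z w.
  have bkexp : mbdd (fun z => kexp L z w).
    by apply: ccont_mbdd => z; exact: CD_cont (CD_kexp L w).
  have bY : mbdd Y by do 2! apply: mbddM => //.
  have [mY [BY hBY]] := bY.
  have cY : ccont w Y.
    apply: ccontM; last exact: CD_cont (CD_kexp L w).
    by apply: ccontM; [exact: cg|exact: (test_pair_cont w t).1].
  have reg e : 0 < e -> cintegral D (fun z => X z * kreg L e z w) =
      - cintegral D (fun z => Y z * (eta e (z.1 - w.1) (z.2 - w.2))%:C).
    move=> e0; have dk := CD_kreg L w (lt0r_neq0 e0).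
    have bk : mbdd (fun z => kreg L e z w) by apply: ccont_mbdd => z; exact: CD_cont dk.
    have beta : mbdd (fun z => kexp L z w * (eta e (z.1 - w.1) (z.2 - w.2))%:C).
      by apply: ccont_mbdd => z; exact: CD_cont_dbar dk.
    have := hg _ _ (test_pair_mul dk t).
    have -> : cintegral D (fun z => g z * (kexp L z w * (eta e (z.1 - w.1) (z.2 - w.2))%:C * psi z +
        kreg L e z w * Psi z)) = cintegral D (fun z => Y z * (eta e (z.1 - w.1) (z.2 - w.2))%:C) +
        cintegral D (fun z => g z * Psi z * kreg L e z w).
      rewrite -cintegralD//.
      - by apply: eq_cintegral => z _; rewrite /Y; ring.
      - apply: mbdd_integrable.
        apply: mbdd_eq (mbddM (mbddM bg bp) beta) => z _; rewrite /Y; ring.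
      - by apply: mbdd_integrable; do 2! apply: mbddM => //.
    have -> : cintegral D (fun z => X z * kreg L e z w) =
        cintegral D (fun z => g z * Psi z * kreg L e z w) +
        cintegral D (fun z => G z * (kreg L e z w * psi z)).
      rewrite -cintegralD//; try (by apply: mbdd_integrable; do 2! apply: mbddM => //).
      by apply: eq_cintegral => z _; rewrite /X; ring.
    move=> h; apply/eqP; rewrite -addr_eq0 -(opprK (cintegral D (fun z => G z * _))) -h.
    by apply/eqP; ring.
  rewrite eq_le nc_ge0 andbT; apply/ler_addgt0Pl => r r0; rewrite addr0.
  have r2 : 0 < r / 2 by rewrite divr_gt0.
  have [e0 e00 he] := approx_identity Dw mY hBY cY r2.
  pose K := 128 * pi ^+ 2 * (BX * expR L).
  have K0 : 0 <= K by rewrite mulr_ge0 ?mulr_ge0 ?exprn_ge0 ?expR_ge0 ?pi_ge0.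
  (* The regularisation scale lies below the threshold [e0] of the approximate identity and makes
     the kernel error [K * sqrt s] at most [r/2]. *)
  pose s : R := Num.min (e0 / 2) ((r / 2 / (K + 1)) ^+ 2).
  have rK : 0 < r / 2 / (K + 1) by rewrite divr_gt0//; lra.
  have s0 : 0 < s by rewrite lt_min divr_gt0//= exprn_gt0.
  have se0 : s < e0 by rewrite gt_min; apply/orP; left; rewrite ltr_pdivrMr//; lra.
  have Ks : K * Num.sqrt s <= r / 2.
    apply: (@le_trans _ _ (K * (r / 2 / (K + 1)))).
      rewrite ler_wpM2l//; apply: (@le_trans _ _ (Num.sqrt ((r / 2 / (K + 1)) ^+ 2))).
        by apply: ler_wsqrtr; rewrite ge_min lexx orbT.
      by rewrite sqrtr_sqr gtr0_norm.
    by rewrite mulrA ler_pdivrMr; lra.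
  have a1 := (kern_approx L0' s0 BX0' Dw mX hBX).2.
  have a2 := he s s0 se0.
  have YE : Y w = g w * psi w by rewrite /Y kexp_diag mulr1.
  rewrite YE in a2.
  rewrite (reg s s0) opprK in a1.
  have -> : cintegral D (fun z => X z * kern L z w) + c%:C * (g w * psi w) =
    (cintegral D (fun z => X z * kern L z w) +
       cintegral D (fun z => Y z * (eta s (z.1 - w.1) (z.2 - w.2))%:C)) -
    (cintegral D (fun z => Y z * (eta s (z.1 - w.1) (z.2 - w.2))%:C) - c%:C * (g w * psi w)) by ring.
  apply: le_trans (ncB _ _) _; apply: le_trans (lerD a1 a2) _.
  by rewrite -/K; lra.
have [_ bf _] := af.
(* Exchanging the integrals moves the singular operator from [F] onto [X], where the reproducing
   formula evaluates it. *)
have swap : cintegral D (fun z => dbar_inv L F z * X z) = - cintegral D (fun z => F z * g z * psi z).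
  have ci : c%:C != 0 :> C by rewrite -nc_eq0 nc_real gtr0_norm// gt_eqF.
  transitivity ((c^-1)%:C * cintegral D (fun z => cintegral D (fun w => F w * kern L z w * X z))).
    have bS : mbdd (fun z => cintegral D (fun w => F w * kern L z w)).
      apply: mbdd_eq (mbddM (mbdd_cst c%:C) bf) => z _.
      by rewrite /dbar_inv mulrA -rmorphM/= divff ?gt_eqF// mul1r.
    rewrite -cintegralZ//; last first.
      apply: mbdd_integrable; apply: mbdd_eq (mbddM bS bX) => z Dz.
      rewrite mulrC -cintegralZ//; last exact: (dbar_inv_bound z L0 Bge0 mF hBw).1.
      by apply: eq_cintegral => w _; rewrite mulrC.
    apply: eq_cintegral => z Dz; rewrite /dbar_inv -mulrA; congr (_ * _).
    rewrite mulrC -cintegralZ//; last exact: (dbar_inv_bound z L0 Bge0 mF hBw).1.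
    by apply: eq_cintegral => w _; rewrite mulrC.
  have mp1 : measurable_fun (D `*` D) (fun p : (R * R) * (R * R) => p.1) by apply: measurable_funTS; exact: measurable_fst.
  have mp2 : measurable_fun (D `*` D) (fun p : (R * R) * (R * R) => p.2) by apply: measurable_funTS; exact: measurable_snd.
  have mh : cmeas (D `*` D) (fun p : (R * R) * (R * R) => F p.2 * kern L p.1 p.2 * X p.1).
    have comp1 (f : R * R -> C) : cmeas D f -> cmeas (D `*` D) (fun p : (R * R) * (R * R) => f p.1).
      move=> [mr mi]; split.
        by apply: (measurable_comp mD _ mr mp1) => _ [p [Dp _] <-].
      by apply: (measurable_comp mD _ mi mp1) => _ [p [Dp _] <-].
    have comp2 (f : R * R -> C) : cmeas D f -> cmeas (D `*` D) (fun p : (R * R) * (R * R) => f p.2).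
      move=> [mr mi]; split.
        by apply: (measurable_comp mD _ mr mp2) => _ [p [_ Dp] <-].
      by apply: (measurable_comp mD _ mi mp2) => _ [p [_ Dp] <-].
    by apply: cmeasM; [apply: cmeasM; [exact: comp2|exact: cmeas_kern]|exact: comp1].
  have dom z w : D z -> D w ->
      nc (F w * kern L z w * X z) <= B * BX * expR L * kdom 1 z w.
    move=> Dz Dw; have := kern_dom L0' Dz Dw; rewrite [nc (F w * _ * _)]ncM [nc (F w * _)]ncM.
    move=> h; rewrite mulrAC -!mulrA; apply: ler_pM; rewrite ?mulr_ge0 ?nc_ge0 ?hB//.
    by apply: ler_pM; rewrite ?nc_ge0 ?hBX.
  have kk : 0 <= B * BX * expR L by rewrite !mulr_ge0 ?expR_ge0.
  have mk1 z : measurable_fun D (fun w => B * BX * expR L * kdom 1 z w).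
    apply: measurable_funM; first exact: measurable_cst.
    by apply: measurable_funTS; exact: measurable_kdom.
  have mk2 w : measurable_fun D (fun z => B * BX * expR L * kdom 1 z w).
    by under eq_fun do rewrite kdomC; exact: mk1.
  have int1 z : D z -> (\int[mu]_(w in D) (B * BX * expR L * kdom 1 z w)%:E <=
      (B * BX * expR L * (64 * pi ^+ 2 * Num.sqrt 1))%:E)%E.
    move=> Dz; apply: integral_scale_le => //; last exact: kdom_integral.
      by apply: measurable_funTS; exact: measurable_kdom.
    by move=> w; exact: kdom_ge0.
  have int2 w : D w -> (\int[mu]_(z in D) (B * BX * expR L * kdom 1 z w)%:E <=
      (B * BX * expR L * (64 * pi ^+ 2 * Num.sqrt 1))%:E)%E.
    by move=> Dw; under eq_integral do rewrite kdomC; exact: int1.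
  rewrite (@cintegral_swap R D (fun z w => F w * kern L z w * X z)
    (fun z w => B * BX * expR L * kdom 1 z w) _ mD (@open_square_measure_fin R) mh.1 mh.2
    dom mk1 mk2 int1 int2).
  have -> : cintegral D (fun w => cintegral D (fun z => F w * kern L z w * X z)) =
     cintegral D (fun w => - c%:C * (F w * g w * psi w)).
    apply: eq_cintegral => w Dw.
    have ik : cintegrable D (fun z => X z * kern L z w).
      apply: (cintegral_dom (expR_ge0 L) ltr01 BX0' _ mX hBX _).1.
        by apply: cmeas_kern => //; exact: measurable_cst.
      by move=> z Dz; rewrite kdomC; exact: kern_dom.
    rewrite (eq_cintegral (g := fun z => F w * (X z * kern L z w))); last by move=> z _; ring.
    by rewrite cintegralZ// reproduce//; ring.
  rewrite cintegralZ//; last by apply: mbdd_integrable; do 2! apply: mbddM => //.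
  by rewrite mulrA mulrN -rmorphM/= mulVf ?gt_eqF// mulN1r.
apply/eqP; rewrite -addr_eq0.
have -> : cintegral D (fun z => dbar_inv L F z * g z * Psi z) +
    cintegral D (fun z => (F z * g z + dbar_inv L F z * G z) * psi z) =
  cintegral D (fun z => dbar_inv L F z * X z) + cintegral D (fun z => F z * g z * psi z).
  rewrite -!cintegralD//; try (by apply: mbdd_integrable; do 2! apply: mbddM => //).
    by apply: eq_cintegral => z _; rewrite /X; ring.
  by apply: mbdd_integrable; apply: mbddM => //; apply: mbddD; exact: mbddM.
by rewrite swap addNr.
Qed.

End weak_dbar.

(** * Inverses and exponentials in the class [mult] *)

Section inverse_exponential.
Variable R : realType.
Local Notation C := R[i].
Local Notation D := (@open_square R).
Implicit Types (z w : R * R) (f g F G : R * R -> C).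

Lemma geometric_small (t q r : R) : 0 <= t -> t < 1 -> 0 <= q -> 0 < r ->
  exists n, t ^+ n * q <= r.
Proof.
move=> t0 t1 q0 r0.
have : (fun n => t ^+ n) @ \oo --> (0 : R) by apply: cvg_expr; rewrite ger0_norm.
have rq : 0 < r / (q + 1) by rewrite divr_gt0//; lra.
move=> /cvgrPdist_lt /(_ _ rq) [n _ /(_ n (leqnn n))] /=.
rewrite sub0r normrN ger0_norm ?exprn_ge0// => h; exists n.
apply: (@le_trans _ _ (r / (q + 1) * q)); first by rewrite ler_wpM2r// ltW.
by rewrite mulrAC ler_pdivrMr; lra.
Qed.

(* 1/f is the limit of the iteration y := 1 + (1 - f) y, which converges
   geometrically together with its d-bar derivative. *)
Lemma mult_inv f F (t : R) : mult f F -> t < 1 ->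
  (forall z, D z -> nc (1 - f z) <= t) ->
  mult (fun z => (f z)^-1) (fun z => - F z / f z ^+ 2).
Proof.
move=> mf t1 ft; have [[cf bf bF] _] := mf.
pose t' := Num.max 0 t.
have t'0 : 0 <= t' by rewrite le_max lexx.
have t'1 : t' < 1 by rewrite gt_max ltr01.
have ft' z : D z -> nc (1 - f z) <= t' by move=> Dz; rewrite le_max ft ?orbT.
have fge z : D z -> 1 - t' <= nc (f z).
  move=> Dz; have := ft' z Dz; have := nc_dist_ge 1 (1 - f z).
  by rewrite nc1 subKr; lra.
have f0 z : D z -> f z != 0.
  by move=> Dz; rewrite -nc_gt0; apply: lt_le_trans (fge z Dz); lra.
have yB z : D z -> nc (f z)^-1 <= (1 - t')^-1.
  move=> Dz; rewrite ncV lef_pV2 ?posrE ?nc_gt0 ?f0 ?fge//; lra.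
have [mF _] := bF; have [B Bge0 hB] := mbdd_bound bF.
have byy : mbdd (fun z => (f z)^-1).
  split; first by apply: cmeas_inv; case: bf.
  by exists (1 - t')^-1.
have bY : mbdd (fun z => - F z / f z ^+ 2).
  apply: mbdd_eq (mbddM (mbddN bF) (mbddM byy byy)) => z _.
  by rewrite expr2 invfM.
pose step (p : (R * R -> C) * (R * R -> C)) : (R * R -> C) * (R * R -> C) :=
  (fun z => 1 + (1 - f z) * p.1 z, fun z => - F z * p.1 z + (1 - f z) * p.2 z).
pose it n := iter n step (fun=> 0, fun=> 0).
have mit n : mult (it n).1 (it n).2.
  elim: n => [|n IH]; first exact: mult_cst.
  have m1 := mult_add (mult_cst (1 : C)) (mult_opp mf).
  apply: mult_eq (mult_add (mult_cst (1 : C)) (mult_mul m1 IH)) => z _ //=.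
  by rewrite !add0r.
(* The error of the derivative iterate is fed by that of the function iterate with coefficient [B].
   With [s] halfway between [t'] and 1, and [l] such that [B + l t' = l s], the weighted sum of the
   two errors with weights 1 and [l + 1] contracts by the ratio [s]. *)
pose s := (1 + t') / 2.
pose l := B / (s - t').
have st : 0 < s - t' by rewrite /s; lra.
have l0 : 0 <= l by rewrite divr_ge0// ltW.
have lB : B + l * t' = l * s by rewrite /l; field; lra.
pose q0 := B * ((1 - t')^-1 * (1 - t')^-1) + (l + 1) * (1 - t')^-1.
have i0 : 0 <= (1 - t')^-1 by rewrite invr_ge0; lra.
have err n z : D z -> nc (- F z / f z ^+ 2 - (it n).2 z) + (l + 1) * nc ((f z)^-1 - (it n).1 z) <= s ^+ n * q0.
  move=> Dz; elim: n => [|n IH].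
    rewrite /= !subr0 expr0 mul1r; apply: lerD; last by rewrite ler_wpM2l ?yB//; lra.
    rewrite ncM ncN expr2 invfM ncM; apply: ler_pM; rewrite ?mulr_ge0 ?nc_ge0 ?hB//.
    by apply: ler_pM; rewrite ?nc_ge0 ?yB.
  rewrite (exprS s n) -(mulrA s); apply: (@le_trans _ _ (s * (nc (- F z / f z ^+ 2 - (it n).2 z) +
      (l + 1) * nc ((f z)^-1 - (it n).1 z)))); last by rewrite ler_wpM2l// /s; lra.
  have fz := f0 z Dz.
  have -> : - F z / f z ^+ 2 - (it n.+1).2 z =
      - F z * ((f z)^-1 - (it n).1 z) + (1 - f z) * (- F z / f z ^+ 2 - (it n).2 z).
    by rewrite /=; field.
  have -> : (f z)^-1 - (it n.+1).1 z = (1 - f z) * ((f z)^-1 - (it n).1 z).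
    by rewrite /=; field.
  have h1 := ncD (- F z * ((f z)^-1 - (it n).1 z)) ((1 - f z) * (- F z / f z ^+ 2 - (it n).2 z)).
  apply: le_trans (lerD h1 (lexx _)) _; rewrite !ncM ncN.
  have := ft' z Dz; have := hB z Dz.
  move: (nc_ge0 (F z)) (nc_ge0 (1 - f z)) (nc_ge0 ((f z)^-1 - (it n).1 z)).
  move: (nc_ge0 (- F z / f z ^+ 2 - (it n).2 z)).
  move: (nc (F z)) (nc (1 - f z)) (nc ((f z)^-1 - _)) (nc (- F z / _ - _)) => a b c d d0 c0 b0 a0 aB bt.
  have ac : a * c <= B * c by rewrite ler_wpM2r.
  have bd : b * d <= s * d by rewrite ler_wpM2r//; rewrite /s; lra.
  have bc : b * c <= t' * c by rewrite ler_wpM2r.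
  have lbc : l * (b * c) <= l * (t' * c) by rewrite ler_wpM2l.
  have lc : B * c + l * (t' * c) = s * (l * c) by have := congr1 (fun x => x * c) lB; nra.
  have sc : t' * c <= s * c by rewrite ler_wpM2r//; rewrite /s; lra.
  have e1 : (l + 1) * (b * c) = l * (b * c) + b * c by ring.
  have e2 : s * (d + (l + 1) * c) = s * d + s * (l * c) + s * c by ring.
  rewrite e1 e2; lra.
apply: mult_lim => // e e0.
have q00 : 0 <= q0.
  rewrite /q0; have := mulr_ge0 Bge0 (mulr_ge0 i0 i0).
  have : 0 <= (l + 1) * (1 - t')^-1 by apply: mulr_ge0 => //; lra.
  lra.
have s0 : 0 <= s by rewrite /s; lra.
have s1 : s < 1 by rewrite /s; lra.
have [n hn] := geometric_small s0 s1 q00 e0.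
exists (it n).1, (it n).2; split => // z Dz.
have := le_trans (err n z Dz) hn.
have := nc_ge0 ((f z)^-1 - (it n).1 z); have := nc_ge0 (- F z / f z ^+ 2 - (it n).2 z).
move: (nc _) (nc _) => a b a0 b0 h; have := mulr_ge0 l0 b0.
by split; lra.
Qed.

Lemma norm_sin_le (x : R) : `|sin x| <= `|x|.
Proof.
have pos (y : R) : 0 <= y -> `|sin y| <= y.
  move=> y0.
  have [|c _] := @MVT_segment R sin cos 0 y y0.
    by apply: continuous_subspaceT; exact: continuous_sin.
  rewrite sin0 !subr0 => ->; rewrite normrM (ger0_norm y0) ler_piMl//.
  by rewrite ler_norml cos_geN1 cos_le1.
have [x0|x0] := leP 0 x; first by rewrite (ger0_norm x0) pos.
by rewrite -normrN -sinN -(normrN x) [leRHS]ger0_norm ?oppr_ge0 ?(ltW x0)// pos// oppr_ge0 ltW.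
Qed.

Lemma cos_taylor (x : R) : `|cos x - 1| <= x ^+ 2 / 2.
Proof.
have -> : cos x = 1 - 2 * sin (x / 2) ^+ 2.
  rewrite [in LHS](_ : x = x / 2 + x / 2); last by field.
  rewrite cosD -!expr2; have := cos2Dsin2 (x / 2); lra.
have -> : 1 - 2 * sin (x / 2) ^+ 2 - 1 = - (2 * sin (x / 2) ^+ 2) by ring.
have : 0 <= sin (x / 2) ^+ 2 by exact: sqr_ge0.
have : sin (x / 2) ^+ 2 <= (x / 2) ^+ 2.
  by rewrite -(real_normK (num_real (sin _))) -(real_normK (num_real (x / 2))) lerXn2r ?nnegrE ?norm_sin_le.
move=> h1 h0; rewrite normrN ger0_norm; nra.
Qed.

Lemma sin_taylor (x : R) : `|x| <= 1 -> `|sin x - x| <= x ^+ 2.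
Proof.
have pos (y : R) : 0 <= y -> y <= 1 -> `|sin y - y| <= y ^+ 2.
  move=> y0 y1.
  have [|c] := @MVT_segment R (fun t => sin t - t) (fun t => cos t - 1) 0 y y0.
    by apply: continuous_subspaceT => t; apply: continuousB; [exact: continuous_sin|exact: cvg_id].
  rewrite in_itv/= => /andP[c0 cy]; rewrite sin0 !subr0 => ->.
  rewrite normrM (ger0_norm y0) expr2 ler_wpM2r//; apply: le_trans (cos_taylor c) _.
  by nra.
have [x0|x0] := leP 0 x; first by rewrite (ger0_norm x0); exact: pos.
rewrite ltr0_norm// => x1; rewrite -normrN opprD -sinN -sqrrN; apply: pos; lra.
Qed.

Lemma expR_taylor (a : R) : `|a| <= 2^-1 -> `|expR a - 1 - a| <= a ^+ 2 *+ 2.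
Proof.
rewrite ler_norml => /andP[a1 a2].
have l1 := expR_ge1Dx a.
have : expR a * (1 - a) <= 1.
  have : expR a * (1 - a) <= expR a * expR (- a) by rewrite ler_wpM2l ?expR_ge0// expR_ge1Dx.
  by rewrite -expRD subrr expR0.
have a20 := sqr_ge0 a; move: (expR a) l1 => x l1 h.
by rewrite ler_norml; apply/andP; split; nra.
Qed.

Lemma cexp_taylor (z : C) : nc z <= 2^-1 -> nc (cexp z - 1 - z) <= 10 * nc z ^+ 2.
Proof.
move=> z1; have ha := abs_cRe z; have hb := abs_cIm z.
have a2 : cRe z ^+ 2 <= nc z ^+ 2 by rewrite nc_sqr lerDl sqr_ge0.
have b2 : cIm z ^+ 2 <= nc z ^+ 2 by rewrite nc_sqr lerDr sqr_ge0.
have ea : `|expR (cRe z) - 1 - cRe z| <= cRe z ^+ 2 *+ 2 by apply: expR_taylor; lra.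
have cb := cos_taylor (cIm z).
have sb : `|sin (cIm z) - cIm z| <= cIm z ^+ 2 by apply: sin_taylor; lra.
have e2 : expR (cRe z) <= 2.
  have n2 : nc z ^+ 2 <= 2^-1 ^+ 2 by rewrite lerXn2r ?nnegrE ?nc_ge0.
  move: ea ha; rewrite !ler_norml -mulr_natl => /andP[_ e1] /andP[_ e2].
  rewrite expr2 in n2; lra.
have e0 := expR_ge0 (cRe z).
have e3 : `|expR (cRe z) - 1| <= 2 * nc z.
  move: ea ha; rewrite !ler_norml => /andP[? ?] /andP[? ?].
  have := nc_ge0 z; move=> z0; apply/andP; split; nra.
apply: le_trans (nc_leD _) _; rewrite !cRI/= !(subr0, oppr0, addr0).
have -> : expR (cRe z) * cos (cIm z) - 1 - cRe z =
  expR (cRe z) * (cos (cIm z) - 1) + (expR (cRe z) - 1 - cRe z) by ring.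
have -> : expR (cRe z) * sin (cIm z) - cIm z =
  expR (cRe z) * (sin (cIm z) - cIm z) + (expR (cRe z) - 1) * cIm z by ring.
have t1 : `|expR (cRe z) * (cos (cIm z) - 1)| <= 2 * (cIm z ^+ 2 / 2).
  by rewrite normrM (ger0_norm e0) ler_pM.
have t2 : `|expR (cRe z) * (sin (cIm z) - cIm z)| <= 2 * cIm z ^+ 2.
  by rewrite normrM (ger0_norm e0) ler_pM.
have t3 : `|(expR (cRe z) - 1) * cIm z| <= 2 * nc z * nc z by rewrite normrM ler_pM.
apply: le_trans (lerD (ler_normD _ _) (ler_normD _ _)) _.
apply: le_trans (lerD (lerD t1 ea) (lerD t2 t3)) _; nra.
Qed.

Lemma nc_exprB (a b : C) (m : R) n : nc a <= m -> nc b <= m ->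
  nc (a ^+ n.+1 - b ^+ n.+1) <= n.+1%:R * m ^+ n * nc (a - b).
Proof.
move=> am bm; have m0 : 0 <= m := le_trans (nc_ge0 a) am.
elim: n => [|n IH]; first by rewrite !expr1 expr0 !mul1r.
have -> : a ^+ n.+2 - b ^+ n.+2 = a * (a ^+ n.+1 - b ^+ n.+1) + (a - b) * b ^+ n.+1.
  by rewrite !(exprS _ n.+1); ring.
apply: le_trans (ncD _ _) _; rewrite !ncM ncX.
have h1 : nc a * nc (a ^+ n.+1 - b ^+ n.+1) <= m * (n.+1%:R * m ^+ n * nc (a - b)).
  by rewrite ler_pM ?nc_ge0.
have h2 : nc (a - b) * nc b ^+ n.+1 <= nc (a - b) * m ^+ n.+1.
  by rewrite ler_wpM2l ?nc_ge0// lerXn2r ?nnegrE ?nc_ge0.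
apply: le_trans (lerD h1 h2) _; rewrite -[n.+2%:R]natr1 exprS.
by apply: eq_ler; ring.
Qed.

(** With [y = x/(n+1)], [cexp y] and [1 + y] are both bounded by [exp(B/(n+1))] and differ by order
    [1/n^2], since [2B <= n+1] forces [|y| <= 1/2]. Telescoping the difference of the powers
    multiplies this by [n+1]. *)
Lemma euler_approx (x : C) (B : R) n : nc x <= B -> 2 * B <= n.+1%:R ->
  nc (cexp x - (1 + x / n.+1%:R) ^+ n.+1) <= 10 * B ^+ 2 * expR B / n.+1%:R /\
  nc ((1 + x / n.+1%:R) ^+ n) <= expR B.
Proof.
move=> xB nB; have n0 : (0 : R) < n.+1%:R by rewrite ltr0n.
set y := x / n.+1%:R.
have ncn := nc_nat R n.+1.
have yE : nc y = nc x / n.+1%:R by rewrite ncM ncV ncn.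
have yB : nc y <= B / n.+1%:R by rewrite yE ler_pM2r ?invr_gt0.
have B0 : 0 <= B := le_trans (nc_ge0 x) xB.
have y2 : nc y <= 2^-1 by apply: le_trans yB _; rewrite ler_pdivrMr//; lra.
have b1 : nc (1 + y) <= expR (B / n.+1%:R).
  apply: le_trans (ncD _ _) _; rewrite nc1; apply: le_trans (expR_ge1Dx _).
  by rewrite lerD2l.
have b2 : nc (cexp y) <= expR (B / n.+1%:R).
  rewrite nc_cexp ler_expR; apply: le_trans yB.
  by apply: le_trans (abs_cRe y); exact: ler_norm.
have pown : expR (B / n.+1%:R) ^+ n <= expR B.
  rewrite -expRM_natl ler_expR -mulr_natl mulrA ler_pdivrMr// mulrC ler_wpM2l//.
  by rewrite mulr1 ler_nat.
split; last first.
  by rewrite ncX; apply: le_trans pown; rewrite lerXn2r ?nnegrE ?nc_ge0 ?expR_ge0.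
have -> : cexp x = cexp y ^+ n.+1.
  rewrite -cexpMn; congr cexp; rewrite -[RHS]mulr_natr /y mulfVK//.
apply: le_trans (nc_exprB n b2 b1) _.
have h : nc (cexp y - (1 + y)) <= 10 * (B / n.+1%:R) ^+ 2.
  rewrite opprD addrA; apply: le_trans (cexp_taylor y2) _.
  by rewrite ler_pM2l// lerXn2r ?nnegrE ?nc_ge0// divr_ge0// ltW.
apply: (@le_trans _ _ (n.+1%:R * expR B * (10 * (B / n.+1%:R) ^+ 2))).
  apply: ler_pM; rewrite ?mulr_ge0 ?nc_ge0 ?exprn_ge0 ?expR_ge0 ?(ltW n0)//.
  by rewrite ler_pM2l.
by apply: eq_ler; field; rewrite gt_eqF.
Qed.

(** Euler's powers [(1 + f/n)^n] are polynomial in [f], so the Leibniz rule covers them; they and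
    their d-bar derivatives [(1 + f/n)^(n-1) F] converge uniformly. *)
Lemma mult_cexp f F : mult f F -> mult (fun z => cexp (f z)) (fun z => cexp (f z) * F z).
Proof.
move=> mf; have [[cf bf bF] _] := mf.
have [mff [B0 hB0]] := bf; have [_ [B1 hB1]] := bF.
pose B := Num.max 1 (Num.max B0 B1).
have B1' : 1 <= B by rewrite le_max lexx.
have hf w : D w -> nc (f w) <= B by move=> Dw; rewrite !le_max hB0 ?orbT.
have hF w : D w -> nc (F w) <= B by move=> Dw; rewrite !le_max hB1 ?orbT.
have bE : mbdd (fun z => cexp (f z)).
  split; first exact: cmeas_cexp.
  exists (expR B) => z Dz; rewrite nc_cexp ler_expR.
  by apply: le_trans (hf z Dz); apply: le_trans (abs_cRe _); exact: ler_norm.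
apply: mult_lim; first exact: mbddM.
move=> e e0.
pose K := 10 * B ^+ 2 * expR B * B + expR B * B * B.
have K0 : 0 <= K by rewrite addr_ge0// !mulr_ge0 ?expR_ge0 ?sqr_ge0//; lra.
(* Large enough for [euler_approx] and for [K/(n+1) <= e], where [K] collects the errors of the
   function and of its derivative. *)
pose n := Num.trunc (2 * B + K / e).
have nlt : 2 * B + K / e < n.+1%:R by exact: truncnS_gt.
have Ke : 0 <= K / e by rewrite divr_ge0// ltW.
have nB : 2 * B <= n.+1%:R by lra.
have n0 : (0 : R) < n.+1%:R by rewrite ltr0n.
have Kn : K / n.+1%:R <= e.
  rewrite ler_pdivrMr// mulrC -ler_pdivrMr//; lra.
have mpow k (g G : R * R -> C) : mult g G ->
    mult (fun z => g z ^+ k.+1) (fun z => k.+1%:R * g z ^+ k * G z).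
  move=> mg; elim: k => [|k IH].
    by apply: mult_eq mg => z _; rewrite ?expr1// expr0 !mul1r.
  apply: mult_eq (mult_mul mg IH) => z _; first by rewrite [RHS]exprS.
  by rewrite -[k.+2%:R]natr1 !exprS; ring.
have m1 : mult (fun z => 1 + f z / n.+1%:R) (fun z => F z / n.+1%:R).
  apply: mult_eq (mult_add (mult_cst (1 : C)) (mult_mul mf (mult_cst (n.+1%:R^-1 : C)))) => z _ //.
  by rewrite mulr0 addr0 add0r.
exists (fun z => (1 + f z / n.+1%:R) ^+ n.+1),
  (fun z => n.+1%:R * (1 + f z / n.+1%:R) ^+ n * (F z / n.+1%:R)).
split=> [|z Dz]; first exact: mpow.
have [h1 h2] := euler_approx (hf z Dz) nB.
have nz : (n.+1%:R : C) != 0 by rewrite pnatr_eq0.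
have -> : n.+1%:R * (1 + f z / n.+1%:R) ^+ n * (F z / n.+1%:R) = (1 + f z / n.+1%:R) ^+ n * F z.
  by move: (_ ^+ n) => y; field.
have ncn := nc_nat R n.+1.
have ineq1 : 10 * B ^+ 2 * expR B / n.+1%:R <= K / n.+1%:R.
  rewrite ler_pM2r ?invr_gt0// /K.
  have p1 : 0 <= 10 * B ^+ 2 * expR B by rewrite mulr_ge0 ?expR_ge0// mulr_ge0 ?sqr_ge0.
  have p2 : 0 <= expR B * B * B by rewrite mulr_ge0 ?mulr_ge0 ?expR_ge0//; lra.
  by have := ler_wpM2l p1 B1'; lra.
split; first exact: le_trans h1 (le_trans ineq1 Kn).
rewrite -mulrBl ncM.
have -> : cexp (f z) - (1 + f z / n.+1%:R) ^+ n =
  (cexp (f z) - (1 + f z / n.+1%:R) ^+ n.+1) + (1 + f z / n.+1%:R) ^+ n * (f z / n.+1%:R).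
  by rewrite exprSr; ring.
apply: le_trans Kn.
apply: (@le_trans _ _ ((10 * B ^+ 2 * expR B / n.+1%:R + expR B * (B / n.+1%:R)) * B)).
  apply: ler_pM; rewrite ?nc_ge0 ?hF//; apply: le_trans (ncD _ _) _; apply: lerD => //.
  rewrite !ncM ncV ncn; apply: ler_pM; rewrite ?mulr_ge0 ?nc_ge0 ?invr_ge0//.
  by rewrite ler_pM2r ?invr_gt0// hf.
by apply: eq_ler; rewrite /K; ring.
Qed.

End inverse_exponential.

(** * Neumann series *)

Section neumann_iteration.
Variable R : realType.
Local Notation C := R[i].
Local Notation D := (@open_square R).
Implicit Types (z w : R * R) (L B M k : R).

(** With [b n = 2 a t^n], the bound [t <= 1/2] gives [a t^n <= b n - b (n+1)], so the intervals of
    centre [x n] and radius [b n] are nested. The supremum of their left ends lies in all of them,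
    which gives the limit and its rate at once. *)
Lemma geometric_limit (x : nat -> R) (a t : R) : 0 <= a -> 0 <= t -> t <= 2^-1 ->
  (forall n, `|x n.+1 - x n| <= a * t ^+ n) ->
  exists l, forall n, `|l - x n| <= 2 * a * t ^+ n.
Proof.
move=> a0 t0 t2 xB.
pose b n := 2 * a * t ^+ n.
have tn0 n : 0 <= t ^+ n by exact: exprn_ge0.
have ab n : a * t ^+ n <= b n - b n.+1.
  have at0 : 0 <= a * t ^+ n by exact: mulr_ge0.
  rewrite /b exprS; have := ler_wpM2l at0 t2; lra.
have up n : x n - b n <= x n.+1 - b n.+1.
  by have := xB n; have := ab n; rewrite ler_norml => h /andP[h1 h2]; lra.
have dn n : x n.+1 + b n.+1 <= x n + b n.
  by have := xB n; have := ab n; rewrite ler_norml => h /andP[h1 h2]; lra.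
have upm n m : (n <= m)%N -> x n - b n <= x m - b m.
  by move/subnKC <-; elim: (m - n)%N => [|d IH]; rewrite ?addn0// addnS; exact: le_trans IH (up _).
have dnm n m : (n <= m)%N -> x m + b m <= x n + b n.
  by move/subnKC <-; elim: (m - n)%N => [|d IH]; rewrite ?addn0// addnS; exact: le_trans (dn _) IH.
have b0 n : 0 <= b n by rewrite /b mulr_ge0 ?mulr_ge0.
have cross n m : x n - b n <= x m + b m.
  have h1 := upm n (maxn n m) (leq_maxl _ _); have h2 := dnm m (maxn n m) (leq_maxr _ _).
  by have := b0 (maxn n m); lra.
pose E := [set x n - b n | n in [set: nat]].
have hub m : ubound E (x m + b m) by move=> _ [n _ <-]; exact: cross.
have E0 : E !=set0 by exists (x 0%N - b 0%N), 0%N.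
exists (sup E) => n; rewrite ler_distl; apply/andP; split.
  by apply: ub_le_sup; [exists (x 0%N + b 0%N); exact: hub|exists n].
by apply: ge_sup => //; exact: hub.
Qed.

Lemma geometric_limitC (x : nat -> C) (a t : R) : 0 <= a -> 0 <= t -> t <= 2^-1 ->
  (forall n, nc (x n.+1 - x n) <= a * t ^+ n) ->
  exists l, forall n, nc (l - x n) <= 4 * a * t ^+ n.
Proof.
move=> a0 t0 t2 xB.
have [l1 h1] : exists l, forall n, `|l - cRe (x n)| <= 2 * a * t ^+ n.
  apply: geometric_limit => // n; apply: le_trans (xB n).
  by apply: le_trans (abs_cRe _); rewrite !cRI.
have [l2 h2] : exists l, forall n, `|l - cIm (x n)| <= 2 * a * t ^+ n.
  apply: geometric_limit => // n; apply: le_trans (xB n).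
  by apply: le_trans (abs_cIm _); rewrite !cRI.
exists (l1 +i* l2) => n; apply: le_trans (nc_leD _) _; rewrite !cRI/=.
by apply: le_trans (lerD (h1 n) (h2 n)) _; lra.
Qed.

Lemma le_geometric_eq0 (x c t : R) : 0 <= t -> t < 1 -> 0 <= c -> 0 <= x ->
  (forall n, x <= c * t ^+ n) -> x = 0.
Proof.
move=> t0 t1 c0 x0 xc; apply/eqP; rewrite eq_le x0 andbT.
apply/ler_addgt0Pl => r r0; rewrite addr0.
by have [n] := geometric_small t0 t1 c0 r0; apply: le_trans; rewrite mulrC.
Qed.

Lemma dbar_invB L B B' (F G : R * R -> C) z : 0 < L -> 0 <= B -> 0 <= B' ->
  cmeas D F -> cmeas D G ->
  (forall w, D w -> nc (F w) <= B * wt L w) -> (forall w, D w -> nc (G w) <= B' * wt L w) ->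
  dbar_inv L F z - dbar_inv L G z = dbar_inv L (fun w => F w - G w) z.
Proof.
move=> L0 B0 B'0 mF mG hF hG; rewrite /dbar_inv -mulrBr; congr (_ * _).
have iF := (dbar_inv_bound z L0 B0 mF hF).1.
have iG := (dbar_inv_bound z L0 B'0 mG hG).1.
have mD := @measurable_open_square R.
have iFG : cintegrable D (fun w => (F w - G w) * kern L z w).
  apply: (dbar_inv_bound z L0 (addr_ge0 B0 B'0) _ _).1 => [|w Dw].
    by apply: cmeasD => //; exact: cmeasN.
  by rewrite mulrDl; apply: le_trans (ncB _ _) _; rewrite lerD ?hF ?hG.
apply/eqP; rewrite subr_eq -cintegralD//; apply/eqP.
by apply: eq_cintegral => w _; ring.
Qed.

Lemma wt_bounds L z : 0 <= L -> D z -> 1 <= wt L z /\ wt L z <= expR L.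
Proof.
move=> L0 /open_square_coord[_ _ z0 z1]; split.
  by rewrite /wt -expR0 ler_expR mulr_ge0 ?sqr_ge0.
by rewrite /wt ler_expR ler_piMr// expr_le1// ltW.
Qed.

Lemma mbdd_wt L B (F : R * R -> C) : 0 <= L -> 0 <= B -> cmeas D F ->
  (forall z, D z -> nc (F z) <= B * wt L z) -> mbdd F.
Proof.
move=> L0 B0 mF hF; split => //; exists (B * expR L) => z Dz.
by apply: le_trans (hF z Dz) _; rewrite ler_wpM2l//; exact: (wt_bounds L0 Dz).2.
Qed.

Section fixpoint.
Variables (L B M k : R) (A : 'I_2 -> 'I_2 -> R * R -> C) (H : 'I_2 -> R * R -> C).
Hypotheses (L0 : 0 < L) (B0 : 0 <= B) (M0 : 0 <= M) (k2 : k <= 2^-1).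
Hypothesis kE : dbar_inv_cst R / Num.sqrt L * (2 * M) <= k.
Hypothesis mA : forall i j, cmeas D (A i j).
Hypothesis AM : forall i j z, D z -> nc (A i j z) <= M.
Hypothesis mH : forall i, cmeas D (H i).
Hypothesis HB : forall i z, D z -> nc (H i z) <= B * wt L z.

Let c : R := dbar_inv_cst R / Num.sqrt L.

Let c0 : 0 <= c.
Proof. by rewrite divr_ge0 ?sqrtr_ge0// ltW// dbar_inv_cst_gt0. Qed.

Let k0 : 0 <= k. Proof. by apply: le_trans kE; rewrite mulr_ge0// mulr_ge0. Qed.

Let step (F : 'I_2 -> R * R -> C) (i : 'I_2) z : C :=
  \sum_(j < 2) A i j z * (H j z + dbar_inv L (F j) z).

Let good (K : R) (F : 'I_2 -> R * R -> C) :=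
  forall i, cmeas D (F i) /\ forall z, D z -> nc (F i z) <= K * wt L z.

Let good_meas K F : 0 <= K -> good K F -> forall i, cmeas D (step F i).
Proof.
move=> K0 gF i; apply: cmeas_sum => j; apply: cmeasM; first exact: mA.
apply: cmeasD; first exact: mH.
have [mF hF] := gF j.
by have [[_ [h _] _] _] := mult_dbar_inv L0 (mbdd_wt (ltW L0) K0 mF hF).
Qed.

Let sumM (X : 'I_2 -> C) (K : R) i z : D z -> (forall j, nc (X j) <= K) ->
  nc (\sum_(j < 2) A i j z * X j) <= 2 * M * K.
Proof.
move=> Dz XK; apply: le_trans (nc_sum _ _ _) _.
apply: (@le_trans _ _ (\sum_(j < 2) M * K)).
  by apply: ler_sum => j _; rewrite ncM ler_pM ?nc_ge0 ?AM.
by rewrite !big_ord_recl big_ord0; lra.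
Qed.

Let step_lip K K' d F G : 0 <= K -> 0 <= K' -> 0 <= d -> good K F -> good K' G ->
  (forall i z, D z -> nc (F i z - G i z) <= d * wt L z) ->
  forall i z, D z -> nc (step F i z - step G i z) <= k * d * wt L z.
Proof.
move=> K0 K'0 d0 gF gG FG i z Dz.
have -> : step F i z - step G i z =
    \sum_(j < 2) A i j z * dbar_inv L (fun w => F j w - G j w) z.
  rewrite /step -sumrB; apply: eq_bigr => j _.
  rewrite -mulrBr -(dbar_invB z L0 K0 K'0 (gF j).1 (gG j).1 (gF j).2 (gG j).2); congr (_ * _).
  ring.
apply: (@le_trans _ _ (2 * M * (c * (d * wt L z)))).
  apply: sumM => // j.
  have mFG : cmeas D (fun w => F j w - G j w).
    by apply: cmeasD; [exact: (gF j).1|apply: cmeasN; exact: (gG j).1].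
  exact: (dbar_inv_bound z L0 d0 mFG (FG j)).2.
have wd : 0 <= d * wt L z by rewrite mulr_ge0// ltW// wt_gt0.
by have := ler_wpM2r wd kE; rewrite -/c; lra.
Qed.

Let it n : 'I_2 -> R * R -> C := iter n step (fun _ _ => 0).

Let itB n : exists2 K, 0 <= K & good K (it n).
Proof.
elim: n => [|n [K K0 gK]].
  exists 0 => // i; split; first exact: cmeas_cst.
  by move=> z _; rewrite nc0 mul0r.
exists (2 * M * (B + c * K)) => [|i].
  by rewrite !mulr_ge0// addr_ge0// mulr_ge0.
split; first exact: good_meas K0 gK i.
move=> z Dz; rewrite -mulrA; apply: sumM => // j; apply: le_trans (ncD _ _) _.
rewrite mulrDl; apply: lerD; first exact: HB.
by rewrite -mulrA; exact: (dbar_inv_bound z L0 K0 (gK j).1 (gK j).2).2.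
Qed.

Let it_diff n i z : D z -> nc (it n.+1 i z - it n i z) <= (2 * M * B * wt L z) * k ^+ n.
Proof.
move=> Dz; rewrite mulrAC; elim: n i z Dz => [|n IH] i z Dz.
  have -> : it 1 i z - it 0 i z = \sum_(j < 2) A i j z * (H j z + dbar_inv L (fun=> 0) z).
    exact: subr0.
  rewrite (_ : 2 * M * B * k ^+ 0 * wt L z = 2 * M * (B * wt L z)); last by rewrite expr0; ring.
  apply: (@sumM (fun j => H j z + dbar_inv L (fun=> 0) z)) => // j.
  have -> : dbar_inv L (fun=> 0) z = 0.
    have m0 : cmeas D (fun=> 0 : C) by exact: cmeas_cst.
    have h0 w : D w -> nc (0 : C) <= 0 * wt L w by rewrite nc0 mul0r.
    have := (dbar_inv_bound z L0 (lexx 0) m0 h0).2.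
    rewrite mul0r mulr0 => h; apply/eqP; rewrite -nc_eq0 eq_le h nc_ge0//.
  by rewrite addr0 HB.
have [K K0 gK] := itB n; have [K' K'0 gK'] := itB n.+1.
rewrite exprS.
have d0 : 0 <= 2 * M * B * k ^+ n by rewrite mulr_ge0 ?exprn_ge0// mulr_ge0// mulr_ge0.
apply: le_trans (step_lip K'0 K0 d0 gK' gK IH i Dz) _.
by apply: eq_ler; ring.
Qed.

(** For holomorphic [H] and [S = dbar_inv L], [u = H + S F] solves [dbar u = A u] as soon as
    [F = A (H + S F)]. The iteration runs on [F], in the supremum norm relative to the weight; a row
    of [A] has two entries bounded by [M], hence the factor [2 * M] in the contraction ratio. The 8
    is [2 * M * B] times the 4 of [geometric_limitC]. *)
Lemma neumann_fixpoint : exists F : 'I_2 -> R * R -> C, forall i,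
  [/\ cmeas D (F i), forall z, D z -> nc (F i z) <= 8 * M * B * wt L z,
   forall z, D z -> F i z = \sum_(j < 2) A i j z * (H j z + dbar_inv L (F j) z) &
   forall z, D z -> nc (dbar_inv L (F i) z) <= 4 * k * B * wt L z].
Proof.
have ex i z : exists l, D z -> forall n, nc (l - it n i z) <= 8 * M * B * k ^+ n * wt L z.
  have [Dz|nDz] := pselect (D z); last by exists 0.
  have a0 : 0 <= 2 * M * B * wt L z.
    by rewrite mulr_ge0 ?(ltW (wt_gt0 _ _))// mulr_ge0// mulr_ge0.
  have [l hl] := geometric_limitC a0 k0 k2 (fun n => it_diff n i Dz).
  by exists l => _ n; apply: le_trans (hl n) _; lra.
pose F i z : C := sval (cid (ex i z)).
have FE i z : D z -> forall n, nc (F i z - it n i z) <= 8 * M * B * k ^+ n * wt L z.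
  by move=> Dz; exact: (svalP (cid (ex i z)) Dz).
have MB0 : 0 <= 8 * M * B by rewrite mulr_ge0// mulr_ge0.
have k1 : k < 1 by apply: le_lt_trans k2 _; rewrite invf_lt1 ?ltr1n.
have lim (x : nat -> R) (l a : R) : 0 <= a -> (forall n, `|l - x n| <= a * k ^+ n) ->
    x @ \oo --> l.
  move=> a0 h; apply/cvgrPdist_le => r r0.
  have [n hn] := geometric_small k0 k1 a0 r0.
  exists n => // m /= nm; apply: le_trans (h m) _; apply: le_trans hn.
  by rewrite mulrC ler_wpM2r// ler_wiXn2l// ltW.
have mF i : cmeas D (F i).
  have a0 z : 0 <= 8 * M * B * wt L z by rewrite mulr_ge0// ltW// wt_gt0.
  have itm n : cmeas D (it n i) by have [K _ gK] := itB n; exact: (gK i).1.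
  split.
    apply: (@measurable_fun_cvg _ _ _ D (fun n z => cRe (it n i z))) => [m|z Dz].
      exact: (itm m).1.
    apply: (lim _ _ _ (a0 z)) => n; rewrite mulrAC; apply: le_trans (FE i z Dz n).
    by apply: le_trans (abs_cRe _); rewrite !cRI.
  apply: (@measurable_fun_cvg _ _ _ D (fun n z => cIm (it n i z))) => [m|z Dz].
    exact: (itm m).2.
  apply: (lim _ _ _ (a0 z)) => n; rewrite mulrAC; apply: le_trans (FE i z Dz n).
  by apply: le_trans (abs_cIm _); rewrite !cRI.
have hF i z : D z -> nc (F i z) <= 8 * M * B * wt L z.
  by move=> Dz; have := FE i z Dz 0%N; rewrite expr0 mulr1 subr0.
have gF : good (8 * M * B) F by move=> i; split; [exact: mF|exact: hF].
have fix_eq i z : D z -> F i z = step F i z.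
  move=> Dz; apply/eqP; rewrite -subr_eq0 -nc_eq0; apply/eqP.
  have w0 := wt_gt0 L z.
  apply: (@le_geometric_eq0 _ (2 * k * (8 * M * B) * wt L z) k) => //.
  - by rewrite mulr_ge0 ?(ltW w0)// mulr_ge0// mulr_ge0.
  - exact: nc_ge0.
  move=> n; have [K K0 gK] := itB n.
  have d0 : 0 <= 8 * M * B * k ^+ n by rewrite mulr_ge0// exprn_ge0.
  have h1 := step_lip MB0 K0 d0 gF gK (fun i z Dz => FE i z Dz n) i Dz.
  have h2 := FE i z Dz n.+1.
  rewrite -(subrKA (it n.+1 i z)); apply: le_trans (ncD _ _) _.
  rewrite [X in _ + X]nc_distC; apply: le_trans (lerD h2 h1) _.
  by rewrite exprS; apply: eq_ler; ring.
exists F => i; split; [exact: mF|exact: hF|exact: fix_eq|].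
move=> z Dz; apply: le_trans (dbar_inv_bound z L0 MB0 (mF i) (hF i)).2 _.
have wB : 0 <= 4 * (B * wt L z) by rewrite mulr_ge0// mulr_ge0// ltW// wt_gt0.
by have := ler_wpM2r wB kE; rewrite -/c; lra.
Qed.

End fixpoint.
End neumann_iteration.

(** * Holomorphic lattice sums *)

Section lattice_sums.
Variable R : realType.
Local Notation C := R[i].
Local Notation D := (@open_square R).
Implicit Types (z : R * R) (L t : R).

(** The distance [|n - m|]: subtraction is truncated, so one of the two terms is 0. *)
Let ndist (n m : nat) : nat := ((n - m) + (m - n))%N.

Lemma two_sided_geometric (m N : nat) :
  \sum_(0 <= n < N | n != m) (9^-1 : R) ^+ ndist n m <= 4^-1.
Proof.
set q : R := 9^-1.
have q0 k : 0 <= q ^+ k by rewrite exprn_ge0// /q.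
have qS k : q ^+ k = 9 * q ^+ k.+1 by rewrite exprS /q mulrA mulfV ?mul1r.
(* Each side of [m] contributes at most [(1/9)/(1 - 1/9) = 1/8]. The induction needs the remaining
   geometric tail as slack, which has a different form before and after the index [m]. *)
suff H : if (N <= m)%N then \sum_(0 <= n < N | n != m) q ^+ ndist n m <= 8^-1 * q ^+ (m - N)
         else \sum_(0 <= n < N | n != m) q ^+ ndist n m <= 4^-1 - 8^-1 * q ^+ (N - m).-1.
  move: H; case: ifP => _ H; apply: le_trans H _; last by have := q0 (N - m).-1; lra.
  have : q ^+ (m - N) <= 1 by rewrite exprn_ile1// /q; lra.
  lra.
elim: N => [|N IH]; first by rewrite big_nil mulr_ge0.
rewrite big_mkcond big_nat_recr//= -big_mkcond/=.
have [Nm|mN|NE] := ltngtP N m.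
- rewrite (ltnW Nm) in IH; rewrite /= /ndist.
  have -> : (N - m + (m - N) = (m - N.+1).+1)%N by lia.
  have E : (m - N = (m - N.+1).+1)%N by lia.
  rewrite E in IH; rewrite (qS (m - N.+1)%N).
  by apply: le_trans (lerD IH (lexx _)) _; have := q0 (m - N.+1).+1; lra.
- rewrite leqNgt mN /= in IH; rewrite /= /ndist.
  have -> : (N - m + (m - N) = (N - m).-1.+1)%N by lia.
  have -> : ((N.+1 - m).-1 = (N - m).-1.+1)%N by lia.
  by apply: le_trans (lerD IH (lexx _)) _; rewrite (qS (N - m).-1); lra.
- rewrite NE leqnn subnn expr0 in IH; rewrite NE addr0.
  have -> : ((m.+1 - m).-1 = 0)%N by lia.
  by rewrite expr0; lra.
Qed.

(** The ratio 1/9 comes from [exp 8 >= 1 + 8]. *)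
Lemma expRN_geometric (x : R) n : 8 * n%:R <= x -> expR (- x) <= 9^-1 ^+ n.
Proof.
move=> h; apply: (@le_trans _ _ (expR (- 8) ^+ n)).
  by rewrite -expRM_natl ler_expR -mulr_natl; lra.
rewrite lerXn2r ?nnegrE ?expR_ge0//.
rewrite expRN lef_pV2 ?posrE ?expR_gt0//.
by apply: le_trans (expR_ge1Dx _); lra.
Qed.

Let ndistE (n m : nat) : (ndist n m)%:R = `|n%:R - m%:R| :> R.
Proof.
have [nm|mn] := leqP n m.
  rewrite ler0_norm ?subr_le0 ?ler_nat// opprB -natrB// /ndist; congr _%:R; lia.
by rewrite ger0_norm ?subr_ge0 ?ler_nat 1?ltnW// -natrB ?(ltnW mn)// /ndist; congr _%:R; lia.
Qed.

Section nearest.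
Variables (t : R) (m : nat).
Hypothesis tm : `|t - m%:R| <= 2^-1.

(** For [n] at distance [j >= 1] from [m], [|t - n| >= (j - 1) + 1/2], so the exponent is at least
    [8 (j - 1)]; the factor 9 makes up for the lost unit. *)
Lemma gauss_near n : expR (- (16 * (t - n%:R) ^+ 2)) <= 9 * 9^-1 ^+ ndist n m.
Proof.
have [j0|j1] := posnP (ndist n m).
  rewrite j0 expr0; apply: (@le_trans _ _ 1); last lra.
  by rewrite -expR0 ler_expR oppr_le0 mulr_ge0// sqr_ge0.
rewrite -[in leRHS](prednK j1) (exprS 9^-1) mulrA mulfV// mul1r.
apply: expRN_geometric; have := ndistE n m; rewrite -(prednK j1).
move: (ndist n m).-1 => j; rewrite -[j.+1%:R]natr1 => jE.
have j0 : (0 : R) <= j%:R by [].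
have : `|t - n%:R| >= j%:R + 2^-1.
  have := ler_normB (t - m%:R) (t - n%:R).
  rewrite (_ : t - m%:R - (t - n%:R) = n%:R - m%:R); last ring.
  by rewrite -jE => h; have tm' := tm; lra.
rewrite -(real_normK (num_real (t - _))); nra.
Qed.

(** At distance [j] one has [(t-n)^2 - (t-m)^2 >= j^2 - j], which is at least [j/2] once [j >= 2].
    For [j = 1] there may be no gain, [t] being possibly midway between [m] and [n]: this is why
    even and odd indices are separated. *)
Lemma gauss_far n : (1 < ndist n m)%N ->
  expR (- (16 * (t - n%:R) ^+ 2)) <= expR (- (16 * (t - m%:R) ^+ 2)) * 9^-1 ^+ ndist n m.
Proof.
move=> j1; rewrite -ler_pdivrMl ?expR_gt0// -expRN -expRD opprK.
rewrite -[X in expR X]opprK; apply: expRN_geometric.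
have := ndistE n m; have : (2 : R) <= (ndist n m)%:R by rewrite ler_nat.
move: ((ndist n m)%:R : R) tm => j tm' j2 jE.
have -> : t - n%:R = (t - m%:R) - (n%:R - m%:R) by ring.
have : (n%:R - m%:R) ^+ 2 = j ^+ 2 :> R by rewrite jE real_normK ?num_real.
have : `|(t - m%:R) * (n%:R - m%:R)| <= 2^-1 * j by rewrite normrM -jE ler_wpM2r//; lra.
rewrite ler_norml => /andP[_].
move: (t - m%:R) (n%:R - m%:R) => x y xy yj; rewrite sqrrB yj; nra.
Qed.

End nearest.

(* [gwave L n] is holomorphic, and relative to [wt L] it is a Gaussian in Im z
   centered at 4 n / sqrt L. *)
Definition gwave L n z : C :=
  cexp (- ((16 * n%:R ^+ 2)%:C + 0 +i* (8 * Num.sqrt L * n%:R) * pz z)).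

Lemma nc_gwave L n z : 0 < L ->
  nc (gwave L n z) = wt L z * expR (- (16 * (z.2 * Num.sqrt L / 4 - n%:R) ^+ 2)).
Proof.
move=> L0; rewrite nc_cexp /wt -expRD; congr expR; rewrite !cRI/=.
have LE : L = Num.sqrt L ^+ 2 by rewrite sqr_sqrtr// ltW.
rewrite {2}LE; by move: (Num.sqrt L) => s; field.
Qed.

(** The indices below [2 * gcount L] cover all wave centres at heights between 0 and 1, while
    staying below [4 sqrt L] when [L >= 1]. *)
Definition gcount L : nat := (Num.trunc (Num.sqrt L)).+1.

(** A finite section of a theta series in [z], restricted to the indices of one parity. *)
Definition hsum L (b : bool) z : C :=
  \sum_(0 <= n < (gcount L).*2 | odd n == b) gwave L n z.

Definition dhsum L (b : bool) z : C :=
  \sum_(0 <= n < (gcount L).*2 | odd n == b)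
    (0 +i* (8 * Num.sqrt L * n%:R)) * conjc (gwave L n z).

Lemma CD_sum (I : Type) (r : seq I) (P : pred I) (f fb : I -> R * R -> C) :
  (forall i, CD (f i) (fb i)) ->
  CD (fun z => \sum_(i <- r | P i) f i z) (fun z => \sum_(i <- r | P i) fb i z).
Proof.
move=> df; elim: r => [|i r IH].
  by apply: (CD_eq (CD_cst (0 : C))) => z; rewrite big_nil.
have [Pi|nPi] := boolP (P i).
  by apply: (CD_eq (CD_add (df i) IH)) => z; rewrite big_cons Pi.
by apply: (CD_eq IH) => z; rewrite big_cons (negPf nPi).
Qed.

Lemma CD_gwave L n : CD (gwave L n) (fun=> 0).
Proof.
apply: (CD_eq (CD_cexp (CD_opp (CD_add (CD_cst ((16 * n%:R ^+ 2)%:C : C))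
  (CD_mul (CD_cst (0 +i* (8 * Num.sqrt L * n%:R) : C)) (CD_pz R)))))) => z //.
by rewrite !(mul0r, mulr0, addr0, oppr0).
Qed.

Lemma CD_hsum L b : CD (hsum L b) (fun=> 0).
Proof.
apply: (CD_eq (CD_sum _ _ (CD_gwave L))) => z //.
by rewrite big1.
Qed.

Lemma CD_conj_hsum L b : CD (fun z => conjc (hsum L b z)) (dhsum L b).
Proof.
have dg n : CD (fun z => conjc (gwave L n z))
    (fun z => (0 +i* (8 * Num.sqrt L * n%:R)) * conjc (gwave L n z)).
  apply: (CD_eq (CD_cexp (CD_opp (CD_add (CD_cst ((16 * n%:R ^+ 2)%:C : C))
    (CD_mul (CD_cst (0 -i* (8 * Num.sqrt L * n%:R) : C)) (CD_conj_pz R)))))) => z.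
    by rewrite /gwave cexp_conj; congr cexp; apply: complex_eq; rewrite !cRI/=; ring.
  rewrite /gwave cexp_conj mulrC; congr (_ * cexp _); apply: complex_eq; rewrite !cRI/=; ring.
apply: (CD_eq (CD_sum _ _ dg)) => z //.
by rewrite /hsum (big_morph conjc (id1 := 0) (op1 := +%R)) ?conjc0// => x y; rewrite rmorphD.
Qed.

Section bounds.
Variables (L : R) (z : R * R).
Hypotheses (L1 : 1 <= L) (Dz : D z).
(** The height of [z] in units of the spacing [4 / sqrt L] between wave centres; [m] is the nearest
    index. *)
Let t := z.2 * Num.sqrt L / 4.
Let m := Num.trunc (t + 2^-1).

Let L0 : 0 < L. Proof. by apply: lt_le_trans L1. Qed.

Let s1 : 1 <= Num.sqrt L. Proof. by rewrite -sqrtr1 ler_wsqrtr. Qed.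

Let t0 : 0 <= t.
Proof.
have [_ _ y0 _] := open_square_coord Dz.
by rewrite divr_ge0// mulr_ge0// ?sqrtr_ge0// ltW.
Qed.

Let tm : `|t - m%:R| <= 2^-1.
Proof.
have h0 : 0 <= t + 2^-1 by rewrite addr_ge0.
have /andP[h1 h2] : m%:R <= t + 2^-1 < m.+1%:R by exact: trunc_itv.
by move: h2; rewrite -[m.+1%:R]natr1 ler_distl => h2; apply/andP; split; lra.
Qed.

Let m_lt : (m < (gcount L).*2)%N.
Proof.
have [_ _ _ y1] := open_square_coord Dz.
have ts : t <= Num.sqrt L / 4 by rewrite ler_pM2r// ler_piMl ?sqrtr_ge0// ltW.
have sg : Num.sqrt L < (gcount L)%:R by exact: truncnS_gt.
have : (m%:R : R) < (gcount L).*2%:R.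
  rewrite -muln2 natrM; move: tm s1 ts sg; rewrite ler_distl => /andP[+ _].
  by move: (m%:R : R) (Num.sqrt L) ((gcount L)%:R : R) t => a b c d; lra.
by rewrite ltr_nat.
Qed.

Let w0 : 0 < wt L z. Proof. exact: wt_gt0. Qed.

Let gB n : nc (gwave L n z) <= wt L z * (9 * 9^-1 ^+ ndist n m).
Proof. by rewrite nc_gwave// ler_pM2l//; exact: (gauss_near tm). Qed.

Let total : \sum_(0 <= n < (gcount L).*2) (9^-1 : R) ^+ ndist n m <= 4^-1 + 1.
Proof.
rewrite (bigD1_seq m) ?mem_index_iota ?iota_uniq ?m_lt//= addrC; apply: lerD.
  exact: two_sided_geometric.
by rewrite /ndist subnn expr0.
Qed.

(** Summing [gauss_near] over all indices gives [9 * (1 + 1/4)], rounded up to 12. *)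
Lemma hsum_le b : nc (hsum L b z) <= 12 * wt L z.
Proof.
apply: le_trans (nc_sum _ _ _) _; rewrite big_mkcond.
apply: (@le_trans _ _ (\sum_(0 <= n < (gcount L).*2) wt L z * (9 * 9^-1 ^+ ndist n m))).
  by apply: ler_sum => n _; case: ifP => // _; rewrite mulr_ge0 ?(ltW w0)// mulr_ge0// exprn_ge0// invr_ge0.
rewrite -mulr_sumr -mulr_sumr mulrC ler_pM2r//; have := total; lra.
Qed.

(** Differentiation costs [8 sqrt L * n], at most [32 L] because [n <= 4 sqrt L]; then
    [384 = 32 * 12]. *)
Lemma dhsum_le b : nc (dhsum L b z) <= 384 * L * wt L z.
Proof.
apply: le_trans (nc_sum _ _ _) _; rewrite big_mkcond.
apply: (@le_trans _ _ (\sum_(0 <= n < (gcount L).*2) (32 * L) * (wt L z * (9 * 9^-1 ^+ ndist n m)))).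
  apply: ler_sum_nat => n /andP[_ nN]; case: ifP => _; last first.
    by rewrite !mulr_ge0 ?(ltW w0) ?(ltW L0)// exprn_ge0.
  rewrite ncM nc_conj; apply: ler_pM; rewrite ?nc_ge0//.
  have n4 : (n%:R : R) <= 4 * Num.sqrt L.
    have : (n%:R : R) <= (gcount L).*2%:R by rewrite ler_nat ltnW.
    rewrite -muln2 natrM /gcount -natr1.
    have : (Num.trunc (Num.sqrt L))%:R <= Num.sqrt L by rewrite truncn_le ?sqrtr_ge0.
    have := s1; lra.
  rewrite [X in 32 * X](_ : L = Num.sqrt L * Num.sqrt L); last by rewrite -expr2 sqr_sqrtr// ltW.
  have n0 : (0 : R) <= n%:R by [].
  have s0 := sqrtr_ge0 L; move: n4 s0; move: (Num.sqrt L) => s n4 s0.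
  rewrite ncE/= expr0n/= add0r sqrtr_sqr ger0_norm ?mulr_ge0//.
  by have := ler_wpM2l s0 n4; nra.
rewrite -mulr_sumr -mulr_sumr -mulr_sumr.
have Lw : 0 <= 32 * L * wt L z by rewrite !mulr_ge0 ?(ltW w0) ?(ltW L0).
have := ler_wpM2l Lw total; move: (\sum_(_ <= _ < _) _) => S hS; lra.
Qed.

(* The wave centered nearest to z dominates the sum of the waves whose index has
   the same parity, hence the two sums have no approximate common zero. *)
Lemma hsum_ge : exists b, 3 / 4 * expR (- 4) * wt L z <= nc (hsum L b z).
Proof.
exists (odd m).
rewrite /hsum big_mkcond (bigD1_seq m) ?mem_index_iota ?iota_uniq ?m_lt// eqxx.
set X := gwave L m z; set Y := \sum_(_ <- _ | _) _.
have XY : nc Y <= 4^-1 * nc X.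
  apply: le_trans (nc_sum _ _ _) _.
  apply: (@le_trans _ _ (\sum_(0 <= n < (gcount L).*2 | n != m) 9^-1 ^+ ndist n m * nc X)).
    apply: ler_sum => n nm; case: ifP => [/eqP on|_]; last first.
      by rewrite nc0 mulr_ge0 ?nc_ge0// exprn_ge0// invr_ge0.
    rewrite /X !nc_gwave// [leRHS]mulrCA ler_pM2l// [leRHS]mulrC; apply: (gauss_far tm).
    (* Distinct indices of the same parity are at distance at least 2, as [gauss_far] requires. *)
    rewrite /ndist ltnNge; apply/negP => h.
    have : n = m.+1 \/ m = n.+1 by clear -nm h; move: (m : nat) nm h => k nm h; lia.
    case=> E; first by move: on; rewrite E /=; case: (odd m).
    by move: on; rewrite E /=; case: (odd n).
  by rewrite -mulr_suml ler_wpM2r ?nc_ge0// two_sided_geometric.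
(* The exponent is at most 4, since [16 (t-m)^2 <= 16/4]. *)
have X0 : expR (- 4) * wt L z <= nc X.
  rewrite nc_gwave// mulrC ler_pM2l// ler_expR lerN2.
  have := tm; rewrite -/t -(real_normK (num_real (t - _))); have := normr_ge0 (t - m%:R).
  by move: `|t - m%:R| => x x0 x2; nra.
change (3 / 4 * expR (- 4) * wt L z <= nc (X + Y)).
have := nc_dist_ge X (- Y); rewrite opprK ncN; lra.
Qed.

End bounds.
End lattice_sums.

(** * The fundamental matrix *)

Section weak_system.
Variable R : realType.
Local Notation C := R[i].
Local Notation D := (@open_square R).
Implicit Types (z w : R * R).

(** [mult_inv] requires values uniformly close to 1. A zero-free C^1 factor [m] may be used to reach
    that range, as [1/f = m / (m f)]. *)
Lemma mult_inv_scaled m mb f F (t : R) : CD m mb -> (forall z, m z != 0) -> mult f F ->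
  t < 1 -> (forall z, D z -> nc (1 - m z * f z) <= t) ->
  (forall z, D z -> f z != 0) /\ mult (fun z => (f z)^-1) (fun z => - F z / f z ^+ 2).
Proof.
move=> dm m0 mf t1 mft.
have f0 z : D z -> f z != 0.
  move=> Dz; apply: contraTneq t1 => fz; rewrite -leNgt.
  by apply: le_trans (mft z Dz); rewrite fz mulr0 subr0 nc1.
split; first exact: f0.
apply: mult_eq (mult_mul (mult_CD dm) (mult_inv (mult_mul (mult_CD dm) mf) t1 mft)) => z Dz.
  by field; rewrite m0 f0.
by field; rewrite m0 f0.
Qed.

Section columns.
Variables (L M k : R) (A : 'I_2 -> 'I_2 -> R * R -> C).
Hypotheses (L0 : 0 < L) (M0 : 0 <= M) (k2 : k <= 2^-1).
Hypothesis kE : dbar_inv_cst R / Num.sqrt L * (2 * M) <= k.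
Hypothesis mA : forall i j, cmeas D (A i j).
Hypothesis AM : forall i j z, D z -> nc (A i j z) <= M.

(** The column is [H + S F] for the fixed point [F] of [neumann_fixpoint] with [H = (h0, h1)]; 48 is
    [4 * B] with [B = 12]. *)
Lemma weak_column (h0 h1 : R * R -> C) : CD h0 (fun=> 0) -> CD h1 (fun=> 0) ->
  (forall z, D z -> nc (h0 z) <= 12 * wt L z) ->
  (forall z, D z -> nc (h1 z) <= 12 * wt L z) ->
  exists u0 u1,
  [/\ mult u0 (fun z => A 0 0 z * u0 z + A 0 1 z * u1 z),
      mult u1 (fun z => A 1 0 z * u0 z + A 1 1 z * u1 z),
      forall z, D z -> nc (u0 z - h0 z) <= 48 * k * wt L z &
      forall z, D z -> nc (u1 z - h1 z) <= 48 * k * wt L z].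
Proof.
move=> d0 d1 b0 b1.
pose H (i : 'I_2) := if i == 0 then h0 else h1.
have mH i : cmeas D (H i).
  by rewrite /H; case: ifP => _; apply: (ccont_mbdd _).1 => z; [exact: CD_cont d0|exact: CD_cont d1].
have HB i z : D z -> nc (H i z) <= 12 * wt L z.
  by move=> Dz; rewrite /H; case: ifP => _; [exact: b0|exact: b1].
have B0 : (0 : R) <= 12 by [].
have [F hF] := neumann_fixpoint L0 B0 M0 k2 kE mA AM mH HB.
have MB0 : 0 <= 8 * M * 12 by rewrite mulr_ge0// mulr_ge0.
pose u i z := H i z + dbar_inv L (F i) z.
have mu i : mult (u i) (fun z => A i 0 z * u 0 z + A i 1 z * u 1 z).
  have [mF bF fE _] := hF i.
  have dH : CD (H i) (fun=> 0) by rewrite /H; case: ifP.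
  apply: mult_eq (mult_add (mult_CD dH) (mult_dbar_inv L0 (mbdd_wt (ltW L0) MB0 mF bF))) => z Dz //.
  rewrite add0r fE// !big_ord_recl big_ord0 addr0.
  by rewrite (_ : lift ord0 ord0 = 1)//; apply/val_inj.
exists (u 0), (u 1); split => // z Dz.
  have [_ _ _ /(_ z Dz)] := hF 0.
  by rewrite (_ : u 0 z - h0 z = dbar_inv L (F 0) z) => [h|]; [apply: le_trans h _; lra|rewrite /u /H/=; ring].
have [_ _ _ /(_ z Dz)] := hF 1.
by rewrite (_ : u 1 z - h1 z = dbar_inv L (F 1) z) => [h|]; [apply: le_trans h _; lra|rewrite /u /H/=; ring].
Qed.

End columns.

(* The larger of the two lattice sums has a fourth power at least
   [wave_min * wt ^+ 4], and the sum of their fourth powers is at most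
   [wave_max * wt ^+ 4]. *)
Definition wave_min : R := (3 / 4 * expR (- 4)) ^+ 4.
Definition wave_max : R := 2 * 12 ^+ 4.
(** With columns within [e = 48 * small_ratio] of their models, the error [2 * 144 * 38 * e] of the
    denominator is exactly half of [wave_min]. *)
Definition small_ratio : R := wave_min / (2 * (2 * 144 * 38)) / 48.

Lemma wave_max_gt0 : 0 < wave_max. Proof. by rewrite mulr_gt0// exprn_gt0. Qed.

Lemma wave_maxV_ge0 : 0 <= wave_max^-1.
Proof. by rewrite invr_ge0 ltW// wave_max_gt0. Qed.

Lemma wave_min_gt0 : 0 < wave_min.
Proof. by rewrite exprn_gt0// mulr_gt0// ?expR_gt0. Qed.

Lemma wave_min_le1 : wave_min <= 1.
Proof.
have e0 := expR_ge0 (- 4 : R).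
have e1 : expR (- 4 : R) <= 1 by rewrite -expR0 ler_expR.
by rewrite exprn_ile1//; lra.
Qed.

Lemma small_ratio_gt0 : 0 < small_ratio.
Proof. by rewrite !divr_gt0// wave_min_gt0. Qed.

Lemma small_ratio_half : small_ratio <= 2^-1.
Proof. by have := wave_min_le1; rewrite /small_ratio; lra. Qed.

(* Algebraic part of the lower bound for the denominator: u, s, r are within
   [e] of (a, b), (0, a), (b, 0). *)
Lemma denominator_close (a b u0 u1 s0 s1 r0 r1 : C) (e w : R) : 0 <= e -> e <= 1 -> 0 <= w ->
  nc a <= 12 * w -> nc b <= 12 * w ->
  nc (u0 - a) <= e * w -> nc (u1 - b) <= e * w ->
  nc s0 <= e * w -> nc (s1 - a) <= e * w ->
  nc (r0 - b) <= e * w -> nc r1 <= e * w ->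
  nc (conjc a ^+ 2 * (u0 * s1 - u1 * s0) - conjc b ^+ 2 * (u0 * r1 - u1 * r0) -
      (nc a ^+ 4 + nc b ^+ 4)%:C) <= 2 * 144 * 38 * e * w ^+ 4.
Proof.
move=> e0 e1 w0 aw bw hu0 hu1 hs0 hs1 hr0 hr1.
have ew : e * w <= w by rewrite ler_piMl.
have ew0 : 0 <= e * w by rewrite mulr_ge0.
have u0w : nc u0 <= 13 * w.
  by rewrite -(subrK a u0); apply: le_trans (ncD _ _) _; lra.
have u1w : nc u1 <= 13 * w.
  by rewrite -(subrK b u1); apply: le_trans (ncD _ _) _; lra.
have sq (x : C) : (nc x ^+ 4)%:C = conjc x ^+ 2 * x ^+ 2.
  by rewrite -exprMn mulrC mulc_conj -rmorphXn/= -exprM.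
have -> : conjc a ^+ 2 * (u0 * s1 - u1 * s0) - conjc b ^+ 2 * (u0 * r1 - u1 * r0) -
    (nc a ^+ 4 + nc b ^+ 4)%:C =
  conjc a ^+ 2 * (u0 * (s1 - a) + (u0 - a) * a - u1 * s0) -
  conjc b ^+ 2 * (u0 * r1 - (u1 * (r0 - b) + (u1 - b) * b)).
  by rewrite rmorphD/= !sq; ring.
(* Three error products, each with one factor bounded by [e * w]; the other factors are at most
   [13 w], [12 w] and [13 w], and [13 + 12 + 13 = 38]. *)
have t1 : nc (u0 * (s1 - a) + (u0 - a) * a - u1 * s0) <= 38 * (w * (e * w)).
  apply: le_trans (ncB _ _) _; apply: le_trans (lerD (ncD _ _) (lexx _)) _; rewrite !ncM.
  have h1 := ler_pM (nc_ge0 _) (nc_ge0 _) u0w hs1.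
  have h2 := ler_pM (nc_ge0 _) (nc_ge0 _) hu0 aw.
  have h3 := ler_pM (nc_ge0 _) (nc_ge0 _) u1w hs0.
  by apply: le_trans (lerD (lerD h1 h2) h3) _; apply: eq_ler; ring.
have t2 : nc (u0 * r1 - (u1 * (r0 - b) + (u1 - b) * b)) <= 38 * (w * (e * w)).
  apply: le_trans (ncB _ _) _; apply: le_trans (lerD (lexx _) (ncD _ _)) _; rewrite !ncM.
  have h1 := ler_pM (nc_ge0 _) (nc_ge0 _) u0w hr1.
  have h2 := ler_pM (nc_ge0 _) (nc_ge0 _) u1w hr0.
  have h3 := ler_pM (nc_ge0 _) (nc_ge0 _) hu1 bw.
  by apply: le_trans (lerD h1 (lerD h2 h3)) _; apply: eq_ler; ring.
have sqw (x : C) : nc x <= 12 * w -> nc (conjc x ^+ 2) <= 144 * w ^+ 2.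
  move=> xw; rewrite ncX nc_conj (_ : 144 * w ^+ 2 = (12 * w) ^+ 2); last by ring.
  by rewrite lerXn2r ?nnegrE ?nc_ge0// mulr_ge0.
apply: le_trans (ncB _ _) _; rewrite ![nc (conjc _ ^+ 2 * _)]ncM.
have h1 := ler_pM (nc_ge0 _) (nc_ge0 _) (sqw a aw) t1.
have h2 := ler_pM (nc_ge0 _) (nc_ge0 _) (sqw b bw) t2.
by apply: le_trans (lerD h1 h2) _; apply: eq_ler; ring.
Qed.

(** As [z - conj(z) = 2i Im z], this equals [wt^-4]; the exponential form makes it C^1 and zero-free
    by the calculus of [CD]. *)
Definition inv_wt4 (L : R) z : C := cexp (L%:C * (pz z - conjc (pz z)) ^+ 2).

Lemma nc_inv_wt4 L z : inv_wt4 L z = ((wt L z ^+ 4)^-1)%:C.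
Proof.
have h : L%:C * (pz z - conjc (pz z)) ^+ 2 = (- (4 * (L * z.2 ^+ 2)))%:C.
  by apply: complex_eq; rewrite !cRI/=; ring.
rewrite /inv_wt4 h /cexp /= cos0 sin0 mulr1 mulr0 expRN; congr (_^-1 +i* _).
by rewrite /wt -expRM_natl.
Qed.

Lemma CD_inv_wt4 L : exists fb, CD (inv_wt4 L) fb.
Proof.
have d := CD_add (CD_pz R) (CD_opp (CD_conj_pz R)).
have d' := CD_cexp (CD_mul (CD_cst (L%:C : C)) (CD_mul d d)).
eexists; apply: (CD_eq d') => z; last by [].
by rewrite /inv_wt4 expr2.
Qed.

(** * The second column and its determinant with the first *)

Section glue.
Variables (L M e : R) (A : 'I_2 -> 'I_2 -> R * R -> C).
Variables (u0 u1 s0 s1 r0 r1 : R * R -> C).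
Hypotheses (L1 : 1 <= L) (M0 : 0 <= M) (e0 : 0 <= e) (eE : e <= 48 * small_ratio).
Hypothesis mA : forall i j, cmeas D (A i j).
Hypothesis AM : forall i j z, D z -> nc (A i j z) <= M.
Hypothesis mu0 : mult u0 (fun z => A 0 0 z * u0 z + A 0 1 z * u1 z).
Hypothesis mu1 : mult u1 (fun z => A 1 0 z * u0 z + A 1 1 z * u1 z).
Hypothesis ms0 : mult s0 (fun z => A 0 0 z * s0 z + A 0 1 z * s1 z).
Hypothesis ms1 : mult s1 (fun z => A 1 0 z * s0 z + A 1 1 z * s1 z).
Hypothesis mr0 : mult r0 (fun z => A 0 0 z * r0 z + A 0 1 z * r1 z).
Hypothesis mr1 : mult r1 (fun z => A 1 0 z * r0 z + A 1 1 z * r1 z).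
Let h0 := hsum L false.
Let h1 := hsum L true.
Hypothesis hu0 : forall z, D z -> nc (u0 z - h0 z) <= e * wt L z.
Hypothesis hu1 : forall z, D z -> nc (u1 z - h1 z) <= e * wt L z.
Hypothesis hs0 : forall z, D z -> nc (s0 z) <= e * wt L z.
Hypothesis hs1 : forall z, D z -> nc (s1 z - h0 z) <= e * wt L z.
Hypothesis hr0 : forall z, D z -> nc (r0 z - h1 z) <= e * wt L z.
Hypothesis hr1 : forall z, D z -> nc (r1 z) <= e * wt L z.

Let e1 : e <= 1.
Proof.
by apply: le_trans eE _; rewrite /small_ratio; have := wave_min_le1; lra.
Qed.

(** Since [d1 = det(u, s)] is close to [h0^2] and [d2 = det(u, r)] to [- h1^2], the coefficients [p]
    and [q] make [d] close to [|h0|^4 + |h1|^4], a positive quantity comparable to [wt^4]. Both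
    determinants satisfy Liouville's equation with the trace [T]. *)
Let p z : C := conjc (h0 z) ^+ 2.
Let q z : C := - conjc (h1 z) ^+ 2.
Let p' z : C := 2 * conjc (h0 z) * dhsum L false z.
Let q' z : C := - (2 * conjc (h1 z) * dhsum L true z).
Let d1 z : C := u0 z * s1 z - u1 z * s0 z.
Let d2 z : C := u0 z * r1 z - u1 z * r0 z.
Let d z : C := p z * d1 z + q z * d2 z.
Let T z : C := A 0 0 z + A 1 1 z.
Let scale z : C := (wave_max^-1)%:C * inv_wt4 L z.

Let mp : mult p p'.
Proof.
have h := mult_CD (CD_conj_hsum L false).
by apply: mult_eq (mult_mul h h) => z _; rewrite /p /p' ?expr2//; ring.
Qed.

Let mq : mult q q'.
Proof.
have h := mult_CD (CD_conj_hsum L true).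
by apply: mult_eq (mult_opp (mult_mul h h)) => z _; rewrite /q /q' ?expr2//; ring.
Qed.

Let md1 : mult d1 (fun z => T z * d1 z).
Proof.
apply: mult_eq (mult_add (mult_mul mu0 ms1) (mult_opp (mult_mul mu1 ms0))) => z _ //.
by rewrite /T /d1; ring.
Qed.

Let md2 : mult d2 (fun z => T z * d2 z).
Proof.
apply: mult_eq (mult_add (mult_mul mu0 mr1) (mult_opp (mult_mul mu1 mr0))) => z _ //.
by rewrite /T /d2; ring.
Qed.

Let md : mult d (fun z => p' z * d1 z + q' z * d2 z + T z * d z).
Proof.
apply: mult_eq (mult_add (mult_mul mp md1) (mult_mul mq md2)) => z _ //.
by rewrite /d; ring.
Qed.

Let h0B z : D z -> nc (h0 z) <= 12 * wt L z.
Proof. by move=> Dz; exact: (hsum_le L1 Dz). Qed.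

Let h1B z : D z -> nc (h1 z) <= 12 * wt L z.
Proof. by move=> Dz; exact: (hsum_le L1 Dz). Qed.

(** For [S = |h0|^4 + |h1|^4], the scaled value of [S] lies between [wave_min / wave_max] and 1;
    replacing [S] by [d] costs at most half of that lower bound. *)
Let d_close z : D z -> nc (1 - scale z * d z) <= 1 - wave_min / wave_max / 2.
Proof.
move=> Dz; have w0 := wt_gt0 L z.
have close := denominator_close e0 e1 (ltW w0) (h0B Dz) (h1B Dz) (hu0 Dz) (hu1 Dz)
  (hs0 Dz) (hs1 Dz) (hr0 Dz) (hr1 Dz).
set S := nc (h0 z) ^+ 4 + nc (h1 z) ^+ 4 in close.
have -> : 1 - scale z * d z = (1 - scale z * S%:C) - scale z * (conjc (h0 z) ^+ 2 * d1 z -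
    conjc (h1 z) ^+ 2 * d2 z - S%:C).
  by rewrite /d /p /q; ring.
apply: le_trans (ncB _ _) _.
have w4 : 0 < wt L z ^+ 4 by rewrite exprn_gt0.
have sE : scale z = (wave_max^-1 / wt L z ^+ 4)%:C.
  by rewrite /scale nc_inv_wt4 -rmorphM.
rewrite ncM sE nc_real ger0_norm; last by rewrite mulr_ge0 ?wave_maxV_ge0// invr_ge0 ltW.
have S1 : wave_min * wt L z ^+ 4 <= S.
  have n0 (x : C) : 0 <= nc x ^+ 4 by rewrite exprn_ge0 ?nc_ge0.
  have c0 : 0 <= 3 / 4 * expR (- 4) * wt L z by rewrite mulr_ge0 ?(ltW w0)// mulr_ge0 ?expR_ge0.
  rewrite /wave_min -exprMn /S; have [b hb] := hsum_ge L1 Dz.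
  have := lerXn2r 4 c0 (nc_ge0 _) hb.
  by case: b {hb} => h; [have := n0 (h0 z)|have := n0 (h1 z)]; rewrite /h0 /h1; lra.
have S2 : S <= wave_max * wt L z ^+ 4.
  have n4 (x : C) : nc x <= 12 * wt L z -> nc x ^+ 4 <= 12 ^+ 4 * wt L z ^+ 4.
    move=> h; rewrite (_ : 12 ^+ 4 * _ = (12 * wt L z) ^+ 4); last by ring.
    by rewrite lerXn2r ?nnegrE ?nc_ge0// mulr_ge0// ltW.
  by have := n4 _ (h0B Dz); have := n4 _ (h1B Dz); rewrite /S /wave_max; move: (12 ^+ 4) => c; lra.
have -> : 1 - (wave_max^-1 / wt L z ^+ 4)%:C * S%:C = (1 - S / (wave_max * wt L z ^+ 4))%:C :> C.
  rewrite rmorphB rmorph1 -rmorphM; congr (1 - _%:C).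
  have wm := lt0r_neq0 wave_max_gt0; have wn := lt0r_neq0 w0.
  by field; rewrite wm wn.
have mw : 0 < wave_max * wt L z ^+ 4 := mulr_gt0 wave_max_gt0 w4.
rewrite nc_real ger0_norm; last by rewrite subr_ge0 ler_pdivrMr// mul1r.
have a1 : wave_min / wave_max <= S / (wave_max * wt L z ^+ 4).
  rewrite ler_pdivlMr// mulrA divfK//; exact: lt0r_neq0 wave_max_gt0.
have a2 : wave_max^-1 / wt L z ^+ 4 * nc (conjc (h0 z) ^+ 2 * d1 z - conjc (h1 z) ^+ 2 * d2 z - S%:C)
   <= wave_max^-1 * (2 * 144 * 38 * e).
  apply: le_trans (ler_wpM2l _ close) _; first by rewrite mulr_ge0 ?wave_maxV_ge0// invr_ge0 ltW.
  have wm := lt0r_neq0 wave_max_gt0; have wn := lt0r_neq0 w0.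
  by apply: eq_ler; field; rewrite wm wn.
have a3 : wave_max^-1 * (2 * 144 * 38 * e) <= wave_min / wave_max / 2.
  rewrite [leRHS]mulrAC [leRHS]mulrC; apply: ler_wpM2l wave_maxV_ge0 _ _ _.
  by have := eE; rewrite /small_ratio; lra.
lra.
Qed.

Let dI : (forall z, D z -> d z != 0) /\
  mult (fun z => (d z)^-1) (fun z => - (p' z * d1 z + q' z * d2 z + T z * d z) / d z ^+ 2).
Proof.
have [fb dfb] := CD_inv_wt4 L.
apply: (mult_inv_scaled (CD_mul (CD_cst ((wave_max^-1)%:C : C)) dfb) _ md _ d_close) => [z|].
  apply: mulf_neq0; last exact: cexp_neq0.
  by rewrite -nc_eq0 nc_real normr_eq0 invr_eq0 gt_eqF// wave_max_gt0.
have h : 0 < wave_min / wave_max / 2.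
  by apply: divr_gt0 => //; exact: divr_gt0 wave_min_gt0 wave_max_gt0.
by move: h; move: (_ / 2) => x; lra.
Qed.

Let dI_bound z : D z -> nc (d z)^-1 <= 2 / wave_min / wt L z ^+ 4.
Proof.
move=> Dz; have w0 := wt_gt0 L z; have w4 : 0 < wt L z ^+ 4 by rewrite exprn_gt0.
have m0 := wave_min_gt0.
have := d_close Dz; have := nc_dist_ge 1 (1 - scale z * d z); rewrite subKr nc1 ncM.
have -> : nc (scale z) = wave_max^-1 / wt L z ^+ 4.
  by rewrite /scale nc_inv_wt4 -rmorphM nc_real ger0_norm// mulr_ge0 ?wave_maxV_ge0// invr_ge0 ltW.
move=> h1' h2'.
have h : wave_min / wave_max / 2 <= wave_max^-1 / wt L z ^+ 4 * nc (d z) by lra.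
have n0 : 0 < nc (d z) by rewrite nc_gt0 dI.1.
rewrite ncV; move: h m0 wave_max_gt0; move: wave_min wave_max (nc (d z)) n0 => a b x x0 h a0 b0.
rewrite -[leRHS]invrK lef_pV2 ?posrE// ?invr_gt0 ?divr_gt0//.
have wn := lt0r_neq0 w0; have an := lt0r_neq0 a0; have bn := lt0r_neq0 b0.
rewrite (_ : (2 / a / wt L z ^+ 4)^-1 = b * wt L z ^+ 4 * (a / b / 2)); last first.
  by field; rewrite an bn wn.
rewrite (_ : x = b * wt L z ^+ 4 * (b^-1 / wt L z ^+ 4 * x)); last by field; rewrite bn wn.
by rewrite ler_wpM2l// ltW// mulr_gt0.
Qed.

Let E z : C := cexp (dbar_inv 1 T z).

Let mT : mbdd T.
Proof.
split; first exact: cmeasD.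
by exists (M + M) => z Dz; apply: le_trans (ncD _ _) _; rewrite lerD// AM.
Qed.

Let mE : mult E (fun z => E z * T z).
Proof. exact: mult_cexp (mult_dbar_inv ltr01 mT). Qed.

Definition exp_growth : R := 2 * expR 1 * dbar_inv_cst R.

Let wt1 z : D z -> 1 <= wt 1 z /\ wt 1 z <= expR 1.
Proof. by move=> Dz; exact: wt_bounds. Qed.

Let dbar_inv1_bound F (B : R) z : D z -> 0 <= B -> cmeas D F -> (forall w, D w -> nc (F w) <= B) ->
  nc (dbar_inv 1 F z) <= dbar_inv_cst R * expR 1 * B.
Proof.
move=> Dz B0 mF FB.
have FB' w : D w -> nc (F w) <= B * wt 1 w.
  by move=> Dw; apply: le_trans (FB w Dw) _; rewrite ler_peMr//; exact: (wt1 Dw).1.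
apply: le_trans (dbar_inv_bound z ltr01 B0 mF FB').2 _.
rewrite sqrtr1 divr1 -mulrA ler_wpM2l ?(ltW (dbar_inv_cst_gt0 R))//.
by rewrite mulrC ler_wpM2r//; exact: (wt1 Dz).2.
Qed.

Let tau_bound z : D z -> nc (dbar_inv 1 T z) <= exp_growth * M.
Proof.
move=> Dz; have h : nc (dbar_inv 1 T z) <= dbar_inv_cst R * expR 1 * (2 * M).
  apply: dbar_inv1_bound => //; [exact: mulr_ge0|exact: mT.1|].
  by move=> w Dw; apply: le_trans (ncD _ _) _; have := AM 0 0 Dw; have := AM 1 1 Dw; lra.
by apply: le_trans h _; rewrite /exp_growth; apply: eq_ler; ring.
Qed.

Let EB z : D z -> nc (E z) <= expR (exp_growth * M).
Proof.
move=> Dz; rewrite nc_cexp ler_expR; apply: le_trans (tau_bound Dz).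
by apply: le_trans (abs_cRe _); exact: ler_norm.
Qed.

Let EVB z : D z -> nc (E z)^-1 <= expR (exp_growth * M).
Proof.
move=> Dz; rewrite -cexpN nc_cexp ler_expR cReN; apply: le_trans (tau_bound Dz).
by apply: le_trans (abs_cRe _); rewrite -normrN; exact: ler_norm.
Qed.

(* a1 s + a2 r has determinant E with u, but solves the system only up to a
   multiple of u, which is then removed with the d-bar inverse. *)
Let a1 z : C := E z * p z / d z.
Let a2 z : C := E z * q z / d z.
Let W z : C := p' z * q z - p z * q' z.
Let om z : C := s0 z * r1 z - s1 z * r0 z.

(** The trace terms of [E] and [d] cancel, and [p' d - p (p' d1 + q' d2) = d2 W]. *)
Let ma1 : mult a1 (fun z => E z / d z ^+ 2 * d2 z * W z).
Proof.
apply: mult_eq (mult_mul (mult_mul mE mp) dI.2) => z Dz //.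
have := dI.1 z Dz; rewrite /d /W => h; by field.
Qed.

Let ma2 : mult a2 (fun z => - (E z / d z ^+ 2 * d1 z * W z)).
Proof.
apply: mult_eq (mult_mul (mult_mul mE mq) dI.2) => z Dz //.
have := dI.1 z Dz; rewrite /d /W => h; by field.
Qed.

(** The defect of [a1 s + a2 r] is [E W / d^2] times [d2 s - d1 r], and Cramer's identity gives
    [d2 s - d1 r = det(s, r) u = om u]. *)
Let beta z : C := E z / d z ^+ 2 * W z * om z.

Let v0 z : C := a1 z * s0 z + a2 z * r0 z.
Let v1 z : C := a1 z * s1 z + a2 z * r1 z.

Let mv0 : mult v0 (fun z => A 0 0 z * v0 z + A 0 1 z * v1 z + beta z * u0 z).
Proof.
apply: mult_eq (mult_add (mult_mul ma1 ms0) (mult_mul ma2 mr0)) => z Dz //.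
by rewrite /v0 /v1 /beta /om /d1 /d2; ring.
Qed.

Let mv1 : mult v1 (fun z => A 1 0 z * v0 z + A 1 1 z * v1 z + beta z * u1 z).
Proof.
apply: mult_eq (mult_add (mult_mul ma1 ms1) (mult_mul ma2 mr1)) => z Dz //.
by rewrite /v0 /v1 /beta /om /d1 /d2; ring.
Qed.

Let bbeta : mbdd beta.
Proof.
have bd (f F : R * R -> C) : mult f F -> mbdd f /\ mbdd F by case=> [[_ ? ?] _].
have [bE _] := bd _ _ mE; have [bI _] := bd _ _ dI.2.
have [bp bp'] := bd _ _ mp; have [bq bq'] := bd _ _ mq.
have [bs0 _] := bd _ _ ms0; have [bs1 _] := bd _ _ ms1.
have [br0 _] := bd _ _ mr0; have [br1 _] := bd _ _ mr1.
have bW : mbdd W by apply: mbddD; [exact: mbddM|apply: mbddN; exact: mbddM].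
have bom : mbdd om by apply: mbddD; [exact: mbddM|apply: mbddN; exact: mbddM].
apply: mbdd_eq (mbddM (mbddM (mbddM bE (mbddM bI bI)) bW) bom) => z Dz.
by rewrite /beta expr2 invfM.
Qed.

(** As [dbar gam = beta], subtracting [gam u] cancels the defect; a multiple of [u] does not change
    the determinant with [u]. *)
Let gam z : C := dbar_inv 1 beta z.
Let v0' z : C := v0 z - gam z * u0 z.
Let v1' z : C := v1 z - gam z * u1 z.

Let mgam : mult gam beta. Proof. exact: mult_dbar_inv ltr01 bbeta. Qed.

Let mv0' : mult v0' (fun z => A 0 0 z * v0' z + A 0 1 z * v1' z).
Proof.
apply: mult_eq (mult_add mv0 (mult_opp (mult_mul mgam mu0))) => z Dz //.
by rewrite /v0' /v1'; ring.
Qed.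

Let mv1' : mult v1' (fun z => A 1 0 z * v0' z + A 1 1 z * v1' z).
Proof.
apply: mult_eq (mult_add mv1 (mult_opp (mult_mul mgam mu1))) => z Dz //.
by rewrite /v0' /v1'; ring.
Qed.

Let detE z : D z -> u0 z * v1' z - u1 z * v0' z = E z.
Proof.
move=> Dz; have := dI.1 z Dz; rewrite /v0' /v1' /v0 /v1 /a1 /a2 => dz.
transitivity (E z * d z / d z); first by rewrite /d /d1 /d2; ring.
by rewrite mulfK.
Qed.

Let Q : R := 2 / wave_min.
(** The factors bound [W], [om] (with [338 = 2 * 13^2]) and [1/d^2], up to powers of the weight. *)
Definition beta_cst : R := (2 * (24 * 384) * 144 * 338) * (2 / wave_min) ^+ 2.
Lemma beta_cst_ge0 : 0 <= beta_cst.
Proof. by rewrite mulr_ge0 ?sqr_ge0 ?mulr_ge0 ?ler0n. Qed.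

Definition entry_cst : R := 13 + 2 * 144 * 13 * (2 / wave_min) +
  13 * (dbar_inv_cst R * expR 1 * beta_cst).

Let Q0 : 0 < Q. Proof. by rewrite divr_gt0// wave_min_gt0. Qed.

Let near_bound (x y : C) z : nc (x - y) <= e * wt L z -> nc y <= 12 * wt L z -> nc x <= 13 * wt L z.
Proof.
move=> h h'; have w0 := wt_gt0 L z; have e1' := e1.
have : e * wt L z <= wt L z by rewrite ler_piMl// ltW.
by rewrite -(subrK y x) => h2; apply: le_trans (ncD _ _) _; lra.
Qed.

Let col_bound z : D z -> [/\ nc (u0 z) <= 13 * wt L z, nc (u1 z) <= 13 * wt L z,
  nc (s0 z) <= 13 * wt L z, nc (s1 z) <= 13 * wt L z &
  nc (r0 z) <= 13 * wt L z /\ nc (r1 z) <= 13 * wt L z].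
Proof.
move=> Dz; have w0 := wt_gt0 L z.
have z0 : nc (0 : C) <= 12 * wt L z by rewrite nc0 mulr_ge0// ltW.
split; [exact: near_bound (hu0 Dz) (h0B Dz)|exact: near_bound (hu1 Dz) (h1B Dz)| |
  exact: near_bound (hs1 Dz) (h0B Dz)|split].
- by apply: near_bound z0; rewrite subr0 hs0.
- exact: near_bound (hr0 Dz) (h1B Dz).
- by apply: near_bound z0; rewrite subr0 hr1.
Qed.

Let pq_bound z : D z -> [/\ nc (p z) <= 144 * wt L z ^+ 2, nc (q z) <= 144 * wt L z ^+ 2,
  nc (p' z) <= 24 * 384 * L * wt L z ^+ 2 & nc (q' z) <= 24 * 384 * L * wt L z ^+ 2].
Proof.
move=> Dz; have w0 := wt_gt0 L z.
have sqw (x : C) : nc x <= 12 * wt L z -> nc (conjc x ^+ 2) <= 144 * wt L z ^+ 2.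
  move=> xw; rewrite ncX nc_conj (_ : 144 * wt L z ^+ 2 = (12 * wt L z) ^+ 2); last by ring.
  by rewrite lerXn2r ?nnegrE ?nc_ge0// mulr_ge0// ltW.
have prw (x y : C) : nc x <= 12 * wt L z -> nc y <= 384 * L * wt L z ->
    nc (2 * conjc x * y) <= 24 * 384 * L * wt L z ^+ 2.
  move=> hx hy; rewrite -mulrA ncM [nc (conjc x * _)]ncM nc_conj.
  rewrite (nc_nat R 2).
  apply: le_trans (ler_wpM2l _ (ler_pM (nc_ge0 _) (nc_ge0 _) hx hy)) _ => //.
  by apply: eq_ler; ring.
split; rewrite ?ncN; [exact: sqw (h0B Dz)|exact: sqw (h1B Dz)| |].
- exact: prw (h0B Dz) (dhsum_le L1 Dz _).
- exact: prw (h1B Dz) (dhsum_le L1 Dz _).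
Qed.

Let a_bound z : D z -> nc (a1 z) <= 144 * Q * expR (exp_growth * M) /\
  nc (a2 z) <= 144 * Q * expR (exp_growth * M).
Proof.
move=> Dz; have [hp hq _ _] := pq_bound Dz.
have [w1 _] := wt_bounds (le_trans ler01 L1) Dz.
have main (x : C) : nc x <= 144 * wt L z ^+ 2 ->
    nc (E z * x / d z) <= 144 * Q * expR (exp_growth * M).
  move=> hx; rewrite !ncM.
  have h := ler_pM (mulr_ge0 (nc_ge0 _) (nc_ge0 _)) (nc_ge0 _)
    (ler_pM (nc_ge0 _) (nc_ge0 _) (EB Dz) hx) (dI_bound Dz).
  apply: le_trans h _.
  rewrite -/Q [leLHS](_ : _ = 144 * Q * expR (exp_growth * M) * (wt L z ^+ 2)^-1); last first.
    by field; rewrite gt_eqF// wt_gt0.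
  rewrite ler_piMr//; first by rewrite mulr_ge0 ?expR_ge0// mulr_ge0// ltW.
  by rewrite invf_le1 ?exprn_gt0 ?wt_gt0// exprn_ege1.
by split; exact: main.
Qed.

(** The powers of the weight are 4 from [W], 2 from [om] and -8 from [1/d^2]. The total is negative
    and the weight is at least 1, so [beta] is bounded without any weight and only one factor [L]
    remains, from the derivatives of the conjugated sums. *)
Let beta_bound z : D z -> nc (beta z) <= beta_cst * expR (exp_growth * M) * L.
Proof.
move=> Dz; have [hp hq hp' hq'] := pq_bound Dz; have [_ _ hs hs' [hr hr']] := col_bound Dz.
have [w1 _] := wt_bounds (le_trans ler01 L1) Dz.
have w0 := wt_gt0 L z.
have hW : nc (W z) <= 2 * (24 * 384) * 144 * L * wt L z ^+ 4.
  apply: le_trans (ncB _ _) _; rewrite [nc (p' z * q z)]ncM [nc (p z * q' z)]ncM.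
  apply: le_trans (lerD (ler_pM (nc_ge0 _) (nc_ge0 _) hp' hq) (ler_pM (nc_ge0 _) (nc_ge0 _) hp hq')) _.
  by apply: eq_ler; ring.
have hom : nc (om z) <= 338 * wt L z ^+ 2.
  apply: le_trans (ncB _ _) _; rewrite !ncM.
  apply: le_trans (lerD (ler_pM (nc_ge0 _) (nc_ge0 _) hs hr') (ler_pM (nc_ge0 _) (nc_ge0 _) hs' hr)) _.
  by apply: eq_ler; ring.
have hI : nc (d z ^+ 2)^-1 <= (Q / wt L z ^+ 4) ^+ 2.
  rewrite -exprVn ncX lerXn2r ?nnegrE ?nc_ge0//; last exact: dI_bound.
  by rewrite divr_ge0 ?exprn_ge0 ?ltW.
rewrite /beta !ncM.
have h := ler_pM (mulr_ge0 (mulr_ge0 (nc_ge0 _) (nc_ge0 _)) (nc_ge0 _)) (nc_ge0 _)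
  (ler_pM (mulr_ge0 (nc_ge0 _) (nc_ge0 _)) (nc_ge0 _)
    (ler_pM (nc_ge0 _) (nc_ge0 _) (EB Dz) hI) hW) hom.
apply: le_trans h _.
rewrite [leLHS](_ : _ = beta_cst * expR (exp_growth * M) * L * (wt L z ^+ 2)^-1); last first.
  by rewrite /beta_cst -/Q; field; rewrite gt_eqF.
rewrite ler_piMr//; last by rewrite invf_le1 ?exprn_gt0// exprn_ege1.
have := L1; have := expR_ge0 (exp_growth * M); have := beta_cst_ge0.
by move=> b0 x0 l1; apply: mulr_ge0; [exact: mulr_ge0|lra].
Qed.

Let v_bound z : D z -> nc (v0' z) <= entry_cst * expR (exp_growth * M) * expR (2 * L) /\
  nc (v1' z) <= entry_cst * expR (exp_growth * M) * expR (2 * L).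
Proof.
move=> Dz; have [ha1 ha2] := a_bound Dz; have [hu hu' hs hs' [hr hr']] := col_bound Dz.
have [w1 w2] := wt_bounds (le_trans ler01 L1) Dz.
have w0 := wt_gt0 L z; have L1' := L1; have L0 : 0 <= L by lra.
have EM0 := expR_gt0 (exp_growth * M).
have bc0 := beta_cst_ge0.
have hb := beta_bound.
have B0 : 0 <= beta_cst * expR (exp_growth * M) * L by rewrite mulr_ge0// mulr_ge0// ltW.
have hg : nc (gam z) <= dbar_inv_cst R * expR 1 * (beta_cst * expR (exp_growth * M) * L).
  exact: (dbar_inv1_bound Dz B0 bbeta.1 beta_bound).
(* Both [L] and the weight are at most [exp L]. *)
have Lw : L * wt L z <= expR (2 * L).
  rewrite (_ : 2 * L = L + L); last by ring.
  rewrite expRD; apply: ler_pM => //; first exact: ltW.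
  by apply: le_trans (expR_ge1Dx _); lra.
have ww : wt L z <= L * wt L z by rewrite ler_peMl// ltW.
have main (x y v u : C) : nc x <= 13 * wt L z -> nc y <= 13 * wt L z -> nc u <= 13 * wt L z ->
    nc (a1 z * x + a2 z * y - gam z * u) <= entry_cst * expR (exp_growth * M) * expR (2 * L).
  move=> hx hy hu2; apply: le_trans (ncB _ _) _.
  apply: le_trans (lerD (ncD _ _) (lexx _)) _.
  rewrite [nc (a1 z * x)]ncM [nc (a2 z * y)]ncM [nc (gam z * u)]ncM.
  apply: le_trans (lerD (lerD (ler_pM (nc_ge0 _) (nc_ge0 _) ha1 hx) (ler_pM (nc_ge0 _) (nc_ge0 _) ha2 hy))
    (ler_pM (nc_ge0 _) (nc_ge0 _) hg hu2)) _.
  apply: (@le_trans _ _ ((entry_cst - 13) * expR (exp_growth * M) * (L * wt L z))).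
    rewrite /entry_cst -/Q.
    have : 0 <= 2 * 144 * 13 * Q * expR (exp_growth * M) by rewrite mulr_ge0 ?(ltW EM0)// mulr_ge0// ltW.
    by move=> k0; have := ler_wpM2l k0 ww; lra.
  have ec0 : 0 <= entry_cst - 13.
    rewrite /entry_cst -/Q; have := Q0; have := dbar_inv_cst_gt0 R; have := expR_ge0 (1 : R).
    move=> x0 /ltW y0 z0; have := mulr_ge0 (mulr_ge0 y0 x0) bc0; lra.
  apply: (@le_trans _ _ ((entry_cst - 13) * expR (exp_growth * M) * expR (2 * L))).
    by rewrite ler_wpM2l// mulr_ge0// ltW.
  by rewrite ler_wpM2r ?expR_ge0// ler_wpM2r ?expR_ge0//; lra.
by split; exact: main.
Qed.

Let u_bound z : D z -> nc (u0 z) <= entry_cst * expR (exp_growth * M) * expR (2 * L) /\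
  nc (u1 z) <= entry_cst * expR (exp_growth * M) * expR (2 * L).
Proof.
move=> Dz; have [hu hu' _ _ _] := col_bound Dz.
have [w1 w2] := wt_bounds (le_trans ler01 L1) Dz.
have L1' := L1.
suff h : 13 * wt L z <= entry_cst * expR (exp_growth * M) * expR (2 * L).
  by split; exact: le_trans h.
have E1 : 1 <= expR (exp_growth * M).
  rewrite -expR0 ler_expR /exp_growth; apply: mulr_ge0 => //.
  apply: mulr_ge0; last exact: ltW (dbar_inv_cst_gt0 R).
  by apply: mulr_ge0 => //; exact: expR_ge0.
have ec : 13 <= entry_cst.
  rewrite /entry_cst -/Q; have := Q0; have := dbar_inv_cst_gt0 R; have := expR_ge0 (1 : R).
  have bc0 := beta_cst_ge0.
  move=> x0 /ltW y0 z0; have := mulr_ge0 (mulr_ge0 y0 x0) bc0; lra.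
rewrite -[leLHS]mulr1 -[13 * _ * 1]mulrA [wt _ _ * 1]mulrC mulrA; apply: ler_pM => //.
- exact: ltW (wt_gt0 _ _).
- by apply: ler_pM.
- by apply: le_trans w2 _; rewrite ler_expR; lra.
Qed.

Lemma weak_fundamental : exists v0 v1 E,
  [/\ mult v0 (fun z => A 0 0 z * v0 z + A 0 1 z * v1 z),
      mult v1 (fun z => A 1 0 z * v0 z + A 1 1 z * v1 z),
      forall z, D z -> u0 z * v1 z - u1 z * v0 z = E z,
      forall z, E z != 0 /\ (D z -> nc (E z)^-1 <= expR (exp_growth * M)) &
      forall z, D z -> let K := entry_cst * expR (exp_growth * M) * expR (2 * L) in
        [/\ nc (u0 z) <= K, nc (u1 z) <= K, nc (v0 z) <= K & nc (v1 z) <= K]].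
Proof.
exists v0', v1', E; split => //.
- by move=> z; split; [exact: cexp_neq0|exact: EVB].
- by move=> z Dz K; split; [exact: (u_bound Dz).1|exact: (u_bound Dz).2|
    exact: (v_bound Dz).1|exact: (v_bound Dz).2].
Qed.

End glue.
End weak_system.

(** * The bounded measurable case *)

Section solution.
Variable R : realType.
Local Notation C := R[i].
Local Notation mu := (leb2 R).
Local Notation D := (@open_square R).
Implicit Types (z w : R * R).

(** The three terms are exponents for the three factors of the entry bound: [entry_cst] itself,
    [expR (exp_growth * M)], and [expR (2 * L)] with [L = K^2 (M^2 + 1)]. *)
Definition growth_cst : R :=
  entry_cst R + exp_growth R + 2 * (1 + 2 * dbar_inv_cst R / small_ratio R) ^+ 2.

Lemma entry_cst_ge0 : 0 <= entry_cst R.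
Proof.
have Q0 : 0 <= 2 / wave_min R by rewrite divr_ge0// ltW// wave_min_gt0.
have x0 : 0 <= dbar_inv_cst R * expR 1 * beta_cst R.
  by rewrite mulr_ge0 ?beta_cst_ge0// mulr_ge0 ?expR_ge0// ltW// dbar_inv_cst_gt0.
rewrite /entry_cst; move: (2 / wave_min R) (_ * beta_cst R) Q0 x0 => a b a0 b0; lra.
Qed.

Lemma exp_growth_ge0 : 0 <= exp_growth R.
Proof.
rewrite /exp_growth; apply: mulr_ge0; last exact: ltW (dbar_inv_cst_gt0 R).
by apply: mulr_ge0 => //; exact: expR_ge0.
Qed.

Lemma growth_cst_ge0 : 0 <= growth_cst.
Proof.
have h : 0 <= (1 + 2 * dbar_inv_cst R / small_ratio R) ^+ 2 by exact: sqr_ge0.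
have h1 := entry_cst_ge0; have h2 := exp_growth_ge0.
by rewrite /growth_cst; apply: addr_ge0; [exact: addr_ge0|exact: mulr_ge0].
Qed.

Lemma fundamental_solution (A : 'I_2 -> 'I_2 -> R * R -> C) (M : R) : 0 <= M ->
  (forall i j, cmeas D (A i j)) -> (forall i j z, D z -> nc (A i j z) <= M) ->
  exists u0 u1 v0 v1 E : R * R -> C, let Y := expR (growth_cst * (M ^+ 2 + 1)) in
  [/\ mult u0 (fun z => A 0 0 z * u0 z + A 0 1 z * u1 z),
      mult u1 (fun z => A 1 0 z * u0 z + A 1 1 z * u1 z),
      mult v0 (fun z => A 0 0 z * v0 z + A 0 1 z * v1 z),
      mult v1 (fun z => A 1 0 z * v0 z + A 1 1 z * v1 z) &
      forall z, D z -> [/\ u0 z * v1 z - u1 z * v0 z = E z, E z != 0, nc (E z)^-1 <= Y &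
        [/\ nc (u0 z) <= Y, nc (u1 z) <= Y, nc (v0 z) <= Y & nc (v1 z) <= Y]]].
Proof.
move=> M0 mA AM.
have c0 := dbar_inv_cst_gt0 R; have s0 := small_ratio_gt0 R; have sh := small_ratio_half R.
set K : R := 1 + 2 * dbar_inv_cst R / small_ratio R.
have K1 : 1 <= K by rewrite /K lerDl divr_ge0 ?(ltW s0)// mulr_ge0// ltW.
(* [sqrt L >= K * M] brings the contraction ratio below [small_ratio]; the added 1 keeps [L >= 1]
   for small [M], as the lattice sums demand. *)
set L : R := K ^+ 2 * (M ^+ 2 + 1).
have M2 := sqr_ge0 M.
have L1 : 1 <= L.
  by rewrite /L -[leLHS]mulr1; apply: ler_pM => //; [rewrite expr_ge1//; lra|lra].
have L0 : 0 < L by lra.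
have sL : K * M <= Num.sqrt L.
  have KM0 : 0 <= K * M by rewrite mulr_ge0//; lra.
  rewrite -(ger0_norm KM0) -sqrtr_sqr; apply: ler_wsqrtr.
  by rewrite /L exprMn ler_wpM2l ?sqr_ge0//; lra.
have sL0 : 0 < Num.sqrt L by rewrite sqrtr_gt0.
have kE : dbar_inv_cst R / Num.sqrt L * (2 * M) <= small_ratio R.
  rewrite mulrAC ler_pdivrMr//; apply: (@le_trans _ _ (small_ratio R * (K * M))); last first.
    by rewrite ler_wpM2l// ltW.
  rewrite mulrA [dbar_inv_cst R * _]mulrA; apply: ler_wpM2r => //.
  have gen (a b : R) : 0 < a -> b * 2 <= a * (1 + 2 * b / a).
    move=> a0; rewrite (_ : a * (1 + 2 * b / a) = a + 2 * b); first lra.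
    by field; rewrite gt_eqF.
  exact: gen.
have hc b : CD (hsum L b) (fun=> 0) by exact: CD_hsum.
have zc : CD (fun=> 0 : C) (fun=> 0) by exact: CD_cst.
have hb b z : D z -> nc (hsum L b z) <= 12 * wt L z by move=> Dz; exact: hsum_le.
have zb z : D z -> nc (0 : C) <= 12 * wt L z by move=> _; rewrite nc0 mulr_ge0// ltW// wt_gt0.
have col h0 h1 := weak_column L0 M0 sh kE mA AM (h0 := h0) (h1 := h1).
have [u0 [u1 [mu0 mu1 hu0 hu1]]] := col _ _ (hc false) (hc true) (hb false) (hb true).
have [s0' [s1' [ms0 ms1 hs0 hs1]]] := col _ _ zc (hc false) zb (hb false).
have [r0 [r1 [mr0 mr1 hr0 hr1]]] := col _ _ (hc true) zc (hb true) zb.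
have e0 : 0 <= 48 * small_ratio R by rewrite mulr_ge0// ltW.
have hs0' z : D z -> nc (s0' z) <= 48 * small_ratio R * wt L z.
  by move=> Dz; rewrite -[s0' z]subr0; exact: hs0.
have hr1' z : D z -> nc (r1 z) <= 48 * small_ratio R * wt L z.
  by move=> Dz; rewrite -[r1 z]subr0; exact: hr1.
have [v0 [v1 [E [mv0 mv1 dE E0 bnd]]]] := weak_fundamental L1 M0 e0 (lexx _) mA AM mu0 mu1 ms0 ms1
  mr0 mr1 hu0 hu1 hs0' hs1 hr0 hr1'.
exists u0, u1, v0, v1, E => Y; split => // z Dz.
have g0 := exp_growth_ge0; have c0' := entry_cst_ge0.
have MM : M <= M ^+ 2 + 1 by have := sqr_ge0 (M - 1); nra.
have gM : exp_growth R * M <= exp_growth R * (M ^+ 2 + 1) by rewrite ler_wpM2l.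
have KK : 0 <= K ^+ 2 by exact: sqr_ge0.
have cM : entry_cst R <= entry_cst R * (M ^+ 2 + 1) by rewrite ler_peMr//; lra.
have YE : growth_cst * (M ^+ 2 + 1) = entry_cst R * (M ^+ 2 + 1) +
    exp_growth R * (M ^+ 2 + 1) + 2 * L.
  by rewrite /growth_cst -/K /L; move: (entry_cst R) (exp_growth R) (K ^+ 2) => a b k; ring.
have EY : expR (exp_growth R * M) <= Y.
  by rewrite /Y YE ler_expR; lra.
have KY : entry_cst R * expR (exp_growth R * M) * expR (2 * L) <= Y.
  rewrite /Y YE !expRD; apply: ler_pM; rewrite ?expR_ge0 ?mulr_ge0 ?expR_ge0//.
  apply: ler_pM; rewrite ?expR_ge0 ?ler_expR//.
  by apply: le_trans cM _; apply: le_trans (expR_ge1Dx _); lra.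
have [b1 b2 b3 b4] := bnd z Dz.
split; first exact: dE.
- exact: (E0 z).1.
- exact: le_trans ((E0 z).2 Dz) EY.
by split; apply: le_trans KY.
Qed.

Lemma ord2_ind (P : 'I_2 -> Prop) : P 0 -> P 1 -> forall i, P i.
Proof.
move=> P0 P1 [[|[|//]] h]; first by rewrite (_ : Ordinal h = 0)//; exact: val_inj.
by rewrite (_ : Ordinal h = 1)//; exact: val_inj.
Qed.

Lemma sum_ord2 (V : nmodType) (F : 'I_2 -> V) : \sum_(i < 2) F i = F 0 + F 1.
Proof.
rewrite !big_ord_recl big_ord0 addr0; congr (_ + F _); exact: val_inj.
Qed.

Lemma opnorm_entries (B : 'M[C]_2) (Y : R) : 0 <= Y -> (forall i j, nc (B i j) <= Y) ->
  opnorm B <= 4 * Y.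
Proof.
move=> Y0 BY; apply: ge_sup.
  exists (l2norm (B *m 0)), 0 => //=.
  by rewrite /l2norm sum_ord2 !mxE nc0 expr0n/= addr0 sqrtr0.
have entry (v : 'cV[C]_2) i : nc (v i 0) <= l2norm v.
  rewrite -(ger0_norm (nc_ge0 (v i 0))) -sqrtr_sqr; apply: ler_wsqrtr.
  rewrite sum_ord2; have h0 := sqr_ge0 (nc (v 0 0)); have h1 := sqr_ge0 (nc (v 1 0)).
  by move: i; apply: ord2_ind; lra.
have l2_le (v : 'cV[C]_2) : l2norm v <= nc (v 0 0) + nc (v 1 0).
  have h0 := nc_ge0 (v 0 0); have h1 := nc_ge0 (v 1 0).
  rewrite -(ger0_norm (addr_ge0 h0 h1)) -sqrtr_sqr; apply: ler_wsqrtr.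
  by rewrite sum_ord2 sqrrD; have := mulr_ge0 h0 h1; lra.
move=> _ [v /= v1 <-]; apply: le_trans (l2_le _) _.
have row i : nc ((B *m v) i 0) <= 2 * Y.
  rewrite mxE sum_ord2; apply: le_trans (ncD _ _) _; rewrite !ncM.
  have h j : nc (B i j) * nc (v j 0) <= Y * 1.
    by apply: ler_pM; rewrite ?nc_ge0//; exact: le_trans (entry v j) v1.
  by have := h 0; have := h 1; lra.
by have := row 0; have := row 1; lra.
Qed.

Lemma cintegral_ae D' (f g : R * R -> C) : measurable D' -> cmeas D' f -> cmeas D' g ->
  {ae mu, forall z : pT R, D' z -> f z = g z} -> cintegral D' f = cintegral D' g.
Proof.
move=> mD' [fr fi] [gr gi] fg.
have mDp := measurable_planeP mD'.
have main (a b : R * R -> R) : measurable_fun D' a -> measurable_fun D' b ->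
    {ae mu, forall z : pT R, D' z -> a z = b z} -> \int[mu]_(z in D') a z = \int[mu]_(z in D') b z.
  move=> ma mb ab; rewrite /Rintegral; congr fine.
  apply: (@ae_eq_integral _ _ R mu D' (EFin \o b) (EFin \o a)) => //.
  - exact: measurable_leb2.
  - exact: measurable_leb2.
  - by apply: filterS ab => z h Dz /=; rewrite h.
rewrite /cintegral; congr (_ +i* _); apply: main => //.
  by apply: filterS fg => z h Dz; rewrite h.
by apply: filterS fg => z h Dz; rewrite h.
Qed.

Lemma Linfty_norm_ae (f : R * R -> C) (M : R) : (Linfty_norm f <= M%:E)%E ->
  {ae mu, forall z : pT R, D z -> nc (f z) <= M}.
Proof.
rewrite /Linfty_norm unlock; case: ifPn => [_ /ess_supP h|].
  apply: filterS h => z h Dz; move: h; rewrite /= patchE mem_set; last exact: open_square_sub.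
  by rewrite lee_fin ger0_norm ?nc_ge0.
(* The other branch of the definition of the norm concerns a null total measure, which the square of
   measure 1 excludes. *)
rewrite -leNgt => h; have : (mu D <= 0)%E.
  apply: le_trans h; apply: le_measure; rewrite ?inE//.
  exact: measurable_planeP (@measurable_open_square R).
by rewrite [X in (X <= _)%E](square_measure R) lee_fin ler10.
Qed.

(** [A] is bounded by [M] only almost everywhere, whereas the construction uses a bound at every
    point of the open square. The truncation has one and agrees with [A] almost everywhere on that
    square, so the weak equation is the same. *)
Definition truncation (M : R) (f : R * R -> C) z : C := if nc (f z) <= M then f z else 0.

Lemma cmeas_truncation M f : cmeas D f -> cmeas D (truncation M f).
Proof.
move=> [mr mi].
have mn : measurable_fun D (fun z => nc (f z) ^+ 2).
  under eq_fun do rewrite nc_sqr.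
  by apply: measurable_funD; exact: measurable_funX.
have mb : measurable_fun D (fun z => (0 <= M) && (nc (f z) ^+ 2 <= M ^+ 2)).
  have [M0|_] := boolP (0 <= M); last exact: measurable_cst.
  by apply: measurable_fun_ler => //; exact: measurable_cst.
have tE z : truncation M f z = if (0 <= M) && (nc (f z) ^+ 2 <= M ^+ 2) then f z else 0.
  rewrite /truncation; have [M0|M0] /= := leP 0 M.
    by rewrite ler_sqr ?nnegrE ?nc_ge0.
  by rewrite leNgt (lt_le_trans M0 (nc_ge0 _)).
have main (g : R * R -> R) : measurable_fun D g ->
    measurable_fun D (fun z => if (0 <= M) && (nc (f z) ^+ 2 <= M ^+ 2) then g z else 0).
  have mD := @measurable_open_square R.
  move=> mg; apply: (measurable_fun_if mD mb); last exact: measurable_cst.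
  exact: measurable_funS mD (@subIsetl _ _ _) mg.
split.
  by under eq_fun do rewrite tE (fun_if (@complex.Re R)); exact: main.
by under eq_fun do rewrite tE (fun_if (@complex.Im R)); exact: main.
Qed.

Lemma truncation_le M f z : 0 <= M -> nc (truncation M f z) <= M.
Proof. by rewrite /truncation; case: ifP => // _; rewrite nc0. Qed.

Lemma bounded_solution (A : R * R -> 'M[C]_2) (M : R) : 0 <= M ->
  (forall i j, cmeasurable_fun (@square R) (fun z => A z i j)) ->
  mx_Linfty_norm A = M%:E ->
  exists P : R * R -> 'M[C]_2,
    [/\ dbar_solution A P, forall z, z \in @square R -> P z \in unitmx &
     let Y := expR (growth_cst * (M ^+ 2 + 1)) in
     (sup_opnorm P + sup_opnorm (fun z => invmx (P z)) <= (4 * Y + 4 * Y ^+ 2)%:E)%E].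
Proof.
move=> M0 mA AM.
have mD := @measurable_open_square R.
have mAD i j : cmeas D (fun z => A z i j).
  have [mr mi] := mA i j.
  have msq : measurable (@square R).
    by apply: measurableX; exact: measurable_itv.
  by split; apply: measurable_funS (@open_square_sub R) _.
have ae_A i j : {ae mu, forall z : pT R, D z -> nc (A z i j) <= M}.
  apply: Linfty_norm_ae; rewrite -AM; apply: ereal_sup_ubound.
  by exists (i, j).
pose B i j := truncation M (fun z => A z i j).
have mB i j : cmeas D (B i j) by exact: cmeas_truncation.
have BM i j z : D z -> nc (B i j z) <= M by move=> _; exact: truncation_le.
have AB i j : {ae mu, forall z : pT R, D z -> B i j z = A z i j}.
  by apply: filterS (ae_A i j) => z h Dz; rewrite /B /truncation h.
have [u0 [u1 [v0 [v1 [E [mu0 mu1 mv0 mv1 hE]]]]]] := fundamental_solution M0 mB BM.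
set Y := expR _ in hE.
have Y1 : 1 <= Y.
  by rewrite /Y -expR0 ler_expR mulr_ge0 ?growth_cst_ge0// addr_ge0// sqr_ge0.
pose e (i j : 'I_2) : R * R -> C := if j == 0 then (if i == 0 then u0 else u1) else (if i == 0 then v0 else v1).
have me i j : mult (e i j) (fun z => B i 0 z * e 0 j z + B i 1 z * e 1 j z).
  by move: i j; apply: ord2_ind; apply: ord2_ind.
(* The weak equation lives in the open square; on its boundary the identity matrix keeps [P]
   invertible and respects the bounds, as [1 <= Y]. *)
pose P z : 'M[C]_2 := if z \in D then \matrix_(i, j) e i j z else 1%:M.
have PD z i j : D z -> P z i j = e i j z by move=> Dz; rewrite /P mem_set// mxE.
(* The adjugate divided by the determinant [E]; its entries are at most [Y * Y]. *)
pose Q z : 'M[C]_2 := if z \in D then \matrix_(i, j)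
    ((E z)^-1 * (if j == 0 then (if i == 0 then v1 z else - u1 z) else (if i == 0 then - v0 z else u0 z)))
  else 1%:M.
have PQ z : P z *m Q z = 1%:M.
  rewrite /P /Q; case: ifPn => [/set_mem Dz|_]; last by rewrite mulmx1.
  have [dE E0 _ _] := hE z Dz.
  apply/matrixP; apply: ord2_ind; apply: ord2_ind; rewrite !mxE sum_ord2 !mxE /e/=.
  - by rewrite -[RHS](divff E0) -[X in _ = X / _]dE; ring.
  - by ring.
  - by ring.
  - by rewrite -[RHS](divff E0) -[X in _ = X / _]dE; ring.
have unitP z : P z \in unitmx by have [] := mulmx1_unit (PQ z).
have invP z : invmx (P z) = Q z by rewrite -[RHS](mulKmx (unitP z)) PQ mulmx1.
exists P; split => //.
- split.
    move=> i j; apply/ccontinuous_inP => z Dz.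
    have [[cf _ _] _] := me i j.
    apply: ccont_near (cf z Dz); last by rewrite PD.
    by apply: filterS (near_open_square Dz) => w Dw; rewrite PD.
  move=> phi /test_function_pair t i j.
  have [bp bP] := mbdd_test t.
  have [[_ be bF] /(_ _ _ t) h] := mult_weak (me i j).
  rewrite (eq_cintegral (g := fun z => e i j z * dbar phi z)); last by move=> z Dz; rewrite PD.
  rewrite h; congr (- _).
  have mPz k : cmeas D (fun z => P z k j).
    apply: (@cmeas_eq _ _ (e k j)) => [z Dz|]; first by rewrite PD.
    by have [[_ [me' _] _] _] := me k j.
  have mAP : cmeas D (fun z => (A z *m P z) i j * (phi z)%:C).
    apply: cmeasM; last exact: bp.1.
    apply: (@cmeas_eq _ _ (fun z => A z i 0 * P z 0 j + A z i 1 * P z 1 j)).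
      by move=> z _; rewrite mxE sum_ord2.
    by apply: cmeasD; exact: cmeasM.
  apply: cintegral_ae => //; first by apply: cmeasM; [exact: bF.1|exact: bp.1].
  apply: filterS2 (AB i 0) (AB i 1) => z h0 h1 Dz.
  by rewrite mxE sum_ord2 !PD// h0// h1.
- have Y0 : 0 <= Y by lra.
  have YY : 1 <= Y ^+ 2 by rewrite expr_ge1.
  have id_le (i j : 'I_2) (K : R) : 1 <= K -> nc ((1%:M : 'M[C]_2) i j) <= K.
    by move=> K1; rewrite mxE; case: eqP => _; rewrite ?nc1 ?nc0//; lra.
  move=> Y2; rewrite [leRHS]EFinD; apply: leeD; apply: ge_ereal_sup => _ [z _ <-]; rewrite lee_fin.
    apply: opnorm_entries => // i j; rewrite /P; case: ifPn => [/set_mem Dz|_]; last exact: id_le.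
    by have [_ _ _ [? ? ? ?]] := hE z Dz; rewrite mxE /e; case: ifP; case: ifP.
  apply: opnorm_entries => [|i j]; first exact: sqr_ge0.
  rewrite invP /Q; case: ifPn => [/set_mem Dz|_]; last exact: id_le.
  have [_ _ eY [? ? ? ?]] := hE z Dz; rewrite mxE ncM expr2; apply: ler_pM; rewrite ?nc_ge0//.
  by case: ifP; case: ifP; rewrite ?ncN.
Qed.

End solution.

(** Every invertible [P] has [|P| + |P^-1| >= 2], while [exp(C M^2 (log M)^2)] tends to 1 as [M]
    tends to 0 or to 1. A lower bound [delta] on [M^2 (log M)^2] keeps away from both, and [C]
    depends on [delta] alone. *)
Theorem proposition2 (R : realType) (delta : R) (delta_gt0 : 0 < delta) :
  exists2 C : R, 0 < C &
    forall (A : R * R -> 'M[R[i]]_2) (M : R),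
      (forall i j, cmeasurable_fun (@square R) (fun z => A z i j)) ->
      mx_Linfty_norm A = M%:E ->
      delta <= M ^+ 2 * ln M ^+ 2 ->
      exists P : R * R -> 'M[R[i]]_2,
        [/\ dbar_solution A P,
            forall z, z \in @square R -> P z \in unitmx &
            (sup_opnorm P + sup_opnorm (fun z => invmx (P z))
               <= (expR (C * M ^+ 2 * ln M ^+ 2))%:E)%E].
Proof.
(* [4 Y + 4 Y^2 <= 8 Y^2]; the 8 is absorbed in [exp(8 (M^2 + 1))] and [Y^2] doubles
   [growth_cst]. *)
pose N : R := 8 + 2 * growth_cst R.
pose K : R := 2 + (expR 1 ^+ 2 + 1) / delta.
have g0 := growth_cst_ge0 R.
have N0 : 0 < N by rewrite /N; lra.
have x0 : 0 <= (expR 1 ^+ 2 + 1) / delta.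
  by rewrite divr_ge0 ?(ltW delta_gt0)// addr_ge0// sqr_ge0.
have K0 : 0 < K by rewrite /K; lra.
exists (N * K); first exact: mulr_gt0.
move=> A M mA AM dM.
(* [ln] is 0 on nonpositive numbers, so [M <= 0] would contradict [0 < delta]. *)
have M0 : 0 < M.
  rewrite ltNge; apply/negP => M0; move: dM; rewrite ln0// expr0n/= mulr0; lra.
have [P [sP uP bP]] := bounded_solution (ltW M0) mA AM.
exists P; split => //; apply: le_trans bP _; rewrite lee_fin.
set X := M ^+ 2 * ln M ^+ 2 in dM.
have M2 := sqr_ge0 M.
have main : M ^+ 2 + 1 <= K * X.
  have X0 : 0 <= X by apply: le_trans dM; exact: ltW.
  (* For [M >= exp 1] the logarithm is at least 1 and [M^2 + 1 <= 2 X]; otherwise [M^2 + 1] is at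
     most the constant [exp(1)^2 + 1], which is compared with [X >= delta]. The two terms of [K]
     serve these two cases. *)
  have [eM|Me] := leP (expR 1) M.
    have l1 : 1 <= ln M by rewrite -[leLHS]expRK ler_ln ?posrE ?expR_gt0.
    have M1 : 1 <= M ^+ 2.
      by rewrite expr_ge1//; apply: le_trans eM; apply: le_trans (expR_ge1Dx _); lra.
    have XM : M ^+ 2 <= X by rewrite /X ler_peMr// expr_ge1//; lra.
    apply: (@le_trans _ _ (2 * X)); first lra.
    by rewrite ler_wpM2r// /K lerDl.
  apply: (@le_trans _ _ (expR 1 ^+ 2 + 1)).
    by rewrite lerD2r lerXn2r ?nnegrE ?expR_ge0 ?ltW.
  apply: (@le_trans _ _ ((expR 1 ^+ 2 + 1) / delta * X)).
    by rewrite mulrAC ler_pdivlMr// ler_wpM2l// addr_ge0// sqr_ge0.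
  by rewrite ler_wpM2r// /K lerDr.
have -> : N * K * M ^+ 2 * ln M ^+ 2 = N * (K * X) by rewrite /X; ring.
apply: (@le_trans _ _ (expR (N * (M ^+ 2 + 1)))); last by rewrite ler_expR ler_wpM2l// ltW.
have Y1 : 1 <= expR (growth_cst R * (M ^+ 2 + 1)).
  by rewrite -expR0 ler_expR mulr_ge0// addr_ge0.
have -> : N * (M ^+ 2 + 1) = 8 * (M ^+ 2 + 1) + (growth_cst R * (M ^+ 2 + 1) + growth_cst R * (M ^+ 2 + 1)).
  by rewrite /N; ring.
rewrite !expRD -expr2; move: (expR (growth_cst R * _)) Y1 => Y Y1.
have YY : Y <= Y ^+ 2 by rewrite expr2 ler_peMl//; lra.
apply: (@le_trans _ _ (8 * Y ^+ 2)); first lra.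
rewrite ler_wpM2r ?sqr_ge0//; apply: le_trans (expR_ge1Dx _); lra.
Qed.
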